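(* Let $X$ be a complex Banach space with open unit ball $\mathbb{B}$. Let $\Phi:\mathbb{U}\to\mathbb{C}$ be a biholomorphic function onto its image with $\Phi(0)=1$, $\operatorname{Re}\Phi(z)>0$ on $\mathbb{U}$, $\Phi'(0)>0$, $\Phi''(0)\in\mathbb{R}$, and suppose that $$|\Phi''(0)+2(\Phi'(0))^2|\ge 2\Phi'(0).$$ Let $g:\mathbb{B}\to\mathbb{C}$ be holomorphic with $g(0)=1$, let $G(z)=z\,g(z)$, and suppose that $(DG(z))^{-1}G(z)\in\mathcal{M}_\Phi$. Then for all $z\in\mathbb{B}\setminus\{0\}$ and $l_z\in T_z$, $$\left|\left(\frac{l_z(D^2G(0)(z^2))}{2!\,\|z\|^2}\right)^2-\left(\frac{l_z(D^3G(0)(z^3))}{3!\,\|z\|^3}\right)^2\right|\le\frac{(\Phi'(0))^2}{4}\left(\frac12\frac{\Phi''(0)}{\Phi'(0)}+\Phi'(0)\right)^2+(\Phi'(0))^2.$$ The bound is sharp, i.e. for each such $\Phi$ equality holds for some such $g$ and some $z\in\mathbb{B}\setminus\{0\}$, $l_z\in T_z$.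
   Context: $\mathbb{U}$ is the open unit disk in $\mathbb{C}$; $X$ is a (nonzero) complex Banach space with norm $\|\cdot\|$ and $\mathbb{B}=\{z\in X:\|z\|<1\}$. For $z\in X\setminus\{0\}$, $T_z=\{l_z\in L(X,\mathbb{C}): l_z(z)=\|z\|,\ \|l_z\|=1\}$, where $L(X,\mathbb{C})$ is the set of continuous linear functionals. $D^kG(0)$ is the $k$-th Fréchet derivative of $G$ at $0$ (a bounded symmetric $k$-linear map), and $D^kG(0)(z^k)=D^kG(0)(z,\dots,z)$ ($k$ times). $\mathcal{M}_\Phi$ is the class of holomorphic mappings $p:\mathbb{B}\to X$ with $p(0)=0$, $Dp(0)=I$ (the identity) and $\|z\|/l_z(p(z))\in\Phi(\mathbb{U})$ for all $z\in\mathbb{B}\setminus\{0\}$, $l_z\in T_z$. The condition $(DG(z))^{-1}G(z)\in\mathcal{M}_\Phi$ includes that $DG(z)$ has a bounded inverse for every $z\in\mathbb{B}$. *)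

(* Defs.v *)
From Stdlib Require Import Reals Lra.
From Stdlib Require Import ClassicalEpsilon FunctionalExtensionality ProofIrrelevance.
From Coquelicot Require Import Coquelicot.

Open Scope R_scope.

Notation CNormedModule := (NormedModule C_AbsRing).
Notation CBanach := (CompleteNormedModule C_AbsRing).

Section Bounded_operators.

Variables U V : CNormedModule.

(* Coquelicot's [is_linear] includes boundedness. *)
Record Lin := mkLin { lin_fun :> U -> V; lin_is_linear : is_linear lin_fun }.

Lemma Lin_ext (A B : Lin) : (forall x, A x = B x) -> A = B.
Proof.
  destruct A as [f Hf], B as [g Hg]; simpl; intros H.
  assert (E : f = g) by (apply functional_extensionality; exact H).
  subst g; f_equal; apply proof_irrelevance.
Qed.

Lemma Lin_plus_linear (A B : Lin) : is_linear (fun x => plus (A x) (B x)).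
Proof.
  destruct A as [f [Hf1 Hf2 [M [HM Hf3]]]], B as [g [Hg1 Hg2 [N [HN Hg3]]]]; simpl.
  split.
  - intros x y; rewrite Hf1, Hg1, <- !plus_assoc; f_equal.
    rewrite !plus_assoc; f_equal; apply plus_comm.
  - intros k x; rewrite Hf2, Hg2; symmetry;
      exact (scal_distr_l (V := NormedModule.ModuleSpace _ V) _ _ _).
  - exists (M + N); split; [lra|]; intros x.
    apply Rle_trans with (1 := norm_triangle _ _).
    specialize (Hf3 x); specialize (Hg3 x); lra.
Qed.

Lemma Lin_scal_linear (k : C) (A : Lin) :
  is_linear (fun x => scal (k : C_AbsRing) (A x)).
Proof.
  destruct A as [f [Hf1 Hf2 [M [HM Hf3]]]]; simpl.
  split.
  - intros x y; rewrite Hf1; exact (scal_distr_l (V := NormedModule.ModuleSpace _ V) _ _ _).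
  - intros j x; rewrite Hf2, !scal_assoc; f_equal; apply Cmult_comm.
  - exists ((Cmod k + 1) * M); split.
    + apply Rmult_lt_0_compat; [pose proof (Cmod_ge_0 k); lra | exact HM].
    + intros x.
      apply Rle_trans with (1 := norm_scal (K := C_AbsRing) k (f x)).
      rewrite Rmult_assoc.
      change (abs (k : C_AbsRing)) with (Cmod k).
      apply Rmult_le_compat; [apply Cmod_ge_0 | apply norm_ge_0 | lra | apply Hf3].
Qed.

Lemma Lin_zero_linear : is_linear (fun _ : U => zero : V).
Proof. exact is_linear_zero. Qed.

Definition Lin_zero : Lin := mkLin _ Lin_zero_linear.
Definition Lin_plus (A B : Lin) : Lin := mkLin _ (Lin_plus_linear A B).
Definition Lin_scal (k : C) (A : Lin) : Lin := mkLin _ (Lin_scal_linear k A).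
Definition Lin_opp (A : Lin) : Lin := Lin_scal (opp (one : C_AbsRing)) A.

Lemma Lin_plus_comm (A B : Lin) : Lin_plus A B = Lin_plus B A.
Proof. apply Lin_ext; intros x; apply plus_comm. Qed.

Lemma Lin_plus_assoc (A B D : Lin) :
  Lin_plus A (Lin_plus B D) = Lin_plus (Lin_plus A B) D.
Proof. apply Lin_ext; intros x; apply plus_assoc. Qed.

Lemma Lin_plus_zero_r (A : Lin) : Lin_plus A Lin_zero = A.
Proof. apply Lin_ext; intros x; apply plus_zero_r. Qed.

Lemma Lin_plus_opp_r (A : Lin) : Lin_plus A (Lin_opp A) = Lin_zero.
Proof.
  apply Lin_ext; intros x; simpl.
  rewrite (scal_opp_one (V := NormedModule.ModuleSpace _ V)).
  exact (plus_opp_r (G := NormedModule.AbelianGroup _ V) _).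
Qed.

Definition Lin_AbelianMonoid_mixin :=
  AbelianMonoid.Mixin Lin Lin_plus Lin_zero
    Lin_plus_comm Lin_plus_assoc Lin_plus_zero_r.

Canonical Lin_AbelianMonoid :=
  AbelianMonoid.Pack Lin Lin_AbelianMonoid_mixin Lin.

Definition Lin_AbelianGroup_mixin :=
  AbelianGroup.Mixin Lin_AbelianMonoid Lin_opp Lin_plus_opp_r.

Canonical Lin_AbelianGroup :=
  AbelianGroup.Pack Lin
    (AbelianGroup.Class _ Lin_AbelianMonoid_mixin Lin_AbelianGroup_mixin) Lin.

Lemma Lin_scal_assoc (j k : (AbsRing.Ring C_AbsRing)) (A : Lin) :
  Lin_scal j (Lin_scal k A) = Lin_scal (mult j k) A.
Proof. apply Lin_ext; intros x; exact (scal_assoc (V := NormedModule.ModuleSpace _ V) _ _ _). Qed.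

Lemma Lin_scal_one (A : Lin) : Lin_scal (one : (AbsRing.Ring C_AbsRing)) A = A.
Proof. apply Lin_ext; intros x; exact (scal_one (V := NormedModule.ModuleSpace _ V) _). Qed.

Lemma Lin_scal_distr_l (k : (AbsRing.Ring C_AbsRing)) (A B : Lin_AbelianGroup) :
  Lin_scal k (plus A B) = plus (Lin_scal k A) (Lin_scal k B).
Proof. apply Lin_ext; intros x; exact (scal_distr_l (V := NormedModule.ModuleSpace _ V) _ _ _). Qed.

Lemma Lin_scal_distr_r (j k : (AbsRing.Ring C_AbsRing)) (A : Lin_AbelianGroup) :
  Lin_scal (plus j k) A = plus (Lin_scal j A) (Lin_scal k A).
Proof. apply Lin_ext; intros x; exact (scal_distr_r (V := NormedModule.ModuleSpace _ V) _ _ _). Qed.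

Definition Lin_ModuleSpace_mixin :=
  ModuleSpace.Mixin (AbsRing.Ring C_AbsRing) Lin_AbelianGroup Lin_scal
    Lin_scal_assoc Lin_scal_one Lin_scal_distr_l Lin_scal_distr_r.

Canonical Lin_ModuleSpace :=
  ModuleSpace.Pack (AbsRing.Ring C_AbsRing) Lin
    (ModuleSpace.Class _ _ (AbelianGroup.class Lin_AbelianGroup)
       Lin_ModuleSpace_mixin) Lin.

Definition Lin_bound (A : Lin) (M : R) : Prop :=
  0 <= M /\ forall x, norm (A x) <= M * norm x.

(* The operator norm, as the least bound of [A]. *)
Definition Lin_norm (A : Lin) : R := real (Glb_Rbar (Lin_bound A)).

Lemma Lin_norm_glb (A : Lin) : is_glb_Rbar (Lin_bound A) (Lin_norm A).
Proof.
  unfold Lin_norm.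
  destruct (lin_is_linear A) as [_ _ [M [HM HA]]].
  pose proof (Glb_Rbar_correct (Lin_bound A)) as H.
  assert (H0 : Rbar_le 0 (Glb_Rbar (Lin_bound A)))
    by (apply (proj2 H); intros N [HN _]; exact HN).
  assert (H1 : Rbar_le (Glb_Rbar (Lin_bound A)) M)
    by (apply (proj1 H); split; [lra | exact HA]).
  destruct (Glb_Rbar (Lin_bound A)); simpl in *; tauto.
Qed.

Lemma Lin_norm_le (A : Lin) (M : R) : Lin_bound A M -> Lin_norm A <= M.
Proof. intros H; exact (proj1 (Lin_norm_glb A) M H). Qed.

Lemma Lin_norm_bound (A : Lin) : Lin_bound A (Lin_norm A).
Proof.
  split.
  - assert (H : Rbar_le 0 (Lin_norm A)); [|exact H].
    apply (proj2 (Lin_norm_glb A)); intros N [HN _]; exact HN.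
  - intros x.
    destruct (norm_ge_0 x) as [Hx | Hx].
    + apply Rmult_le_reg_r with (/ norm x); [now apply Rinv_0_lt_compat|].
      rewrite Rmult_assoc, Rinv_r, Rmult_1_r; [|lra].
      assert (H : Rbar_le (norm (A x) * / norm x) (Lin_norm A)); [|exact H].
      apply (proj2 (Lin_norm_glb A)); intros N [_ HN]; simpl.
      apply Rmult_le_reg_r with (norm x); [exact Hx|].
      rewrite Rmult_assoc, Rinv_l, Rmult_1_r; [apply HN | lra].
    + destruct (lin_is_linear A) as [_ _ [M [_ HA]]].
      specialize (HA x); rewrite <- Hx in *; lra.
Qed.

Lemma Lin_norm_triangle (A B : Lin_ModuleSpace) :
  Lin_norm (plus A B) <= Lin_norm A + Lin_norm B.
Proof.
  destruct (Lin_norm_bound A) as [HA0 HA], (Lin_norm_bound B) as [HB0 HB].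
  apply Lin_norm_le; split; [lra|]; intros x.
  apply Rle_trans with (1 := norm_triangle (A x) (B x)).
  specialize (HA x); specialize (HB x); lra.
Qed.

Lemma Lin_norm_scal (k : C_AbsRing) (A : Lin_ModuleSpace) :
  Lin_norm (scal k A) <= abs k * Lin_norm A.
Proof.
  destruct (Lin_norm_bound A) as [HA0 HA].
  apply Lin_norm_le; split.
  - apply Rmult_le_pos; [apply abs_ge_0 | exact HA0].
  - intros x.
    apply Rle_trans with (1 := norm_scal k (A x)).
    rewrite Rmult_assoc.
    apply Rmult_le_compat_l; [apply abs_ge_0 | apply HA].
Qed.

Lemma Lin_norm_eq_zero (A : Lin_ModuleSpace) : Lin_norm A = 0 -> A = zero.
Proof.
  intros H; apply Lin_ext; intros x; apply norm_eq_zero.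
  apply Rle_antisym; [|apply norm_ge_0].
  pose proof (proj2 (Lin_norm_bound A) x) as Hx; rewrite H in Hx; lra.
Qed.

Definition Lin_ball (A : Lin_ModuleSpace) (e : R) (B : Lin_ModuleSpace) : Prop :=
  Lin_norm (minus B A) < e.

Lemma Lin_ball_center (A : Lin_ModuleSpace) (e : posreal) : Lin_ball A e A.
Proof.
  unfold Lin_ball; rewrite minus_eq_zero.
  apply Rle_lt_trans with 0; [|apply cond_pos].
  apply Lin_norm_le; split; [lra|]; intros x.
  change (norm (zero : V) <= 0 * norm x); rewrite norm_zero; lra.
Qed.

Lemma Lin_ball_sym (A B : Lin_ModuleSpace) (e : R) : Lin_ball A e B -> Lin_ball B e A.
Proof.
  unfold Lin_ball; intros H.
  apply Rle_lt_trans with (2 := H).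
  rewrite <- opp_minus, <- (scal_opp_one (V := Lin_ModuleSpace)).
  apply Rle_trans with (1 := Lin_norm_scal _ _).
  rewrite abs_opp_one, Rmult_1_l; apply Rle_refl.
Qed.

Lemma Lin_ball_triangle (A B D : Lin_ModuleSpace) (e1 e2 : R) :
  Lin_ball A e1 B -> Lin_ball B e2 D -> Lin_ball A (e1 + e2) D.
Proof.
  unfold Lin_ball; intros H1 H2.
  rewrite (minus_trans B D A).
  apply Rle_lt_trans with (1 := Lin_norm_triangle _ _); lra.
Qed.

Definition Lin_UniformSpace_mixin :=
  UniformSpace.Mixin Lin (zero : Lin_ModuleSpace) Lin_ball
    Lin_ball_center Lin_ball_sym Lin_ball_triangle.

Canonical Lin_UniformSpace :=
  UniformSpace.Pack Lin Lin_UniformSpace_mixin Lin.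

Canonical Lin_NormedModuleAux :=
  NormedModuleAux.Pack C_AbsRing Lin
    (NormedModuleAux.Class C_AbsRing Lin
       (ModuleSpace.class _ Lin_ModuleSpace) Lin_UniformSpace_mixin) Lin.

Lemma Lin_norm_ball (A B : Lin_NormedModuleAux) (e : R) :
  Lin_norm (minus B A) < e -> ball A e B.
Proof. intros H; exact H. Qed.

Lemma Lin_ball_norm (A B : Lin_NormedModuleAux) (e : posreal) :
  ball A e B -> Lin_norm (minus B A) < 1 * e.
Proof. intros H; rewrite Rmult_1_l; exact H. Qed.

Definition Lin_NormedModule_mixin :=
  NormedModule.Mixin C_AbsRing Lin_NormedModuleAux Lin_norm 1
    Lin_norm_triangle Lin_norm_scal Lin_norm_ball Lin_ball_norm Lin_norm_eq_zero.

Canonical Lin_NormedModule : CNormedModule :=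
  NormedModule.Pack C_AbsRing Lin
    (NormedModule.Class C_AbsRing Lin
       (NormedModuleAux.class _ Lin_NormedModuleAux) Lin_NormedModule_mixin) Lin.

End Bounded_operators.

Arguments lin_fun {U V} _ _.
Arguments lin_is_linear {U V} _.

(* The Fréchet derivative of [f] at [x]; a junk value if [f] is not
   differentiable at [x]. *)
Definition Frechet {U V : CNormedModule} (f : U -> V) (x : U) : Lin U V :=
  epsilon (inhabits (Lin_zero U V)) (fun A : Lin U V => filterdiff f (locally x) A).

(* [MultLin U V k] is L(U, L(U, ..., L(U, V))) with k factors U. *)
Fixpoint MultLin (U V : CNormedModule) (k : nat) : CNormedModule :=
  match k with
  | O => V
  | S k => Lin_NormedModule U (MultLin U V k)
  end.

Fixpoint Frechet_n {U V : CNormedModule} (k : nat) (f : U -> V) :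
    U -> MultLin U V k :=
  match k with
  | O => f
  | S k => Frechet (Frechet_n k f)
  end.

(* A(z^k) = A(z, ..., z). *)
Fixpoint diag {U V : CNormedModule} (k : nat) : MultLin U V k -> U -> V :=
  match k with
  | O => fun A _ => A
  | S k => fun A z => diag k (lin_fun A z) z
  end.

Definition unit_disk (u : C) : Prop := Cmod u < 1.

Definition unit_ball {U : CNormedModule} (z : U) : Prop := norm z < 1.

Definition holomorphic_on_ball {U V : CNormedModule} (f : U -> V) : Prop :=
  forall z : U, unit_ball z -> ex_filterdiff f (locally z).

Definition disk_image (Phi : C -> C) (w : C) : Prop :=
  exists u : C, unit_disk u /\ w = Phi u.

Definition biholomorphic_onto_image (Phi : C -> C) : Prop :=
  (forall u : C, unit_disk u -> ex_derive (K := C_AbsRing) Phi u) /\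
  open (disk_image Phi) /\
  exists Psi : C -> C,
    (forall u : C, unit_disk u -> Psi (Phi u) = u) /\
    (forall w : C, disk_image Phi w -> ex_derive (K := C_AbsRing) Psi w).

Definition is_inverse {U : CNormedModule} (A B : Lin U U) : Prop :=
  (forall x, A (B x) = x) /\ (forall x, B (A x) = x).

Definition invertible {U : CNormedModule} (A : Lin U U) : Prop :=
  exists B : Lin U U, is_inverse A B.

Definition Lin_inv {U : CNormedModule} (A : Lin U U) : Lin U U :=
  epsilon (inhabits (Lin_zero U U)) (is_inverse A).

(* [norm l] is the operator norm of the functional [l]. *)
Definition support_functional {U : CNormedModule} (z : U)
    (l : Lin U C_NormedModule) : Prop :=
  l z = RtoC (norm z) /\ norm l = 1.

(* The class M_Phi; [l (p z) <> 0] makes the quotient meaningful, since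
   division by 0 is total in Coquelicot. *)
Definition class_M {U : CNormedModule} (Phi : C -> C) (p : U -> U) : Prop :=
  holomorphic_on_ball p /\
  p zero = zero /\
  (forall h : U, Frechet p zero h = h) /\
  forall (z : U) (l : Lin U C_NormedModule),
    unit_ball z -> z <> zero -> support_functional z l ->
    l (p z) <> RtoC 0 /\ disk_image Phi (RtoC (norm z) / l (p z))%C.

Definition zmul {U : CNormedModule} (g : U -> C) (z : U) : U :=
  scal (g z : C_AbsRing) z.

(* The hypotheses on g, with G = zmul g. *)
Definition admissible {U : CNormedModule} (Phi : C -> C) (g : U -> C) : Prop :=
  holomorphic_on_ball (V := C_NormedModule) g /\
  g zero = RtoC 1 /\
  (forall z : U, unit_ball z -> invertible (Frechet (zmul g) z)) /\
  class_M Phi (fun z : U => Lin_inv (Frechet (zmul g) z) (zmul g z)).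

(* l(D^k G(0)(z^k)) / (k! ||z||^k). *)
Definition normalized_coef {U : CNormedModule} (k : nat) (G : U -> U)
    (l : Lin U C_NormedModule) (z : U) : C :=
  (l (diag k (Frechet_n k G zero) z) / RtoC (INR (Factorial.fact k) * norm z ^ k))%C.

(* Main.v *)
Require Import Defs.
From Stdlib Require Import Reals Lra Lia Psatz List ClassicalEpsilon.
From mathcomp Require classical.classical_sets classical.boolp.
From Coquelicot Require Import Coquelicot.
Import ListNotations.
Open Scope R_scope.

(** For [G = z g(z)] one has [DG(z) z = (g(z) + Dg(z) z) z], so on the line through a unit
    vector [u] the hypothesis says that [h(w) = g(w u)] satisfies [1 + w h'(w) / h(w) = Phi(om(w))]
    with [om] a holomorphic self-map of the disk fixing [0].  If [om = w1 w + w2 w^2 + ...], the two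
    normalized coefficients are [h'(0) = a w1] and [h''(0)/2 = (a/2) (w2 + lam w1^2)] with
    [lam = b/(2a) + a].  Since [|w2| <= 1 - |w1|^2] and [|lam| >= 1], they are bounded by [a] and
    [a |lam| / 2], and [om(w) = i w] makes both bounds sharp with squares of opposite sign.

    The derivatives [D^2 G(0)] and [D^3 G(0)] exist because Fréchet derivatives of holomorphic maps
    are holomorphic: Goursat's lemma in logarithmic coordinates gives the first Cauchy coefficient
    formula, hence uniform quadratic remainders, first for scalar slices and then, by Hahn-Banach,
    in norm; a directional derivative is thus a uniform limit of holomorphic difference quotients. *)

(** * Linear identities and Fréchet derivatives *)

(** The hypothesis [|b + 2 a^2| >= 2 a] says exactly [|lam| >= 1]. As [|w2 + lam w1^2| <= 1 - |w1|^2
    + |lam| |w1|^2], it moves the maximum of the second coefficient to [|w1| = 1], where the first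
    one is maximal too, so nothing is lost by bounding the two squares separately. At [|w1| = 1] one
    has [om(w) = c w]; the squares are positive multiples of [c^2] and [c^4], and these are opposite
    just when [c^2 = -1]. The support functional erases the dimension: applied to [DG(x)^-1 G(x)] it
    only sees the eigenvalue of [DG(x)] at the eigenvector [x]. Conversely, a one-variable solution
    [h] lifts to [g(x) = h(l(x))], where [h] is the exponential of a primitive of
    [(Phi(i w) - 1) / w]; [Re Phi > 0] keeps [DG] invertible. As [Frechet] picks a derivative by
    [epsilon], nothing can be said about [D^2 G(0)] and [D^3 G(0)] before existence is proved. For
    this the remainder of a directional derivative must be uniform in the direction, and [L(U, V)]
    must inherit completeness so that the argument can be iterated. *)

Inductive mexp :=
  | MVar (n : nat) | MZero | MPlus (e f : mexp) | MOpp (e : mexp) | MScal (c : C) (e : mexp).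

Fixpoint mcoef (e : mexp) (n : nat) : C :=
  match e with
  | MVar m => if Nat.eqb m n then RtoC 1 else RtoC 0
  | MZero => RtoC 0
  | MPlus e f => (mcoef e n + mcoef f n)%C
  | MOpp e => (- mcoef e n)%C
  | MScal c e => (c * mcoef e n)%C
  end.

Section Module_identities.

Variable V : CNormedModule.

Fixpoint mden (env : list V) (e : mexp) : V :=
  match e with
  | MVar n => nth n env zero
  | MZero => zero
  | MPlus e f => plus (mden env e) (mden env f)
  | MOpp e => opp (mden env e)
  | MScal c e => scal (c : C_AbsRing) (mden env e)
  end.

Fixpoint lincomb (f : nat -> C) (k : nat) (l : list V) : V :=
  match l with
  | [] => zero
  | v :: l => plus (scal (f k : C_AbsRing) v) (lincomb f (S k) l)
  end.

(** Compares only the indices of actual atoms, so that [cbn] unfolds it to one scalar equation per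
    atom instead of a statement about all indices. *)
Fixpoint coefs_eq (f g : nat -> C) (k : nat) (l : list V) : Prop :=
  match l with
  | [] => True
  | _ :: l => f k = g k /\ coefs_eq f g (S k) l
  end.

Lemma lincomb_zero f k l : (forall n, (k <= n)%nat -> f n = RtoC 0) -> lincomb f k l = zero.
Proof.
  revert k; induction l as [|v l IH]; intros k H; simpl; [reflexivity|].
  rewrite IH by (intros n Hn; apply H; lia).
  rewrite H by lia; rewrite plus_zero_r.
  exact (scal_zero_l (V := NormedModule.ModuleSpace _ V) v).
Qed.

Lemma lincomb_plus f g k l :
  lincomb (fun n => (f n + g n)%C) k l = plus (lincomb f k l) (lincomb g k l).
Proof.
  revert k; induction l as [|v l IH]; intros k; simpl; [now rewrite plus_zero_r|].
  rewrite IH.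
  rewrite (scal_distr_r (V := NormedModule.ModuleSpace _ V) (f k : C_AbsRing) (g k : C_AbsRing) v
    : scal ((f k + g k)%C : C_AbsRing) v = _).
  rewrite <- !plus_assoc; f_equal; rewrite !plus_assoc; f_equal; apply plus_comm.
Qed.

Lemma lincomb_scal c f k l :
  lincomb (fun n => (c * f n)%C) k l = scal (c : C_AbsRing) (lincomb f k l).
Proof.
  revert k; induction l as [|v l IH]; intros k; simpl.
  - symmetry; exact (scal_zero_r (V := NormedModule.ModuleSpace _ V) _).
  - rewrite IH, (scal_distr_l (V := NormedModule.ModuleSpace _ V)); f_equal.
    symmetry; exact (scal_assoc (V := NormedModule.ModuleSpace _ V) _ _ _).
Qed.

Lemma lincomb_ext f g k l : coefs_eq f g k l -> lincomb f k l = lincomb g k l.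
Proof.
  revert k; induction l as [|v l IH]; intros k; simpl; [reflexivity|].
  intros [-> H]; now rewrite IH.
Qed.

Lemma coefs_eq_all f g k l : (forall n, f n = g n) -> coefs_eq f g k l.
Proof. intros H; revert k; induction l; intros k; simpl; auto. Qed.

Lemma lincomb_var m k l :
  lincomb (fun n => if Nat.eqb (k + m) n then RtoC 1 else RtoC 0) k l = nth m l zero.
Proof.
  revert m k; induction l as [|v l IH]; intros [|m] k; simpl; try reflexivity.
  - rewrite Nat.add_0_r, Nat.eqb_refl.
    rewrite lincomb_zero, plus_zero_r; [exact (scal_one (V := NormedModule.ModuleSpace _ V) _)|].
    intros n Hn; destruct (Nat.eqb_spec k n); [lia | reflexivity].
  - destruct (Nat.eqb_spec (k + S m) k); [lia|].
    replace (k + S m)%nat with (S k + m)%nat by lia.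
    rewrite IH, (scal_zero_l (V := NormedModule.ModuleSpace _ V) v
      : scal (RtoC 0 : C_AbsRing) v = zero).
    apply plus_zero_l.
Qed.

Lemma mden_lincomb env e : mden env e = lincomb (mcoef e) 0 env.
Proof.
  induction e as [m| |e IHe f IHf|e IHe|c e IHe]; simpl.
  - symmetry; exact (lincomb_var m 0 env).
  - symmetry; apply lincomb_zero; reflexivity.
  - rewrite IHe, IHf; symmetry; exact (lincomb_plus _ _ _ _).
  - rewrite IHe, <- (scal_opp_one (V := NormedModule.ModuleSpace _ V)).
    rewrite <- (lincomb_scal (opp (one : C_AbsRing))).
    apply lincomb_ext, coefs_eq_all; intros n; simpl.
    change (opp (one : C_AbsRing)) with (- RtoC 1)%C; ring.
  - rewrite IHe; symmetry; exact (lincomb_scal _ _ _ _).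
Qed.

(** Soundness of the reflective tactics below: both sides have the normal form [lincomb] of their
    coefficients. *)
Lemma mden_eq env e f : coefs_eq (mcoef e) (mcoef f) 0 env -> mden env e = mden env f.
Proof. rewrite !mden_lincomb; apply lincomb_ext. Qed.

End Module_identities.

(** * Tactics for identities in a normed module *)

Ltac m_index x l :=
  lazymatch l with
  | x :: _ => constr:(O)
  | _ :: ?l => let n := m_index x l in constr:(S n)
  end.

Ltac m_insert x l :=
  let rec mem l' :=
    lazymatch l' with
    | [] => constr:(x :: l)
    | x :: _ => l
    | _ :: ?l'' => mem l''
    end in mem l.

Ltac m_atoms e l :=
  lazymatch e with
  | plus ?a ?b => let l := m_atoms a l in m_atoms b l
  | minus ?a ?b => let l := m_atoms a l in m_atoms b l
  | opp ?a => m_atoms a l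
  | scal ?c ?a => m_atoms a l
  | zero => l
  | ?x => m_insert x l
  end.

Ltac m_reify e l :=
  lazymatch e with
  | plus ?a ?b => let a := m_reify a l in let b := m_reify b l in constr:(MPlus a b)
  | minus ?a ?b => let a := m_reify a l in let b := m_reify b l in constr:(MPlus a (MOpp b))
  | opp ?a => let a := m_reify a l in constr:(MOpp a)
  | scal ?c ?a => let a := m_reify a l in constr:(MScal c a)
  | zero => constr:(MZero)
  | ?x => let n := m_index x l in constr:(MVar n)
  end.

(* Identities between linear combinations in [V], one scalar goal per atom. *)
Ltac module_coefs V :=
  lazymatch goal with
  | |- ?a = ?b =>
    let l := m_atoms a (@nil (NormedModule.sort C_AbsRing V)) in
    let l := m_atoms b l in
    let ea := m_reify a l in
    let eb := m_reify b l in
    refine (mden_eq V l ea eb _);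
    cbn [coefs_eq mcoef Nat.eqb];
    repeat split
  end.

Ltac module_eq V := module_coefs V; ring.

(* Brings the operations of [V] to one and the same structure on [V]. *)
Ltac mnorm V :=
  let G := constr:(NormedModule.AbelianMonoid C_AbsRing V) in
  let A := constr:(NormedModule.AbelianGroup C_AbsRing V) in
  let M := constr:(NormedModule.ModuleSpace C_AbsRing V) in
  let K := constr:(AbsRing.Ring C_AbsRing) in
  let unless a b := lazymatch a with b => fail | _ => idtac end in
  repeat match goal with
  | H : context [@plus ?g ?x ?y] |- _ => unless g G; change (@plus g x y) with (@plus G x y) in H
  | |- context [@plus ?g ?x ?y] => unless g G; change (@plus g x y) with (@plus G x y)
  | H : context [@zero ?g] |- _ => unless g G; change (@zero g) with (@zero G) in H
  | |- context [@zero ?g] => unless g G; change (@zero g) with (@zero G)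
  | H : context [@opp ?a ?x] |- _ => unless a A; change (@opp a x) with (@opp A x) in H
  | |- context [@opp ?a ?x] => unless a A; change (@opp a x) with (@opp A x)
  | H : context [@minus ?a ?x ?y] |- _ => unless a A; change (@minus a x y) with (@minus A x y) in H
  | |- context [@minus ?a ?x ?y] => unless a A; change (@minus a x y) with (@minus A x y)
  | H : context [@scal ?k ?m ?c ?x] |- _ =>
      first [unless k K | unless m M]; change (@scal k m c x) with (@scal K M c x) in H
  | |- context [@scal ?k ?m ?c ?x] =>
      first [unless k K | unless m M]; change (@scal k m c x) with (@scal K M c x)
  end.

Tactic Notation "vreplace" constr(V) ":" uconstr(a) "with" uconstr(b) :=
  let E := fresh in
  assert (E : @eq (NormedModule.sort C_AbsRing V) a b) by module_eq V;
  cbn beta in E; mnorm V; rewrite E; clear E.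

Tactic Notation "vreplace" constr(V) ":" uconstr(a) "with" uconstr(b) "in" hyp(H) :=
  let E := fresh in
  assert (E : @eq (NormedModule.sort C_AbsRing V) a b) by module_eq V;
  cbn beta in E; mnorm V; rewrite E in H; clear E.

Lemma scal_C_assoc {V : CNormedModule} (c d : C) (x : V) :
  scal (c : C_AbsRing) (scal (d : C_AbsRing) x) = scal ((c * d)%C : C_AbsRing) x.
Proof. module_eq V. Qed.

Lemma scal_C_one {V : CNormedModule} (x : V) : scal (RtoC 1 : C_AbsRing) x = x.
Proof. module_eq V. Qed.

Lemma scal_C_zero {V : CNormedModule} (x : V) : @eq V (scal (RtoC 0 : C_AbsRing) x) zero.
Proof. module_eq V. Qed.

(** The axioms of a normed module only bound the left side by the right one; the converse is the
    same bound for the scalar [/ c]. *)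
Lemma norm_scal_C {V : CNormedModule} (c : C) (x : V) :
  norm (scal (c : C_AbsRing) x) = Cmod c * norm x.
Proof.
  apply Rle_antisym; [exact (norm_scal (K := C_AbsRing) c x)|].
  destruct (Ceq_dec c (RtoC 0)) as [-> | Hc].
  - rewrite Cmod_0, Rmult_0_l; apply norm_ge_0.
  - pose proof (norm_scal (K := C_AbsRing) (/ c)%C (scal (c : C_AbsRing) x)) as H.
    rewrite scal_C_assoc, Cinv_l, scal_C_one in H by exact Hc.
    change (abs ((/ c)%C : C_AbsRing)) with (Cmod (/ c)) in H.
    rewrite Cmod_inv in H by exact Hc.
    apply Cmod_gt_0 in Hc.
    apply Rmult_le_reg_l with (/ Cmod c); [now apply Rinv_0_lt_compat|].
    rewrite <- Rmult_assoc, Rinv_l, Rmult_1_l by lra; exact H.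
Qed.

Lemma norm_pos_neq0 {V : CNormedModule} (x : V) : x <> zero -> 0 < norm x.
Proof.
  intros H; destruct (norm_ge_0 x) as [Hx | Hx]; [exact Hx|].
  symmetry in Hx; now apply norm_eq_zero in Hx.
Qed.

Lemma norm_pos_inv {V : CNormedModule} (x : V) : 0 < norm x -> x <> zero.
Proof. intros H E; rewrite E, norm_zero in H; lra. Qed.

Lemma norm_minus_sym {V : CNormedModule} (x y : V) : norm (minus x y) = norm (minus y x).
Proof. rewrite <- opp_minus; apply norm_opp. Qed.

Lemma norm_minus_self {V : CNormedModule} (x : V) : norm (minus x x) = 0.
Proof. rewrite minus_eq_zero; apply norm_zero. Qed.

Lemma norm_minus_triangle {V : CNormedModule} (x y z : V) :
  norm (minus x z) <= norm (minus x y) + norm (minus y z).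
Proof. rewrite (minus_trans y x z); apply norm_triangle. Qed.

Lemma norm_minus_le {V : CNormedModule} (x y : V) : norm (minus x y) <= norm x + norm y.
Proof. unfold minus; apply Rle_trans with (1 := norm_triangle _ _); rewrite norm_opp; lra. Qed.

(** * Bounded linear maps *)

Section Linear_maps.

Context {U V : CNormedModule}.

Lemma Lin_plusE (A : Lin U V) x y : A (plus x y) = plus (A x) (A y).
Proof. apply (linear_plus _ (lin_is_linear A)). Qed.

Lemma Lin_scalE (A : Lin U V) (c : C) x : A (scal (c : C_AbsRing) x) = scal (c : C_AbsRing) (A x).
Proof. apply (linear_scal _ (lin_is_linear A)). Qed.

Lemma Lin_zeroE (A : Lin U V) : A zero = zero.
Proof. apply (linear_zero _ (lin_is_linear A)). Qed.

Lemma Lin_minusE (A : Lin U V) x y : A (minus x y) = minus (A x) (A y).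
Proof.
  unfold minus; rewrite Lin_plusE; f_equal; apply (linear_opp _ _ (lin_is_linear A)).
Qed.

Lemma Lin_norm_apply (A : Lin U V) x : norm (A x) <= norm A * norm x.
Proof. apply (Lin_norm_bound U V A). Qed.

Lemma Lin_norm_le_of (A : Lin U V) M :
  0 <= M -> (forall x, norm (A x) <= M * norm x) -> norm A <= M.
Proof. intros H1 H2; apply (Lin_norm_le U V A); now split. Qed.

End Linear_maps.

Lemma Lin_comp_linear {U V W : CNormedModule} (B : Lin V W) (A : Lin U V) :
  is_linear (fun x => B (A x)).
Proof. apply is_linear_comp; apply lin_is_linear. Qed.

Definition Lin_comp {U V W : CNormedModule} (B : Lin V W) (A : Lin U V) : Lin U W :=
  mkLin _ _ _ (Lin_comp_linear B A).

(** The epsilon-delta form of [filterdiff], in terms of increments and norms; [fdiff_filterdiff]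
    proves the equivalence, and the quantitative estimates below use this form. *)
Definition fdiff {U V : CNormedModule} (f : U -> V) (x : U) (A : Lin U V) : Prop :=
  forall eps, 0 < eps -> exists d, 0 < d /\ forall h, norm h < d ->
    norm (minus (f (plus x h)) (plus (f x) (A h))) <= eps * norm h.

Lemma locally_norm_iff {U : CNormedModule} (x : U) (P : U -> Prop) :
  locally x P <-> exists d, 0 < d /\ forall h, norm h < d -> P (plus x h).
Proof.
  split.
  - intros H; apply locally_norm_le_locally in H; destruct H as [d Hd].
    exists d; split; [apply cond_pos|]; intros h Hh; apply Hd.
    unfold ball_norm; replace (minus (plus x h) x) with h by module_eq U; exact Hh.
  - intros [d [Hd H]]; apply locally_le_locally_norm; exists (mkposreal d Hd).
    intros y Hy; unfold ball_norm in Hy; simpl in Hy.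
    replace y with (plus x (minus y x)) by module_eq U; now apply H.
Qed.

Lemma fdiff_filterdiff {U V : CNormedModule} (f : U -> V) (x : U) (A : Lin U V) :
  filterdiff f (locally x) A <-> fdiff f x A.
Proof.
  split.
  - intros [_ H] eps Heps.
    specialize (H x (fun P HP => HP) (mkposreal eps Heps)); simpl in H.
    apply locally_norm_iff in H; destruct H as [d [Hd H]].
    exists d; split; [exact Hd|]; intros h Hh; specialize (H h Hh); simpl in H.
    replace (minus (plus x h) x) with h in H by module_eq U.
    replace (minus (f (plus x h)) (plus (f x) (A h)))
      with (minus (minus (f (plus x h)) (f x)) (A h)) by module_eq V; exact H.
  - intros H; split; [apply lin_is_linear|].
    intros y Hy; apply is_filter_lim_locally_unique in Hy; subst y.
    intros eps; destruct (H eps (cond_pos eps)) as [d [Hd H']].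
    apply locally_norm_iff; exists d; split; [exact Hd|]; intros h Hh.
    replace (minus (plus x h) x) with h by module_eq U.
    replace (minus (minus (f (plus x h)) (f x)) (A h))
      with (minus (f (plus x h)) (plus (f x) (A h))) by module_eq V.
    now apply H'.
Qed.

Lemma fdiff_ex {U V : CNormedModule} (f : U -> V) (x : U) :
  ex_filterdiff f (locally x) <-> exists A, fdiff f x A.
Proof.
  split.
  - intros [l Hl]; exists (mkLin _ _ l (proj1 Hl)); now apply fdiff_filterdiff.
  - intros [A HA]; exists A; now apply fdiff_filterdiff.
Qed.

Lemma norm_le_eps {V : CNormedModule} (x : V) (M : R) :
  (forall eps, 0 < eps -> norm x <= eps * M) -> x = zero.
Proof.
  intros H; apply norm_eq_zero, Rle_antisym; [|apply norm_ge_0].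
  apply Rnot_lt_le; intros Hx.
  assert (0 < Rabs M + 1) by (pose proof (Rabs_pos M); lra).
  specialize (H (norm x / (2 * (Rabs M + 1)))).
  assert (HM : norm x / (2 * (Rabs M + 1)) * M <= norm x / 2).
  { replace (norm x / 2) with (norm x / (2 * (Rabs M + 1)) * (Rabs M + 1)) by (field; lra).
    apply Rmult_le_compat_l; [apply Rlt_le, Rdiv_lt_0_compat; lra|].
    pose proof (Rle_abs M); lra. }
  assert (0 < norm x / (2 * (Rabs M + 1))) by (apply Rdiv_lt_0_compat; lra).
  specialize (H ltac:(assumption)); lra.
Qed.

Lemma small_multiple {U : CNormedModule} (h : U) (d : R) :
  0 < d -> exists t, 0 < t /\ norm (scal (RtoC t : C_AbsRing) h) < d.
Proof.
  intros Hd; exists (d / (2 * (norm h + 1))).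
  pose proof (norm_ge_0 h).
  assert (0 < d / (2 * (norm h + 1))) by (apply Rdiv_lt_0_compat; lra).
  split; [assumption|].
  rewrite norm_scal_C, Cmod_R, Rabs_pos_eq by lra.
  apply Rle_lt_trans with (d / (2 * (norm h + 1)) * (norm h + 1)).
  - apply Rmult_le_compat_l; lra.
  - replace (d / (2 * (norm h + 1)) * (norm h + 1)) with (d / 2) by (field; lra); lra.
Qed.

(** Both maps approximate the same increment along [t h] for small [t > 0]. By homogeneity [t]
    cancels, which leaves the bound [2 eps norm h] for every [eps]. *)
Lemma fdiff_unique {U V : CNormedModule} (f : U -> V) (x : U) (A B : Lin U V) :
  fdiff f x A -> fdiff f x B -> A = B.
Proof.
  intros HA HB; apply Lin_ext; intros h.
  cut (minus (A h) (B h) = zero).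
  { intros E; replace (A h) with (plus (minus (A h) (B h)) (B h)) by module_eq V.
    rewrite E; apply plus_zero_l. }
  apply (norm_le_eps _ (2 * norm h)); intros eps Heps.
  destruct (HA eps Heps) as [d1 [Hd1 H1]], (HB eps Heps) as [d2 [Hd2 H2]].
  destruct (small_multiple h (Rmin d1 d2)) as [t [Ht Hth]]; [now apply Rmin_pos|].
  specialize (H1 _ (Rlt_le_trans _ _ _ Hth (Rmin_l _ _))).
  specialize (H2 _ (Rlt_le_trans _ _ _ Hth (Rmin_r _ _))).
  rewrite Lin_scalE in H1, H2.
  rewrite norm_scal_C, Cmod_R, Rabs_pos_eq in H1, H2 by lra.
  set (y := f (plus x (scal (RtoC t : C_AbsRing) h))) in *.
  apply Rmult_le_reg_l with t; [exact Ht|].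
  rewrite <- (Rabs_pos_eq t) at 1 by lra.
  rewrite <- Cmod_R, <- norm_scal_C.
  replace (scal (RtoC t : C_AbsRing) (minus (A h) (B h))) with
    (minus (minus y (plus (f x) (scal (RtoC t : C_AbsRing) (B h))))
           (minus y (plus (f x) (scal (RtoC t : C_AbsRing) (A h))))) by module_eq V.
  apply Rle_trans with (1 := norm_minus_le _ _); lra.
Qed.

Lemma Frechet_spec {U V : CNormedModule} (f : U -> V) (x : U) :
  ex_filterdiff f (locally x) -> fdiff f x (Frechet f x).
Proof.
  intros H; apply fdiff_ex in H; destruct H as [A HA].
  apply fdiff_filterdiff; unfold Frechet.
  apply (epsilon_spec (inhabits (Lin_zero U V)) (fun A : Lin U V => filterdiff f (locally x) A)).
  exists A; now apply fdiff_filterdiff.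
Qed.

Lemma Frechet_eq {U V : CNormedModule} (f : U -> V) (x : U) (A : Lin U V) :
  fdiff f x A -> Frechet f x = A.
Proof.
  intros H; apply (fdiff_unique f x); [|exact H].
  apply Frechet_spec, fdiff_ex; now exists A.
Qed.

Lemma fdiff_ext_near {U V : CNormedModule} (f g : U -> V) (x : U) (A : Lin U V) r :
  0 < r -> (forall h, norm h < r -> f (plus x h) = g (plus x h)) -> fdiff f x A -> fdiff g x A.
Proof.
  intros Hr E H eps Heps; destruct (H eps Heps) as [d [Hd H']].
  exists (Rmin d r); split; [now apply Rmin_pos|].
  intros h Hh; pose proof (Rmin_l d r); pose proof (Rmin_r d r).
  rewrite <- E by lra.
  replace (g x) with (f x); [apply H'; lra|].
  specialize (E zero); rewrite plus_zero_r in E; apply E; rewrite norm_zero; lra.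
Qed.

Lemma fdiff_comp {U V W : CNormedModule} (f : U -> V) (g : V -> W) x A B :
  fdiff f x A -> fdiff g (f x) B -> fdiff (fun y => g (f y)) x (Lin_comp B A).
Proof.
  intros HA HB; apply fdiff_filterdiff; apply fdiff_filterdiff in HA, HB.
  apply (filterdiff_comp' f g x A B HA HB).
Qed.

Lemma fdiff_lin {U V : CNormedModule} (A : Lin U V) x : fdiff A x A.
Proof. apply fdiff_filterdiff, filterdiff_linear, lin_is_linear. Qed.

Lemma fdiff_const {U V : CNormedModule} (y : V) (x : U) : fdiff (fun _ => y) x (Lin_zero U V).
Proof. apply fdiff_filterdiff, filterdiff_const. Qed.

Lemma fdiff_plus {U V : CNormedModule} (f g : U -> V) x A B :
  fdiff f x A -> fdiff g x B -> fdiff (fun y => plus (f y) (g y)) x (Lin_plus U V A B).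
Proof.
  intros HA HB; apply fdiff_filterdiff; apply fdiff_filterdiff in HA, HB.
  exact (filterdiff_plus_fct f g A B HA HB).
Qed.

Lemma Lin_scal_fct_linear {U V : CNormedModule} (a : C) (y : V) (A : Lin U C_NormedModule)
    (B : Lin U V) :
  is_linear (fun h => plus (scal (A h : C_AbsRing) y) (scal (a : C_AbsRing) (B h))).
Proof.
  split.
  - intros h k; rewrite !Lin_plusE.
    change (plus (A h) (A k)) with (A h + A k)%C; module_eq V.
  - intros c h; rewrite !Lin_scalE.
    change (scal c (A h)) with (c * A h)%C; module_eq V.
  - exists (norm A * norm y + Cmod a * norm B + 1).
    pose proof (norm_ge_0 A); pose proof (norm_ge_0 y); pose proof (norm_ge_0 B).
    pose proof (Cmod_ge_0 a).
    assert (0 <= norm A * norm y) by now apply Rmult_le_pos.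
    assert (0 <= Cmod a * norm B) by now apply Rmult_le_pos.
    split; [lra|]; intros h.
    apply Rle_trans with (1 := norm_triangle _ _); rewrite !norm_scal_C.
    pose proof (Lin_norm_apply A h) as HA; pose proof (Lin_norm_apply B h) as HB.
    change (norm (A h)) with (Cmod (A h)) in HA.
    pose proof (norm_ge_0 h).
    apply (Rmult_le_compat_r (norm y)) in HA; [|assumption].
    apply (Rmult_le_compat_l (Cmod a)) in HB; [|assumption].
    nra.
Qed.

Definition Lin_scal_fct {U V : CNormedModule} (a : C) (y : V) (A : Lin U C_NormedModule)
    (B : Lin U V) : Lin U V := mkLin _ _ _ (Lin_scal_fct_linear a y A B).

(** The product rule [filterdiff_scal_fct] wants scalars in the normed module of the absolute ring,
    whereas functionals land in [C_NormedModule]. Operations and norm agree, so only the packaging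
    changes. *)
Lemma is_linear_AbsRing_C {U : CNormedModule} (A : Lin U C_NormedModule) :
  is_linear (V := AbsRing_NormedModule C_AbsRing) A.
Proof. destruct (lin_is_linear A) as [H1 H2 H3]; split; assumption. Qed.

Lemma fdiff_scal {U V : CNormedModule} (f : U -> C) (g : U -> V) x
    (A : Lin U C_NormedModule) (B : Lin U V) :
  fdiff (V := C_NormedModule) f x A -> fdiff g x B ->
  fdiff (fun y => scal (f y : C_AbsRing) (g y)) x (Lin_scal_fct (f x) (g x) A B).
Proof.
  intros HA HB.
  apply fdiff_filterdiff; apply fdiff_filterdiff in HB.
  cut (filterdiff (V := AbsRing_NormedModule C_AbsRing) f (locally x) A).
  { intros HA'; destruct (filterdiff_scal_fct x (f : U -> C_AbsRing) g A B Cmult_comm HA' HB)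
      as [_ H]; split; [apply lin_is_linear | exact H]. }
  exact (proj2 (fdiff_filterdiff (V := AbsRing_NormedModule C_AbsRing) f x
    (mkLin U (AbsRing_NormedModule C_AbsRing) A (is_linear_AbsRing_C A))) HA).
Qed.

Lemma fdiff_cont {U V : CNormedModule} (f : U -> V) x A :
  fdiff f x A -> forall eps, 0 < eps ->
  exists d, 0 < d /\ forall h, norm h < d -> norm (minus (f (plus x h)) (f x)) < eps.
Proof.
  intros HA eps Heps; destruct (HA 1 Rlt_0_1) as [d [Hd H]].
  pose proof (norm_ge_0 A).
  exists (Rmin d (eps / (norm A + 2))).
  assert (0 < eps / (norm A + 2)) by (apply Rdiv_lt_0_compat; lra).
  split; [now apply Rmin_pos|]; intros h Hh.
  pose proof (Rmin_l d (eps / (norm A + 2))); pose proof (Rmin_r d (eps / (norm A + 2))).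
  specialize (H h ltac:(lra)); pose proof (Lin_norm_apply A h).
  replace (minus (f (plus x h)) (f x)) with
    (plus (minus (f (plus x h)) (plus (f x) (A h))) (A h)) by module_eq V.
  apply Rle_lt_trans with (1 := norm_triangle _ _).
  apply Rle_lt_trans with ((norm A + 1) * norm h); [lra|].
  pose proof (norm_ge_0 h).
  apply Rle_lt_trans with ((norm A + 1) * (eps / (norm A + 2))).
  - apply Rmult_le_compat_l; lra.
  - apply Rmult_lt_reg_r with (norm A + 2); [lra|].
    replace ((norm A + 1) * (eps / (norm A + 2)) * (norm A + 2))
      with ((norm A + 1) * eps) by (field; lra); nra.
Qed.

(** * Complex derivatives and integrals of curves *)

(** Written with [Cmod] and complex arithmetic so that [ring] and [field] apply. It is convertible
    to [fdiff] with derivative [Cmul d], through which the rules of calculus are inherited. *)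
Definition cdiff (f : C -> C) (z d : C) : Prop :=
  forall eps, 0 < eps -> exists del, 0 < del /\ forall h, Cmod h < del ->
    Cmod (f (z + h) - (f z + d * h))%C <= eps * Cmod h.

Lemma Cmul_linear (d : C) : is_linear (U := C_NormedModule) (V := C_NormedModule) (fun h => (d * h)%C).
Proof.
  split.
  - intros x y; change (plus x y) with (x + y)%C; change (d * (x + y) = d * x + d * y)%C; ring.
  - intros k x; change (d * (k * x) = k * (d * x))%C; ring.
  - exists (Cmod d + 1); pose proof (Cmod_ge_0 d); split; [lra|]; intros x.
    change (Cmod (d * x) <= (Cmod d + 1) * Cmod x); rewrite Cmod_mult.
    pose proof (Cmod_ge_0 x); nra.
Qed.

Definition Cmul (d : C) : Lin C_NormedModule C_NormedModule := mkLin _ _ _ (Cmul_linear d).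

Lemma cdiff_fdiff f z d :
  cdiff f z d <-> fdiff (U := C_NormedModule) (V := C_NormedModule) f z (Cmul d).
Proof. split; intros H; exact H. Qed.

Lemma Lin_C_eq (A : Lin C_NormedModule C_NormedModule) : A = Cmul (A (RtoC 1)).
Proof.
  apply Lin_ext; intros h; simpl.
  transitivity (A (scal (h : C_AbsRing) (RtoC 1 : C_NormedModule))).
  - f_equal; symmetry; exact (Cmult_1_r h).
  - rewrite Lin_scalE; exact (Cmult_comm h (A (RtoC 1))).
Qed.

Lemma is_derive_cdiff (f : C -> C) (z d : C) :
  is_derive (K := C_AbsRing) (V := C_NormedModule) f z d <-> cdiff f z d.
Proof.
  assert (Hl : is_linear (U := AbsRing_NormedModule C_AbsRing) (V := C_NormedModule)
    (fun y : C => scal (y : C_AbsRing) (d : C_NormedModule))).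
  { destruct (Cmul_linear d) as [H1 H2 [M [HM H3]]]; split.
    - intros x y; change ((x + y) * d = x * d + y * d)%C; ring.
    - intros k x; change ((k * x) * d = k * (x * d))%C; ring.
    - exists M; split; [exact HM|]; intros x.
      change (Cmod (x * d) <= M * Cmod x); rewrite Cmult_comm; apply H3. }
  unfold is_derive.
  split; intros H.
  - apply (fdiff_filterdiff _ _ (mkLin _ _ _ Hl)) in H.
    intros eps Heps; destruct (H eps Heps) as [del [Hdel H']].
    exists del; split; [exact Hdel|]; intros h Hh; specialize (H' h Hh).
    rewrite (Cmult_comm d h); exact H'.
  - apply (fdiff_filterdiff _ _ (mkLin _ _ _ Hl)).
    intros eps Heps; destruct (H eps Heps) as [del [Hdel H']].
    exists del; split; [exact Hdel|]; intros h Hh; specialize (H' h Hh).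
    rewrite (Cmult_comm d h) in H'; exact H'.
Qed.

Lemma C_derive_eq f z d : cdiff f z d -> C_derive f z = d.
Proof. intros H; apply is_C_derive_unique, is_derive_cdiff, H. Qed.

Lemma cdiff_unique f z d e : cdiff f z d -> cdiff f z e -> d = e.
Proof. intros H1 H2; apply C_derive_eq in H1, H2; congruence. Qed.

Lemma ex_derive_cdiff (f : C -> C) (z : C) :
  ex_derive (K := C_AbsRing) (V := C_NormedModule) f z <-> cdiff f z (C_derive f z).
Proof.
  split.
  - intros H; apply is_derive_cdiff, C_derive_correct; [exact (RtoC 0) | exact H].
  - intros H; exists (C_derive f z); now apply is_derive_cdiff.
Qed.

Lemma cdiff_const c z : cdiff (fun _ => c) z (RtoC 0).
Proof.
  intros eps Heps; exists 1; split; [lra|]; intros h _.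
  replace (c - (c + RtoC 0 * h))%C with (RtoC 0) by ring.
  rewrite Cmod_0; pose proof (Cmod_ge_0 h); nra.
Qed.

Lemma cdiff_id z : cdiff (fun w => w) z (RtoC 1).
Proof.
  intros eps Heps; exists 1; split; [lra|]; intros h _.
  replace (z + h - (z + RtoC 1 * h))%C with (RtoC 0) by ring.
  rewrite Cmod_0; pose proof (Cmod_ge_0 h); nra.
Qed.

Lemma cdiff_eq f z d e : cdiff f z d -> d = e -> cdiff f z e.
Proof. intros H <-; exact H. Qed.

Lemma cdiff_plus f g z d e :
  cdiff f z d -> cdiff g z e -> cdiff (fun w => f w + g w)%C z (d + e).
Proof.
  intros Hf Hg; apply (proj1 (cdiff_fdiff _ _ _)) in Hf; apply (proj1 (cdiff_fdiff _ _ _)) in Hg; apply (proj2 (cdiff_fdiff _ _ _)).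
  pose proof (fdiff_plus _ _ _ _ _ Hf Hg) as H.
  replace (Cmul (d + e)) with (Lin_plus _ _ (Cmul d) (Cmul e)); [exact H|].
  apply Lin_ext; intros h; change (d * h + e * h = (d + e) * h)%C; ring.
Qed.

Lemma cdiff_mult f g z d e :
  cdiff f z d -> cdiff g z e -> cdiff (fun w => f w * g w)%C z (d * g z + f z * e).
Proof.
  intros Hf Hg; apply (proj1 (cdiff_fdiff _ _ _)) in Hf; apply (proj1 (cdiff_fdiff _ _ _)) in Hg; apply (proj2 (cdiff_fdiff _ _ _)).
  pose proof (fdiff_scal _ _ _ _ _ Hf Hg) as H.
  replace (Cmul (d * g z + f z * e)) with
    (Lin_scal_fct (U := C_NormedModule) (V := C_NormedModule) (f z) (g z) (Cmul d) (Cmul e));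
    [exact H|].
  apply Lin_ext; intros h; change ((d * h) * g z + f z * (e * h) = (d * g z + f z * e) * h)%C; ring.
Qed.

Lemma cdiff_comp f g z d e :
  cdiff f z d -> cdiff g (f z) e -> cdiff (fun w => g (f w)) z (e * d).
Proof.
  intros Hf Hg; apply (proj1 (cdiff_fdiff _ _ _)) in Hf; apply (proj1 (cdiff_fdiff _ _ _)) in Hg; apply (proj2 (cdiff_fdiff _ _ _)).
  pose proof (fdiff_comp _ _ _ _ _ Hf Hg) as H.
  replace (Cmul (e * d)) with (Lin_comp (Cmul e) (Cmul d)); [exact H|].
  apply Lin_ext; intros h; change (e * (d * h) = e * d * h)%C; ring.
Qed.

Lemma cdiff_scal c f z d : cdiff f z d -> cdiff (fun w => c * f w)%C z (c * d).
Proof.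
  intros H; apply (cdiff_eq _ _ _ _ (cdiff_mult _ _ _ _ _ (cdiff_const c z) H)); ring.
Qed.

Lemma cdiff_ext_near f g z d r :
  0 < r -> (forall w, Cmod (w - z) < r -> f w = g w) -> cdiff f z d -> cdiff g z d.
Proof.
  intros Hr E H; apply (proj2 (cdiff_fdiff _ _ _)); apply (proj1 (cdiff_fdiff _ _ _)) in H.
  apply (fdiff_ext_near (U := C_NormedModule) f g z _ r Hr); [|exact H].
  intros h Hh; apply E; change (NormedModule.sort C_AbsRing C_NormedModule) with C in h.
  change (Cmod (z + h - z) < r); replace (z + h - z)%C with h by ring; exact Hh.
Qed.

Lemma cdiff_ext f g z d : (forall w, f w = g w) -> cdiff f z d -> cdiff g z d.
Proof. intros E; apply (cdiff_ext_near f g z d 1 Rlt_0_1); intros w _; apply E. Qed.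

Lemma cdiff_minus f g z d e :
  cdiff f z d -> cdiff g z e -> cdiff (fun w => f w - g w)%C z (d - e).
Proof.
  intros Hf Hg; apply (cdiff_scal (- RtoC 1)) in Hg.
  apply cdiff_ext with (fun w => f w + (- RtoC 1) * g w)%C; [intros w; ring|].
  apply (cdiff_eq _ _ _ _ (cdiff_plus _ _ _ _ _ Hf Hg)); ring.
Qed.

Lemma cdiff_cont f z d : cdiff f z d -> forall eps, 0 < eps -> exists del, 0 < del /\
  forall w, Cmod (w - z) < del -> Cmod (f w - f z) < eps.
Proof.
  intros H eps Heps; apply (proj1 (cdiff_fdiff _ _ _)) in H.
  destruct (fdiff_cont _ _ _ H eps Heps) as [del [Hdel H']].
  exists del; split; [exact Hdel|]; intros w Hw.
  specialize (H' (w - z)%C Hw); change (Cmod (f (z + (w - z))%C - f z) < eps) in H'.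
  replace (z + (w - z))%C with w in H' by ring; exact H'.
Qed.

Lemma cdiff_inv z : z <> RtoC 0 -> cdiff Cinv z (- / (z * z)).
Proof.
  intros Hz eps Heps.
  pose proof (proj1 (Cmod_gt_0 _) Hz) as Hm.
  set (m := Cmod z) in *.
  (* The remainder is [h^2 / (z^2 (z + h))]; with [|z + h| >= m / 2] it is at most [eps |h|] once
     [|h| <= eps m^3 / 2]. *)
  assert (Hk : 0 < eps * (m * m * m) / 2) by (repeat apply Rmult_lt_0_compat; lra).
  exists (Rmin (m / 2) (eps * (m * m * m) / 2)); split; [apply Rmin_pos; lra|].
  intros h Hh.
  pose proof (Rmin_l (m / 2) (eps * (m * m * m) / 2)).
  pose proof (Rmin_r (m / 2) (eps * (m * m * m) / 2)).
  assert (Hzh : m / 2 <= Cmod (z + h)).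
  { pose proof (Cmod_triangle (z + h) (- h)) as Ht.
    replace (z + h + - h)%C with z in Ht by ring; rewrite Cmod_opp in Ht; fold m in Ht; lra. }
  assert (Hzh0 : (z + h)%C <> RtoC 0) by (apply Cmod_gt_0; lra).
  replace (/ (z + h) - (/ z + - / (z * z) * h))%C with (h * (h / (z * z * (z + h))))%C
    by (field; auto).
  rewrite Cmod_mult, Rmult_comm; apply Rmult_le_compat_r; [apply Cmod_ge_0|].
  rewrite Cmod_div, !Cmod_mult by (repeat apply Cmult_neq_0; assumption).
  fold m; apply Rle_div_l; [repeat apply Rmult_lt_0_compat; lra|].
  apply Rle_trans with (eps * (m * m * (m / 2))); [lra|].
  apply Rmult_le_compat_l; [lra|]; apply Rmult_le_compat_l; [nra|lra].
Qed.

Lemma cdiff_div f g z d e : g z <> RtoC 0 ->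
  cdiff f z d -> cdiff g z e -> cdiff (fun w => f w / g w)%C z ((d * g z - f z * e) / (g z * g z)).
Proof.
  intros Hg Hf Hd.
  pose proof (cdiff_mult _ _ _ _ _ Hf (cdiff_comp _ _ _ _ _ Hd (cdiff_inv _ Hg))) as H.
  apply (cdiff_eq _ _ _ _ H); field; exact Hg.
Qed.

(** * Continuous curves and their integrals *)

Definition ccont (f : R -> C) (t : R) : Prop :=
  forall eps, 0 < eps -> exists del, 0 < del /\ forall s, Rabs (s - t) < del -> Cmod (f s - f t) < eps.

Lemma ccont_cdiff f g t d : cdiff f (g t) d -> ccont g t -> ccont (fun s => f (g s)) t.
Proof.
  intros Hf Hg eps Heps.
  destruct (cdiff_cont _ _ _ Hf eps Heps) as [d1 [Hd1 H1]].
  destruct (Hg d1 Hd1) as [d2 [Hd2 H2]].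
  exists d2; split; [exact Hd2|]; intros s Hs; now apply H1, H2.
Qed.

Lemma Cmod_le_components (z : C) : Cmod z <= Rabs (fst z) + Rabs (snd z).
Proof.
  rewrite <- (Cmod_R (fst z)).
  replace (Rabs (snd z)) with (Cmod (Ci * RtoC (snd z)))
    by (rewrite Cmod_mult, Cmod_R; unfold Cmod, Ci; simpl;
        replace (0 * (0 * 1) + 1 * (1 * 1)) with 1 by ring; rewrite sqrt_1; ring).
  replace z with (RtoC (fst z) + Ci * RtoC (snd z))%C at 1; [apply Cmod_triangle|].
  destruct z; unfold RtoC, Ci, Cmult, Cplus; simpl; f_equal; ring.
Qed.

Lemma ccont_components (f : R -> C) t :
  ccont f t <-> continuous (fun s => fst (f s)) t /\ continuous (fun s => snd (f s)) t.
Proof.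
  split.
  - intros H.
    assert (Hk : forall k : C -> R, (forall z w, Rabs (k z - k w) <= Cmod (z - w)) ->
      continuous (fun s => k (f s)) t).
    { intros k Hk; apply filterlim_locally; intros eps.
      destruct (H eps (cond_pos eps)) as [d [Hd Hs]].
      exists (mkposreal d Hd); intros s Hst; apply Rle_lt_trans with (1 := Hk _ _), Hs, Hst. }
    split; apply Hk; intros [a b] [c d].
    + exact (Rle_trans _ _ _ (Rmax_l _ _) (Rmax_Cmod ((a, b) - (c, d))%C)).
    + exact (Rle_trans _ _ _ (Rmax_r _ _) (Rmax_Cmod ((a, b) - (c, d))%C)).
  - intros [H1 H2] eps Heps.
    assert (He : 0 < eps / 2) by lra.
    destruct (proj1 (filterlim_locally _ _) H1 (mkposreal _ He)) as [d1 Hd1].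
    destruct (proj1 (filterlim_locally _ _) H2 (mkposreal _ He)) as [d2 Hd2].
    exists (Rmin d1 d2); split; [apply Rmin_pos; apply cond_pos|]; intros s Hs.
    specialize (Hd1 s (Rlt_le_trans _ _ _ Hs (Rmin_l _ _))).
    specialize (Hd2 s (Rlt_le_trans _ _ _ Hs (Rmin_r _ _))).
    change (Rabs (fst (f s) - fst (f t)) < eps / 2) in Hd1.
    change (Rabs (snd (f s) - snd (f t)) < eps / 2) in Hd2.
    apply Rle_lt_trans with (1 := Cmod_le_components _).
    destruct (f s), (f t); simpl in *; unfold Rminus in *; lra.
Qed.

Lemma ccont_const c t : ccont (fun _ => c) t.
Proof. apply ccont_components; split; apply continuous_const. Qed.

Lemma ccont_plus f g t : ccont f t -> ccont g t -> ccont (fun s => f s + g s)%C t.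
Proof.
  intros Hf Hg; apply ccont_components in Hf, Hg; apply ccont_components; simpl.
  split; apply (continuous_plus (V := R_NormedModule)); tauto.
Qed.

Lemma ccont_mult f g t : ccont f t -> ccont g t -> ccont (fun s => f s * g s)%C t.
Proof.
  intros Hf Hg; apply ccont_components in Hf, Hg; apply ccont_components; simpl.
  split; [apply (continuous_minus (V := R_NormedModule)) | apply (continuous_plus (V := R_NormedModule))];
    apply (continuous_mult (K := R_AbsRing)); tauto.
Qed.

Lemma ccont_minus f g t : ccont f t -> ccont g t -> ccont (fun s => f s - g s)%C t.
Proof.
  intros Hf Hg; apply ccont_components in Hf, Hg; apply ccont_components; simpl.
  split; apply (continuous_minus (V := R_NormedModule)); tauto.
Qed.

Definition ccont_on (f : R -> C) (a b : R) : Prop := a <= b /\ forall t, a <= t <= b -> ccont f t.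

Definition Cint (f : R -> C) (a b : R) : C :=
  (RInt (fun t => fst (f t)) a b, RInt (fun t => snd (f t)) a b).

Lemma ccont_on_ex f a b : ccont_on f a b ->
  ex_RInt (fun t => fst (f t)) a b /\ ex_RInt (fun t => snd (f t)) a b.
Proof.
  intros [Hab H]; split; apply (ex_RInt_continuous (V := R_CompleteNormedModule));
    rewrite Rmin_left, Rmax_right by exact Hab; intros t Ht;
    specialize (H t Ht); apply ccont_components in H; tauto.
Qed.

Lemma ccont_on_plus f g a b :
  ccont_on f a b -> ccont_on g a b -> ccont_on (fun t => f t + g t)%C a b.
Proof. intros [H H1] [_ H2]; split; [exact H|]; intros t Ht; apply ccont_plus; auto. Qed.

Lemma ccont_on_minus f g a b :
  ccont_on f a b -> ccont_on g a b -> ccont_on (fun t => f t - g t)%C a b.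
Proof. intros [H H1] [_ H2]; split; [exact H|]; intros t Ht; apply ccont_minus; auto. Qed.

Lemma ccont_on_mult f g a b :
  ccont_on f a b -> ccont_on g a b -> ccont_on (fun t => f t * g t)%C a b.
Proof. intros [H H1] [_ H2]; split; [exact H|]; intros t Ht; apply ccont_mult; auto. Qed.

Lemma ccont_on_const c a b : a <= b -> ccont_on (fun _ => c) a b.
Proof. intros H; split; [exact H|]; intros t _; apply ccont_const. Qed.

Lemma Cint_ext f g a b : a <= b -> (forall t, a <= t <= b -> f t = g t) -> Cint f a b = Cint g a b.
Proof.
  intros Hab H; unfold Cint; f_equal; apply RInt_ext; intros t Ht;
    rewrite Rmin_left, Rmax_right in Ht by exact Hab; rewrite H by lra; reflexivity.
Qed.

Lemma Cint_plus f g a b : ccont_on f a b -> ccont_on g a b ->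
  Cint (fun t => f t + g t)%C a b = (Cint f a b + Cint g a b)%C.
Proof.
  intros Hf Hg; apply ccont_on_ex in Hf, Hg.
  unfold Cint, Cplus; simpl; f_equal; apply (RInt_plus (V := R_CompleteNormedModule)); tauto.
Qed.

Lemma Cint_Cmult c f a b : ccont_on f a b ->
  Cint (fun t => c * f t)%C a b = (c * Cint f a b)%C.
Proof.
  intros Hf; apply ccont_on_ex in Hf; destruct Hf as [H1 H2].
  pose proof (fun k => ex_RInt_scal (V := R_CompleteNormedModule) _ a b k H1) as K1.
  pose proof (fun k => ex_RInt_scal (V := R_CompleteNormedModule) _ a b k H2) as K2.
  pose proof (fun k => RInt_scal (V := R_CompleteNormedModule) _ a b k H1) as E1.
  pose proof (fun k => RInt_scal (V := R_CompleteNormedModule) _ a b k H2) as E2.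
  unfold Cint, Cmult; simpl; f_equal.
  - etransitivity; [exact (RInt_minus (V := R_CompleteNormedModule) _ _ a b (K1 _) (K2 _))|].
    rewrite E1, E2; reflexivity.
  - etransitivity; [exact (RInt_plus (V := R_CompleteNormedModule) _ _ a b (K2 _) (K1 _))|].
    rewrite E1, E2; reflexivity.
Qed.

Lemma Cint_minus f g a b : ccont_on f a b -> ccont_on g a b ->
  Cint (fun t => f t - g t)%C a b = (Cint f a b - Cint g a b)%C.
Proof.
  intros Hf Hg.
  transitivity (Cint (fun t => f t + (- RtoC 1) * g t)%C a b).
  - apply Cint_ext; [apply Hf|]; intros; ring.
  - rewrite Cint_plus, Cint_Cmult; [ring | exact Hg | exact Hf |].
    apply ccont_on_mult; [apply ccont_on_const, Hf | exact Hg].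
Qed.

Lemma Cint_const c a b : Cint (fun _ => c) a b = (RtoC (b - a) * c)%C.
Proof.
  unfold Cint; rewrite !RInt_const; destruct c as [x y]; unfold Cmult, RtoC; simpl.
  unfold scal; simpl; unfold mult; simpl; f_equal; ring.
Qed.

Lemma Cint_Chasles f a b c : ccont_on f a b -> ccont_on f b c ->
  Cint f a c = (Cint f a b + Cint f b c)%C.
Proof.
  intros Hf Hg; apply ccont_on_ex in Hf, Hg.
  unfold Cint, Cplus; simpl; f_equal; symmetry;
    apply (RInt_Chasles (V := R_CompleteNormedModule)); tauto.
Qed.

(** Turns estimates of moduli into estimates of real parts: for integrals, for the mean value
    inequality and for the complex Hahn-Banach theorem. *)
Lemma unimodular_rotation (z : C) : exists c, Cmod c = 1 /\ (c * z)%C = RtoC (Cmod z).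
Proof.
  destruct (Ceq_dec z (RtoC 0)) as [-> | E].
  { exists (RtoC 1); rewrite Cmod_1, Cmod_0; split; [reflexivity | ring]. }
  pose proof (proj1 (Cmod_gt_0 _) E) as Hm.
  assert (Hm0 : RtoC (Cmod z) <> RtoC 0) by (intros H; apply RtoC_inj in H; lra).
  exists (Cconj z / RtoC (Cmod z))%C; split.
  - rewrite Cmod_div, Cmod_conj, Cmod_R, Rabs_pos_eq by (assumption || lra); field; lra.
  - replace (Cconj z / RtoC (Cmod z) * z)%C with ((z * Cconj z) / RtoC (Cmod z))%C
      by (field; exact Hm0).
    rewrite <- Cmod2_conj, <- RtoC_div by lra; f_equal; field; lra.
Qed.

Lemma Cint_le_RInt f (g : R -> R) a b : ccont_on f a b -> ex_RInt g a b ->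
  (forall t, a <= t <= b -> Cmod (f t) <= g t) -> Cmod (Cint f a b) <= RInt g a b.
Proof.
  intros Hf Hg Hfg; pose proof (proj1 Hf) as Hab.
  destruct (unimodular_rotation (Cint f a b)) as [c [Hc HcI]].
  rewrite <- Cint_Cmult in HcI by exact Hf.
  apply (f_equal fst) in HcI; simpl in HcI; rewrite <- HcI.
  assert (Hcf : ccont_on (fun t => c * f t)%C a b)
    by (apply ccont_on_mult; [now apply ccont_on_const | exact Hf]).
  apply ccont_on_ex in Hcf.
  apply RInt_le; [exact Hab | apply Hcf | exact Hg|].
  intros t Ht; apply Rle_trans with (Cmod (c * f t)).
  - apply Rle_trans with (1 := Rle_abs _); exact (re_le_Cmod (c * f t)%C).
  - rewrite Cmod_mult, Hc, Rmult_1_l; apply Hfg; lra.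
Qed.

Lemma Cint_le f a b M : ccont_on f a b -> (forall t, a <= t <= b -> Cmod (f t) <= M) ->
  Cmod (Cint f a b) <= M * (b - a).
Proof.
  intros Hf HM.
  apply Rle_trans with (1 := Cint_le_RInt f (fun _ => M) a b Hf (ex_RInt_const _ _ _) HM).
  rewrite RInt_const; unfold scal; simpl; unfold mult; simpl; lra.
Qed.

Lemma Cint_affine (p q : C) a b : a <= b ->
  Cint (fun t => p + RtoC t * q)%C a b
    = (RtoC (b - a) * p + RtoC ((b * b - a * a) / 2) * q)%C.
Proof.
  intros Hab.
  assert (E : forall u v, RInt (fun t => u + t * v) a b = (b - a) * u + (b * b - a * a) / 2 * v).
  { intros u v; apply is_RInt_unique.
    replace ((b - a) * u + (b * b - a * a) / 2 * v) with
      (minus (b * u + b * b / 2 * v) (a * u + a * a / 2 * v))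
      by (unfold minus, plus, opp; simpl; field).
    apply (is_RInt_derive (V := R_CompleteNormedModule) (fun t => t * u + t * t / 2 * v)).
    - intros x _; auto_derive; [trivial | field].
    - intros x _; apply (ex_derive_continuous (K := R_AbsRing) (V := R_NormedModule)).
      auto_derive; trivial. }
  assert (E' : forall u v r (f : R -> R), (forall t, f t = u + t * v) ->
    r = (b - a) * u + (b * b - a * a) / 2 * v -> RInt f a b = r).
  { intros u v r f Hf ->; rewrite <- E; apply RInt_ext; intros t _; apply Hf. }
  unfold Cint; destruct p as [p1 p2], q as [q1 q2]; unfold Cplus, Cmult, RtoC; simpl.
  f_equal; [apply (E' p1 q1) | apply (E' p2 q2)]; intros; ring.
Qed.

(** * The Hahn-Banach theorem *)

(** [Glb_Rbar] takes values in the extended reals; one member and one lower bound make it finite, so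
    that [real] returns the true infimum and not its default value. *)
Lemma glb_exists (E : R -> Prop) (m : R) :
  (exists x, E x) -> (forall x, E x -> m <= x) ->
  (forall x, E x -> real (Glb_Rbar E) <= x) /\
  (forall n, (forall x, E x -> n <= x) -> n <= real (Glb_Rbar E)).
Proof.
  intros [x0 H0] Hm.
  destruct (Glb_Rbar_correct E) as [H1 H2].
  assert (Ha : Rbar_le m (Glb_Rbar E)) by (apply H2; intros x Hx; apply Hm, Hx).
  pose proof (H1 x0 H0) as Hb.
  destruct (Glb_Rbar E) as [r| |]; simpl in *; try contradiction.
  split; [exact H1|].
  intros n Hn; exact (H2 (Finite n) Hn).
Qed.

Section Sublinear_functionals.

Context {V : CNormedModule}.

Notation rscal t x := (scal (RtoC t : C_AbsRing) x).

Record sublinear (q : V -> R) : Prop := {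
  sublinear_plus : forall x y, q (plus x y) <= q x + q y;
  sublinear_scal : forall t x, 0 < t -> q (rscal t x) <= t * q x
}.

Lemma sublinear_zero q : sublinear q -> q zero = 0.
Proof.
  intros H.
  pose proof (sublinear_scal q H 2 zero ltac:(lra)) as H2.
  pose proof (sublinear_scal q H (1/2) zero ltac:(lra)) as H3.
  vreplace V : (rscal 2 zero) with zero in H2.
  vreplace V : (rscal (1/2) zero) with zero in H3.
  mnorm V; lra.
Qed.

Lemma sublinear_scal_eq q t x : sublinear q -> 0 < t -> q (rscal t x) = t * q x.
Proof.
  intros H Ht; apply Rle_antisym; [now apply sublinear_scal|].
  pose proof (sublinear_scal q H (/ t) (rscal t x) ltac:(now apply Rinv_0_lt_compat)) as H1.
  rewrite scal_C_assoc, <- RtoC_mult, Rinv_l, scal_C_one in H1 by lra.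
  apply Rmult_le_reg_l with (/ t); [now apply Rinv_0_lt_compat|].
  rewrite <- Rmult_assoc, Rinv_l by lra; lra.
Qed.

Lemma sublinear_opp q x : sublinear q -> 0 <= q x + q (opp x).
Proof.
  intros H; rewrite <- (sublinear_zero q H).
  replace (zero : V) with (plus x (opp x)) by module_eq V; now apply sublinear_plus.
Qed.

Lemma sublinear_norm : sublinear (fun x : V => norm x).
Proof.
  split; [exact norm_triangle|].
  intros t x Ht; rewrite norm_scal_C, Cmod_R, Rabs_pos_eq by lra; apply Rle_refl.
Qed.

(* The largest sublinear functional below [q] whose value at [- y] is at most [- q y]. *)
Definition push (q : V -> R) (y x : V) : R :=
  real (Glb_Rbar (fun r => exists t, 0 <= t /\ r = q (plus x (rscal t y)) - t * q y)).

Lemma push_glb q y x : sublinear q ->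
  (forall t, 0 <= t -> push q y x <= q (plus x (rscal t y)) - t * q y) /\
  (forall n, (forall t, 0 <= t -> n <= q (plus x (rscal t y)) - t * q y) -> n <= push q y x).
Proof.
  intros H.
  destruct (glb_exists (fun r => exists t, 0 <= t /\ r = q (plus x (rscal t y)) - t * q y)
    (- q (opp x))) as [H1 H2].
  - exists (q (plus x (rscal 0 y)) - 0 * q y), 0; split; [lra | reflexivity].
  - intros r [t [Ht ->]].
    pose proof (sublinear_plus q H (plus x (rscal t y)) (opp x)) as Hs.
    vreplace V : (plus (plus x (rscal t y)) (opp x)) with (rscal t y) in Hs.
    destruct Ht as [Ht | <-].
    + rewrite (sublinear_scal_eq q t y H Ht) in Hs; lra.
    + rewrite scal_C_zero, (sublinear_zero q H) in Hs; rewrite scal_C_zero; lra.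
  - split.
    + intros t Ht; apply H1; now exists t.
    + intros n Hn; apply H2; intros r [t [Ht ->]]; now apply Hn.
Qed.

Lemma push_le q y x : sublinear q -> push q y x <= q x.
Proof.
  intros H; destruct (push_glb q y x H) as [H1 _]; specialize (H1 0 (Rle_refl 0)).
  rewrite scal_C_zero, plus_zero_r in H1; lra.
Qed.

Lemma push_opp q y : sublinear q -> push q y (opp y) <= - q y.
Proof.
  intros H; destruct (push_glb q y (opp y) H) as [H1 _]; specialize (H1 1 Rle_0_1).
  vreplace V : (plus (opp y) (rscal 1 y)) with zero in H1.
  mnorm V; rewrite (sublinear_zero q H) in H1; lra.
Qed.

(** Parameters [t1] for [x1] and [t2] for [x2] combine to [t1 + t2] for the sum, and [t] for [x]
    becomes [s * t] for [s x]. *)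
Lemma push_sublinear q y : sublinear q -> sublinear (push q y).
Proof.
  intros H; split.
  - intros x1 x2.
    destruct (push_glb q y x1 H) as [_ H1], (push_glb q y x2 H) as [_ H2].
    cut (push q y (plus x1 x2) - push q y x2 <= push q y x1); [lra|].
    apply H1; intros t1 Ht1.
    cut (push q y (plus x1 x2) - (q (plus x1 (rscal t1 y)) - t1 * q y) <= push q y x2); [lra|].
    apply H2; intros t2 Ht2.
    destruct (push_glb q y (plus x1 x2) H) as [H3 _].
    specialize (H3 (t1 + t2) ltac:(lra)).
    pose proof (sublinear_plus q H (plus x1 (rscal t1 y)) (plus x2 (rscal t2 y))) as Hs.
    rewrite RtoC_plus in H3.
    vreplace V : (plus (plus x1 x2) (scal (t1 + t2)%C y)) with
      (plus (plus x1 (rscal t1 y)) (plus x2 (rscal t2 y))) in H3.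
    lra.
  - intros s x Hs.
    destruct (push_glb q y x H) as [_ H1], (push_glb q y (rscal s x) H) as [H2 _].
    apply Rmult_le_reg_l with (/ s); [now apply Rinv_0_lt_compat|].
    rewrite <- Rmult_assoc, Rinv_l, Rmult_1_l by lra.
    apply H1; intros t Ht.
    specialize (H2 (s * t) ltac:(nra)).
    rewrite RtoC_mult in H2.
    vreplace V : (plus (rscal s x) (scal (s * t)%C y)) with (rscal s (plus x (rscal t y))) in H2.
    rewrite (sublinear_scal_eq q) in H2 by assumption.
    apply Rmult_le_reg_l with s; [exact Hs|].
    rewrite <- Rmult_assoc, Rinv_r, Rmult_1_l by lra; lra.
Qed.

(** The pointwise infimum works: of the two members that approximate it at [x] and at [y], the
    smaller one serves at both points, and its own subadditivity applies. *)
Lemma chain_inf_sublinear (A : (V -> R) -> Prop) :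
  (exists q, A q) -> (forall q, A q -> sublinear q) ->
  (forall q r, A q -> A r -> (forall x, q x <= r x) \/ (forall x, r x <= q x)) ->
  exists p, sublinear p /\ forall q x, A q -> p x <= q x.
Proof.
  intros Hne Hsub Htot.
  destruct Hne as [q0 Hq0].
  pose (E x := fun r : R => exists q, A q /\ r = q x).
  assert (HE : forall x, (forall r, E x r -> real (Glb_Rbar (E x)) <= r) /\
    (forall n, (forall r, E x r -> n <= r) -> n <= real (Glb_Rbar (E x)))).
  (* A member above [q0] is at least [q0 x]; a member [q] below [q0] satisfies
     [q x >= - q (- x) >= - q0 (- x)]. *)
  { intros x; apply (glb_exists (E x) (Rmin (q0 x) (- q0 (opp x)))).
    - exists (q0 x), q0; now split.
    - intros r [q [Hq ->]].
      destruct (Htot q q0 Hq Hq0) as [Hc | Hc].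
      + pose proof (sublinear_opp q x (Hsub q Hq)); specialize (Hc (opp x)).
        pose proof (Rmin_r (q0 x) (- q0 (opp x))); lra.
      + pose proof (Rmin_l (q0 x) (- q0 (opp x))); specialize (Hc x); lra. }
  assert (Hle : forall q x, A q -> real (Glb_Rbar (E x)) <= q x)
    by (intros q x Hq; apply HE; now exists q).
  exists (fun x => real (Glb_Rbar (E x))); split; [|exact Hle].
  split.
  - intros x y.
    cut (real (Glb_Rbar (E (plus x y))) - real (Glb_Rbar (E y)) <= real (Glb_Rbar (E x))); [lra|].
    apply HE; intros r [q1 [Hq1 ->]].
    cut (real (Glb_Rbar (E (plus x y))) - q1 x <= real (Glb_Rbar (E y))); [lra|].
    apply HE; intros r [q2 [Hq2 ->]].
    destruct (Htot q1 q2 Hq1 Hq2) as [Hc | Hc].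
    + pose proof (Hle q1 (plus x y) Hq1); pose proof (sublinear_plus q1 (Hsub _ Hq1) x y).
      specialize (Hc y); lra.
    + pose proof (Hle q2 (plus x y) Hq2); pose proof (sublinear_plus q2 (Hsub _ Hq2) x y).
      specialize (Hc x); lra.
  - intros t x Ht.
    apply Rmult_le_reg_l with (/ t); [now apply Rinv_0_lt_compat|].
    rewrite <- Rmult_assoc, Rinv_l, Rmult_1_l by lra.
    apply HE; intros r [q [Hq ->]].
    pose proof (Hle q (rscal t x) Hq); rewrite (sublinear_scal_eq q t x (Hsub q Hq) Ht) in H.
    apply Rmult_le_reg_l with t; [exact Ht|].
    rewrite <- Rmult_assoc, Rinv_r, Rmult_1_l by lra; lra.
Qed.

(** Zorn's lemma for the reversed pointwise order on the sublinear functionals below [p]. A nonempty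
    chain is bounded by its infimum, the empty one by [p]. *)
Lemma minimal_sublinear (p : V -> R) : sublinear p ->
  exists q, sublinear q /\ (forall x, q x <= p x) /\
    forall r, sublinear r -> (forall x, r x <= q x) -> forall x, q x <= r x.
Proof.
  intros Hp.
  pose (T := {q : V -> R | sublinear q /\ forall x, q x <= p x}).
  pose (ord := fun q r : T => boolp.asbool (forall x, proj1_sig r x <= proj1_sig q x)).
  assert (ordE : forall q r, is_true (ord q r) <-> forall x, proj1_sig r x <= proj1_sig q x).
  { intros q r; unfold ord.
    destruct (boolp.asboolP (forall x, proj1_sig r x <= proj1_sig q x)) as [H | H];
      split; intros H'; [exact H | reflexivity | discriminate H' | contradiction]. }
  destruct (@classical_sets.ZL_preorder T (exist _ p (conj Hp (fun x => Rle_refl _))) ord)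
    as [[q [Hq Hqp]] Hmax].
  - intros q; apply ordE; intros x; apply Rle_refl.
  - intros q r s Hqr Hrs; apply ordE; intros x.
    apply Rle_trans with (proj1_sig r x); [now apply ordE | now apply ordE].
  - intros A HA.
    destruct (classic (exists q, A q)) as [[[q0 Hq0] HAq0] | Hemp].
    + destruct (chain_inf_sublinear (fun q => exists t : T, A t /\ q = proj1_sig t))
        as [m [Hm Hmle]].
      * exists q0, (exist _ q0 Hq0); now split.
      * intros q [t [_ ->]]; exact (proj1 (proj2_sig t)).
      * intros q r [s [Hs ->]] [t [Ht ->]].
        destruct (HA s t Hs Ht) as [H | H]; [right | left]; now apply ordE.
      * assert (Hmp : forall x, m x <= p x).
        { intros x; apply Rle_trans with (q0 x); [|apply Hq0].
          apply Hmle; now exists (exist _ q0 Hq0). }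
        exists (exist _ m (conj Hm Hmp)); intros s Hs; apply ordE; intros x; simpl.
        apply Hmle; now exists s.
    + exists (exist _ p (conj Hp (fun x => Rle_refl _))); intros s Hs; exfalso; eauto.
  - exists q; split; [exact Hq|]; split; [exact Hqp|].
    intros r Hr Hrq.
    assert (Hrp : forall x, r x <= p x) by (intros x; apply Rle_trans with (q x); auto).
    pose (tq := exist _ q (conj Hq Hqp) : T); pose (tr := exist _ r (conj Hr Hrp) : T).
    exact (proj1 (ordE tr tq) (Hmax tr (proj2 (ordE tq tr) Hrq))).
Qed.

(** A minimal sublinear functional is linear: [push q y] cannot lie strictly below [q], so
    [q (- y) <= - q y], and odd together with subadditive means additive. Starting below
    [push norm u] forces [q (- u) <= - norm u], which fixes the value at [u]. *)
Lemma real_hahn_banach (u : V) :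
  exists q : V -> R, (forall x y, q (plus x y) = q x + q y) /\
    (forall t x, q (rscal t x) = t * q x) /\
    (forall x, q x <= norm x) /\ q u = norm u.
Proof.
  pose proof (push_sublinear _ u sublinear_norm) as Hp0.
  destruct (minimal_sublinear _ Hp0) as [q [Hq [Hqp Hmin]]].
  assert (Hqn : forall x, q x <= norm x).
  { intros x; apply Rle_trans with (1 := Hqp x); exact (push_le _ _ _ sublinear_norm). }
  assert (Hodd : forall y, q (opp y) = - q y).
  { intros y.
    pose proof (Hmin _ (push_sublinear q y Hq) (fun x => push_le q y x Hq) (opp y)).
    pose proof (push_opp q y Hq); pose proof (sublinear_opp q y Hq); lra. }
  exists q; repeat split; [| |exact Hqn|].
  - intros x y.
    pose proof (sublinear_plus q Hq x y) as H1.
    pose proof (sublinear_plus q Hq (opp x) (opp y)) as H2.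
    vreplace V : (plus (opp x) (opp y)) with (opp (plus x y)) in H2.
    rewrite !Hodd in H2; lra.
  - intros t x; destruct (Rtotal_order t 0) as [Ht | [-> | Ht]].
    + vreplace V : (rscal t x) with (opp (scal (- RtoC t)%C x)).
      rewrite <- RtoC_opp, Hodd, (sublinear_scal_eq q) by (assumption || lra); ring.
    + rewrite scal_C_zero, sublinear_zero by assumption; ring.
    + now apply sublinear_scal_eq.
  - apply Rle_antisym; [apply Hqn|].
    specialize (Hqp (opp u)); pose proof (push_opp _ u sublinear_norm) as H.
    simpl in H; rewrite Hodd in Hqp; lra.
Qed.

Lemma hahn_banach (u : V) :
  exists l : Lin V C_NormedModule, (forall x, Cmod (l x) <= norm x) /\ l u = RtoC (norm u).
Proof.
  destruct (real_hahn_banach u) as [q [Hadd [Hsc [Hle Hu]]]].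
  (* The complex-linear functional with real part [q] is [q x - i q (i x)]. *)
  pose (L x := (q x, - q (scal (Ci : C_AbsRing) x)) : C).
  assert (Hci : forall c x, q (scal (c : C_AbsRing) x) = Re c * q x + Im c * q (scal (Ci : C_AbsRing) x)).
  { intros [a b] x; simpl; rewrite <- !Hsc, <- Hadd; f_equal.
    module_coefs V; unfold Ci, RtoC, Cmult, Cplus; simpl; f_equal; ring. }
  assert (Hplus : forall x y, L (plus x y) = (L x + L y)%C).
  { intros x y; unfold L, Cplus; simpl; f_equal; [apply Hadd|].
    vreplace V : (scal (Ci : C_AbsRing) (plus x y))
      with (plus (scal (Ci : C_AbsRing) x) (scal (Ci : C_AbsRing) y)).
    rewrite Hadd; ring. }
  assert (Hscal : forall c x, L (scal (c : C_AbsRing) x) = (c * L x)%C).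
  { intros c x; unfold L.
    rewrite scal_C_assoc, (Hci c x), (Hci (Ci * c)%C x); destruct c as [a b]; unfold Cmult, Ci; simpl; f_equal; ring. }
  assert (Hbound : forall x, Cmod (L x) <= norm x).
  { intros x; destruct (unimodular_rotation (L x)) as [c [Hc HcL]].
    rewrite <- Hscal in HcL; apply (f_equal fst) in HcL; simpl in HcL; rewrite <- HcL.
    apply Rle_trans with (1 := Hle _); rewrite norm_scal_C, Hc; lra. }
  assert (Hlin : is_linear (V := C_NormedModule) L).
  { split; [exact Hplus | exact Hscal |].
    exists 1; split; [lra|]; intros x; rewrite Rmult_1_l; apply Hbound. }
  exists (mkLin V C_NormedModule L Hlin); split; [exact Hbound|].
  pose proof (Hbound u) as HB; simpl; unfold L in *; rewrite Hu in *.
  set (s := q (scal (Ci : C_AbsRing) u)) in *.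
  pose proof (norm_ge_0 u).
  (* The real part of [L u] already has modulus [norm u], and [|L u| <= norm u], so no room is left
     for an imaginary part. *)
  assert (Hs : s = 0).
  { apply (Rsqr_incr_1 _ _) in HB; [|apply Cmod_ge_0 | assumption].
    unfold Rsqr in HB; unfold Cmod in HB; rewrite sqrt_sqrt in HB.
    - simpl in HB; nra.
    - simpl; nra. }
  rewrite Hs, Ropp_0; reflexivity.
Qed.

End Sublinear_functionals.

(** The device that carries scalar Cauchy estimates over to vector-valued maps: constants that do
    not depend on [l] survive as norm bounds. *)
Lemma norm_le_functionals {V : CNormedModule} (y : V) (M : R) :
  (forall l : Lin V C_NormedModule, (forall x, Cmod (l x) <= norm x) -> Cmod (l y) <= M) ->
  norm y <= M.
Proof.
  intros H; destruct (hahn_banach y) as [l [Hl Hy]]; specialize (H l Hl).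
  rewrite Hy, Cmod_R, Rabs_pos_eq in H by apply norm_ge_0; exact H.
Qed.

Lemma support_functional_exists {V : CNormedModule} (u : V) :
  u <> zero -> exists l : Lin V C_NormedModule, support_functional u l.
Proof.
  intros Hu; destruct (hahn_banach u) as [l [Hl Hlu]].
  exists l; split; [exact Hlu|].
  apply norm_pos_neq0 in Hu.
  apply Rle_antisym.
  - apply Lin_norm_le_of; [lra|]; intros x; rewrite Rmult_1_l; apply Hl.
  - pose proof (Lin_norm_apply l u) as H.
    rewrite Hlu in H; change (norm (RtoC (norm u))) with (Cmod (RtoC (norm u))) in H.
    rewrite Cmod_R, Rabs_pos_eq in H by lra.
    apply Rmult_le_reg_r with (norm u); lra.
Qed.

(** * Goursat's lemma *)

Lemma nested_intervals (u v : nat -> R) :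
  (forall n, u n <= u (S n)) -> (forall n, v (S n) <= v n) -> (forall n, u n <= v n) ->
  exists x, forall n, u n <= x <= v n.
Proof.
  intros Hu Hv Huv.
  assert (Hu' : forall n m, (n <= m)%nat -> u n <= u m)
    by (intros n m H; induction H; [lra | specialize (Hu m); lra]).
  assert (Hv' : forall n m, (n <= m)%nat -> v m <= v n)
    by (intros n m H; induction H; [lra | specialize (Hv m); lra]).
  assert (Hc : forall n m, u n <= v m).
  { intros n m; specialize (Hu' n (max n m) (Nat.le_max_l _ _)).
    specialize (Hv' m (max n m) (Nat.le_max_r _ _)); specialize (Huv (max n m)); lra. }
  destruct (completeness (fun r => exists n, r = u n)) as [x [H1 H2]].
  - exists (v O); intros r [n ->]; apply Hc.
  - now exists (u O), O.
  - exists x; intros n; split; [apply H1; now exists n|].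
    apply H2; intros r [m ->]; apply Hc.
Qed.

(** The integral of [f] along the boundary of [[a, b] x [c, d]], counterclockwise from the bottom
    side; [dz = i dy] on the vertical sides. *)
Definition rect_int (f : C -> C) (a b c d : R) : C :=
  (Cint (fun x => f (x, c)) a b + Ci * Cint (fun y => f (b, y)) c d
   - Cint (fun x => f (x, d)) a b - Ci * Cint (fun y => f (a, y)) c d)%C.

Lemma ccont_horizontal y t : ccont (fun x => (x, y) : C) t.
Proof.
  apply ccont_components; simpl; split; [apply continuous_id | apply continuous_const].
Qed.

Lemma ccont_vertical x t : ccont (fun y => (x, y) : C) t.
Proof.
  apply ccont_components; simpl; split; [apply continuous_const | apply continuous_id].
Qed.

Lemma rect_int_affine (p q : C) a b c d : a <= b -> c <= d ->
  rect_int (fun z => p + z * q)%C a b c d = RtoC 0.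
Proof.
  intros Hab Hcd; unfold rect_int.
  assert (Eh : forall y, Cint (fun x => p + (x, y) * q)%C a b =
    (RtoC (b - a) * (p + Ci * RtoC y * q) + RtoC ((b * b - a * a) / 2) * q)%C).
  { intros y; rewrite <- Cint_affine by exact Hab; apply Cint_ext; [exact Hab|]; intros x _.
    destruct p, q; unfold Cplus, Cmult, RtoC, Ci; simpl; f_equal; ring. }
  assert (Ev : forall x, Cint (fun y => p + (x, y) * q)%C c d =
    (RtoC (d - c) * (p + RtoC x * q) + RtoC ((d * d - c * c) / 2) * (Ci * q))%C).
  { intros x; rewrite <- Cint_affine by exact Hcd; apply Cint_ext; [exact Hcd|]; intros y _.
    destruct p, q; unfold Cplus, Cmult, RtoC, Ci; simpl; f_equal; ring. }
  rewrite !Eh, !Ev.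
  set (A := ((b * b - a * a) / 2)); set (B := ((d * d - c * c) / 2)); rewrite !RtoC_minus; ring.
Qed.

Section Goursat.

Variables (f : C -> C) (a b c d : R).
Hypothesis Hab : a < b.
Hypothesis Hcd : c < d.
Hypothesis Hf : forall x y, a <= x <= b -> c <= y <= d -> exists e, cdiff f (x, y) e.

Lemma horizontal_ok a' b' y : a <= a' -> a' <= b' -> b' <= b -> c <= y <= d ->
  ccont_on (fun x => f (x, y)) a' b'.
Proof.
  intros H1 H2 H3 H4; split; [exact H2|]; intros t Ht.
  destruct (Hf t y) as [e He]; [lra | exact H4|].
  apply (ccont_cdiff f (fun x => (x, y)) t e He), ccont_horizontal.
Qed.

Lemma vertical_ok c' d' x : c <= c' -> c' <= d' -> d' <= d -> a <= x <= b ->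
  ccont_on (fun y => f (x, y)) c' d'.
Proof.
  intros H1 H2 H3 H4; split; [exact H2|]; intros t Ht.
  destruct (Hf x t) as [e He]; [exact H4 | lra|].
  apply (ccont_cdiff f (fun y => (x, y)) t e He), ccont_vertical.
Qed.

Lemma rect_int_split a' b' c' d' m n :
  a <= a' -> a' <= m -> m <= b' -> b' <= b -> c <= c' -> c' <= n -> n <= d' -> d' <= d ->
  rect_int f a' b' c' d' =
  (rect_int f a' m c' n + rect_int f m b' c' n + rect_int f a' m n d' + rect_int f m b' n d')%C.
Proof.
  intros H1 H2 H3 H4 H5 H6 H7 H8; unfold rect_int.
  rewrite (Cint_Chasles (fun x => f (x, c')) a' m b') by (apply horizontal_ok; lra).
  rewrite (Cint_Chasles (fun x => f (x, d')) a' m b') by (apply horizontal_ok; lra).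
  rewrite (Cint_Chasles (fun y => f (a', y)) c' n d') by (apply vertical_ok; lra).
  rewrite (Cint_Chasles (fun y => f (b', y)) c' n d') by (apply vertical_ok; lra).
  ring.
Qed.

Let w n := (b - a) / 2 ^ n.
Let h n := (d - c) / 2 ^ n.

(* [(x, y)] is the lower left corner of a rectangle of the [n]-th subdivision
   that carries at least its share of the boundary integral. *)
Let good n (p : R * R) : Prop :=
  a <= fst p /\ fst p + w n <= b /\ c <= snd p /\ snd p + h n <= d /\
  Cmod (rect_int f a b c d) <=
    4 ^ n * Cmod (rect_int f (fst p) (fst p + w n) (snd p) (snd p + h n)).

(** The integrals over the four quarters add up to the whole one, so at least one of them has a
    quarter of its modulus; [i] and [j] below are the offsets of that quarter. *)
Lemma good_step n p : good n p -> exists q, good (S n) q /\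
  (fst p <= fst q /\ fst q + w (S n) <= fst p + w n) /\
  (snd p <= snd q /\ snd q + h (S n) <= snd p + h n).
Proof.
  destruct p as [x y]; intros [H1 [H2 [H3 [H4 H5]]]]; simpl in *.
  assert (H2n : 0 < 2 ^ n) by (apply pow_lt; lra).
  assert (Hw : w n = 2 * w (S n)) by (unfold w; simpl; field; lra).
  assert (Hh : h n = 2 * h (S n)) by (unfold h; simpl; field; lra).
  assert (Hw0 : 0 < w (S n)) by (unfold w; apply Rdiv_lt_0_compat; [lra | apply pow_lt; lra]).
  assert (Hh0 : 0 < h (S n)) by (unfold h; apply Rdiv_lt_0_compat; [lra | apply pow_lt; lra]).
  set (w' := w (S n)) in *; set (h' := h (S n)) in *.
  assert (H4n : 0 < 4 ^ n) by (apply pow_lt; lra).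
  pose proof (rect_int_split x (x + w n) y (y + h n) (x + w') (y + h')
    ltac:(lra) ltac:(lra) ltac:(lra) ltac:(lra) ltac:(lra) ltac:(lra) ltac:(lra) ltac:(lra)) as E.
  replace (x + w n) with (x + w' + w') in E by lra.
  replace (y + h n) with (y + h' + h') in E by lra.
  set (J := Cmod (rect_int f a b c d)) in *.
  assert (Hex : exists i j, 0 <= i <= w' /\ 0 <= j <= h' /\
    J <= 4 * 4 ^ n * Cmod (rect_int f (x + i) (x + i + w') (y + j) (y + j + h'))).
  { replace (x + w n) with (x + w' + w') in H5 by lra.
    replace (y + h n) with (y + h' + h') in H5 by lra.
    rewrite E in H5.
    set (r1 := rect_int f x (x + w') y (y + h')) in *.
    set (r2 := rect_int f (x + w') (x + w' + w') y (y + h')) in *.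
    set (r3 := rect_int f x (x + w') (y + h') (y + h' + h')) in *.
    set (r4 := rect_int f (x + w') (x + w' + w') (y + h') (y + h' + h')) in *.
    pose proof (Cmod_triangle (r1 + r2 + r3) r4).
    pose proof (Cmod_triangle (r1 + r2) r3).
    pose proof (Cmod_triangle r1 r2).
    destruct (Rle_dec J (4 * 4 ^ n * Cmod r1)) as [K1 | K1].
    { exists 0, 0; rewrite !Rplus_0_r; repeat split; lra || exact K1. }
    destruct (Rle_dec J (4 * 4 ^ n * Cmod r2)) as [K2 | K2].
    { exists w', 0; rewrite !Rplus_0_r; repeat split; lra || exact K2. }
    destruct (Rle_dec J (4 * 4 ^ n * Cmod r3)) as [K3 | K3].
    { exists 0, h'; rewrite !Rplus_0_r; repeat split; lra || exact K3. }
    destruct (Rle_dec J (4 * 4 ^ n * Cmod r4)) as [K4 | K4].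
    { exists w', h'; repeat split; lra || exact K4. }
    exfalso.
    assert (4 ^ n * Cmod (r1 + r2 + r3 + r4) <=
      4 ^ n * (Cmod r1 + Cmod r2 + Cmod r3 + Cmod r4))
      by (apply Rmult_le_compat_l; lra).
    lra. }
  destruct Hex as [i [j [Hi [Hj HJ]]]].
  exists (x + i, y + j); unfold good; simpl fst; simpl snd.
  fold w' h'; simpl pow; repeat split; lra || exact HJ.
Qed.

Lemma good_start : good O (a, c).
Proof.
  unfold good, w, h; simpl; rewrite !Rdiv_1_r, Rmult_1_l.
  replace (a + (b - a)) with b by ring; replace (c + (d - c)) with d by ring.
  repeat split; lra.
Qed.

Let next n (p : {p | good n p}) : {q | good (S n) q /\
  (fst (proj1_sig p) <= fst q /\ fst q + w (S n) <= fst (proj1_sig p) + w n) /\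
  (snd (proj1_sig p) <= snd q /\ snd q + h (S n) <= snd (proj1_sig p) + h n)} :=
  constructive_indefinite_description _ (good_step n (proj1_sig p) (proj2_sig p)).

Fixpoint corner n : {p | good n p} :=
  match n with
  | O => exist _ (a, c) good_start
  | S n => exist _ (proj1_sig (next n (corner n))) (proj1 (proj2_sig (next n (corner n))))
  end.

(** The nested rectangles shrink to a point [(x, y)]. Subtracting the tangent map there does not
    change the integrals and leaves an integrand of size [eps (w n + h n)], hence an integral of
    size [2 eps (w n + h n)^2]; the factor [4 ^ n] makes up exactly for the shrinking. *)
Lemma goursat : rect_int f a b c d = RtoC 0.
Proof.
  assert (H2n : forall n, 0 < 2 ^ n) by (intros n; apply pow_lt; lra).
  assert (Hw0 : forall n, 0 < w n) by (intros n; unfold w; apply Rdiv_lt_0_compat; [lra | apply H2n]).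
  assert (Hh0 : forall n, 0 < h n) by (intros n; unfold h; apply Rdiv_lt_0_compat; [lra | apply H2n]).
  destruct (nested_intervals (fun n => fst (proj1_sig (corner n)))
    (fun n => fst (proj1_sig (corner n)) + w n)) as [x Hx].
  { intros n; simpl; apply (proj2_sig (next n (corner n))). }
  { intros n; apply (proj2_sig (next n (corner n))). }
  { intros n; specialize (Hw0 n); lra. }
  destruct (nested_intervals (fun n => snd (proj1_sig (corner n)))
    (fun n => snd (proj1_sig (corner n)) + h n)) as [y Hy].
  { intros n; simpl; apply (proj2_sig (next n (corner n))). }
  { intros n; apply (proj2_sig (next n (corner n))). }
  { intros n; specialize (Hh0 n); lra. }
  assert (Hxab : a <= x <= b).
  { specialize (Hx O); destruct (proj2_sig (corner O)) as [K1 [K2 _]]; lra. }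
  assert (Hycd : c <= y <= d).
  { specialize (Hy O); destruct (proj2_sig (corner O)) as [_ [_ [K1 [K2 _]]]]; lra. }
  destruct (Hf x y Hxab Hycd) as [e He].
  apply (norm_le_eps (V := C_NormedModule) _ (2 * ((b - a) + (d - c)) ^ 2)); intros eps Heps.
  change (Cmod (rect_int f a b c d) <= eps * (2 * (b - a + (d - c)) ^ 2)).
  destruct (He eps Heps) as [del [Hdel Hd]].
  (* The extra [1] makes the inequality [w n + h n < del] strict. *)
  destruct (Pow_x_infinity 2 ltac:(rewrite Rabs_pos_eq; lra) (((b - a) + (d - c)) / del + 1))
    as [n Hn].
  specialize (Hn n (le_n n)); rewrite Rabs_pos_eq in Hn by (apply Rlt_le, H2n).
  assert (Hsmall : w n + h n < del).
  { unfold w, h; rewrite <- Rdiv_plus_distr; apply Rlt_div_l; [apply H2n|].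
    apply Rlt_le_trans with (del * (((b - a) + (d - c)) / del + 1)).
    - replace (del * (((b - a) + (d - c)) / del + 1)) with ((b - a) + (d - c) + del) by (field; lra).
      lra.
    - apply Rmult_le_compat_l; lra. }
  specialize (Hx n); specialize (Hy n).
  destruct (proj2_sig (corner n)) as [K1 [K2 [K3 [K4 K5]]]].
  set (x0 := fst (proj1_sig (corner n))) in *; set (y0 := snd (proj1_sig (corner n))) in *.
  specialize (Hw0 n); specialize (Hh0 n).
  set (wn := w n) in *; set (hn := h n) in *.
  set (p := (f (x, y) - (x, y) * e)%C).
  pose (r := fun z : C => (f z - (p + z * e))%C).
  assert (Hr : forall s t, x0 <= s <= x0 + wn -> y0 <= t <= y0 + hn ->
    Cmod (r (s, t)) <= eps * (wn + hn)).
  { intros s t Hs Ht.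
    pose (k := ((s, t) - (x, y))%C).
    assert (Hk : Cmod k <= wn + hn).
    { apply Rle_trans with (1 := Cmod_le_components k); unfold k; simpl.
      apply Rplus_le_compat; apply Rabs_le; lra. }
    specialize (Hd k ltac:(lra)).
    replace ((x, y) + k)%C with ((s, t) : C) in Hd
      by (unfold k, Cminus, Cplus, Copp; simpl; f_equal; ring).
    replace (r (s, t)) with (f (s, t) - (f (x, y) + e * k))%C by (unfold r, p, k; ring).
    apply Rle_trans with (1 := Hd); apply Rmult_le_compat_l; lra. }
  assert (Hlin : forall z : C, exists e', cdiff (fun z => p + z * e)%C z e').
  { intros z; eexists; apply cdiff_plus; [apply cdiff_const|].
    apply cdiff_mult; [apply cdiff_id | apply cdiff_const]. }
  assert (HhL : forall t, ccont_on (fun s => p + (s, t) * e)%C x0 (x0 + wn)).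
  { intros t; split; [lra|]; intros s _; destruct (Hlin (s, t)) as [e' He'].
    exact (ccont_cdiff _ (fun s => (s, t)) s e' He' (ccont_horizontal _ _)). }
  assert (HvL : forall s, ccont_on (fun t => p + (s, t) * e)%C y0 (y0 + hn)).
  { intros s; split; [lra|]; intros t _; destruct (Hlin (s, t)) as [e' He'].
    exact (ccont_cdiff _ (fun t => (s, t)) t e' He' (ccont_vertical _ _)). }
  assert (Hsub : rect_int r x0 (x0 + wn) y0 (y0 + hn) = rect_int f x0 (x0 + wn) y0 (y0 + hn)).
  { transitivity (rect_int f x0 (x0 + wn) y0 (y0 + hn)
      - rect_int (fun z => p + z * e)%C x0 (x0 + wn) y0 (y0 + hn))%C.
    - unfold rect_int, r.
      rewrite !Cint_minus; [ring | ..];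
        (apply HhL || apply HvL || (apply horizontal_ok; lra) || (apply vertical_ok; lra)).
    - rewrite rect_int_affine by lra; ring. }
  (* Perimeter [2 (wn + hn)] times the bound [eps (wn + hn)] of [r]. *)
  assert (Hb : Cmod (rect_int r x0 (x0 + wn) y0 (y0 + hn)) <= 2 * eps * (wn + hn) ^ 2).
  { assert (E1 : forall t, y0 <= t <= y0 + hn ->
      Cmod (Cint (fun s => r (s, t)) x0 (x0 + wn)) <= eps * (wn + hn) * wn).
    { intros t Ht; replace wn with (x0 + wn - x0) at 3 by ring.
      apply Cint_le; [|intros s Hs; now apply Hr].
      apply ccont_on_minus; [apply horizontal_ok; lra | apply HhL]. }
    assert (E2 : forall s, x0 <= s <= x0 + wn ->
      Cmod (Cint (fun t => r (s, t)) y0 (y0 + hn)) <= eps * (wn + hn) * hn).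
    { intros s Hs; replace hn with (y0 + hn - y0) at 3 by ring.
      apply Cint_le; [|intros t Ht; now apply Hr].
      apply ccont_on_minus; [apply vertical_ok; lra | apply HvL]. }
    unfold rect_int.
    pose proof (E1 y0 ltac:(lra)); pose proof (E1 (y0 + hn) ltac:(lra)).
    pose proof (E2 x0 ltac:(lra)); pose proof (E2 (x0 + wn) ltac:(lra)).
    assert (HCi : Cmod Ci = 1) by (unfold Cmod, Ci; simpl;
      replace (0 * (0 * 1) + 1 * (1 * 1)) with 1 by ring; apply sqrt_1).
    unfold Cminus.
    apply Rle_trans with (1 := Cmod_triangle _ _).
    apply Rle_trans with (1 := Rplus_le_compat_r _ _ _ (Cmod_triangle _ _)).
    apply Rle_trans with (1 := Rplus_le_compat_r _ _ _ (Rplus_le_compat_r _ _ _ (Cmod_triangle _ _))).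
    rewrite !Cmod_opp, !Cmod_mult, HCi; lra. }
  rewrite Hsub in Hb.
  apply Rle_trans with (1 := K5).
  apply Rle_trans with (4 ^ n * (2 * eps * (wn + hn) ^ 2)).
  - apply Rmult_le_compat_l; [apply Rlt_le, pow_lt; lra | exact Hb].
  - unfold wn, hn, w, h.
    replace 4 with (2 * 2) by ring; rewrite Rpow_mult_distr.
    specialize (H2n n); right; field; lra.
Qed.

End Goursat.

(** * Circle means *)

Definition Cexp (z : C) : C := (exp (fst z) * cos (snd z), exp (fst z) * sin (snd z)).

Lemma Cexp_plus z w : Cexp (z + w) = (Cexp z * Cexp w)%C.
Proof.
  destruct z as [a b], w as [c d]; unfold Cexp, Cplus, Cmult; simpl.
  rewrite exp_plus, cos_plus, sin_plus; f_equal; ring.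
Qed.

Lemma Cexp_0 : Cexp (RtoC 0) = RtoC 1.
Proof. unfold Cexp, RtoC; simpl; rewrite exp_0, cos_0, sin_0; f_equal; ring. Qed.

Lemma Cmod_Cexp z : Cmod (Cexp z) = exp (fst z).
Proof.
  destruct z as [a b]; unfold Cmod, Cexp; simpl.
  transitivity (sqrt (exp a * exp a)); [|apply sqrt_square, Rlt_le, exp_pos].
  f_equal; pose proof (sin2_cos2 b) as H; unfold Rsqr in H.
  transitivity (exp a * exp a * (sin b * sin b + cos b * cos b)); [ring | rewrite H; ring].
Qed.

Lemma Cexp_neq_0 z : Cexp z <> RtoC 0.
Proof. apply Cmod_gt_0; rewrite Cmod_Cexp; apply exp_pos. Qed.

Lemma derivable_pt_lim_small f l : derivable_pt_lim f 0 l -> forall eps, 0 < eps ->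
  exists del, 0 < del /\ forall h, Rabs h < del -> Rabs (f h - f 0 - l * h) <= eps * Rabs h.
Proof.
  intros H eps Heps; destruct (H eps Heps) as [del Hd].
  exists del; split; [apply cond_pos|]; intros h Hh.
  destruct (Req_dec h 0) as [-> | Hh0].
  { replace (f 0 - f 0 - l * 0) with 0 by ring; rewrite Rabs_R0; lra. }
  specialize (Hd h Hh0 Hh); rewrite Rplus_0_l in Hd.
  replace (f h - f 0 - l * h) with (((f h - f 0) / h - l) * h) by (field; exact Hh0).
  rewrite Rabs_mult; apply Rmult_le_compat_r; [apply Rabs_pos | lra].
Qed.

Lemma cdiff_Cexp_0 : cdiff Cexp (RtoC 0) (RtoC 1).
Proof.
  intros eps Heps.
  (* The real part of the remainder is at most [4 k m] and the imaginary part at most [5 k m],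
     whence the 9. The bound [1 / 2] gives [exp x <= 3] and [|sin y| <= 2 |y|]. *)
  set (k := Rmin (1 / 2) (eps / 9)).
  assert (Hk : 0 < k) by (apply Rmin_pos; lra).
  pose proof (Rmin_l (1 / 2) (eps / 9)) as Hk1; pose proof (Rmin_r (1 / 2) (eps / 9)) as Hk2; fold k in Hk1, Hk2; clearbody k.
  destruct (derivable_pt_lim_small _ _ derivable_pt_lim_exp_0 k Hk) as [d1 [Hd1 H1]].
  destruct (derivable_pt_lim_small _ _ derivable_pt_lim_sin_0 k Hk) as [d2 [Hd2 H2]].
  destruct (derivable_pt_lim_small _ _ derivable_pt_lim_cos_0 k Hk) as [d3 [Hd3 H3]].
  rewrite exp_0 in H1; rewrite sin_0 in H2; rewrite cos_0 in H3.
  exists (Rmin (Rmin d1 k) (Rmin d2 d3)); split; [repeat apply Rmin_pos; assumption|].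
  intros [x y] Hh.
  pose proof (Rmin_l (Rmin d1 k) (Rmin d2 d3)); pose proof (Rmin_r (Rmin d1 k) (Rmin d2 d3)).
  pose proof (Rmin_l d1 k); pose proof (Rmin_r d1 k).
  pose proof (Rmin_l d2 d3); pose proof (Rmin_r d2 d3).
  pose proof (Rmax_Cmod (x, y)) as Hm; simpl in Hm.
  pose proof (Rmax_l (Rabs x) (Rabs y)); pose proof (Rmax_r (Rabs x) (Rabs y)).
  specialize (H1 x ltac:(lra)); specialize (H2 y ltac:(lra)); specialize (H3 y ltac:(lra)).
  set (m := Cmod (x, y)) in *.
  rewrite Cexp_0.
  apply Rle_trans with (1 := Cmod_le_components _).
  unfold Cexp; simpl.
  rewrite !Rplus_0_l.
  replace (exp x * cos y + - (1 + (1 * x - 0 * y)))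
    with (exp x * (cos y - 1 - 0 * y) + (exp x - 1 - 1 * x)) by ring.
  replace (exp x * sin y + - (1 * y + 0 * x))
    with ((exp x - 1) * sin y + (sin y - 0 - 1 * y)) by ring.
  assert (He3 : Rabs (exp x) <= 3).
  { rewrite Rabs_pos_eq by (apply Rlt_le, exp_pos).
    apply Rle_trans with (2 := exp_le_3); apply Rlt_le, exp_increasing.
    pose proof (Rle_abs x); lra. }
  assert (He1 : Rabs (exp x - 1) <= 2 * k).
  { replace (exp x - 1) with ((exp x - 1 - 1 * x) + x) by ring.
    apply Rle_trans with (1 := Rabs_triang _ _); pose proof (Rabs_pos x); nra. }
  assert (Hs : Rabs (sin y) <= 2 * Rabs y).
  { replace (sin y) with ((sin y - 0 - 1 * y) + y) by ring.
    apply Rle_trans with (1 := Rabs_triang _ _); pose proof (Rabs_pos y); nra. }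
  assert (A : Rabs (exp x * (cos y - 1 - 0 * y) + (exp x - 1 - 1 * x)) <= 4 * k * m).
  { apply Rle_trans with (1 := Rabs_triang _ _); rewrite Rabs_mult.
    assert (Rabs (exp x) * Rabs (cos y - 1 - 0 * y) <= 3 * (k * Rabs y))
      by (apply Rmult_le_compat; try apply Rabs_pos; assumption).
    nra. }
  assert (B : Rabs ((exp x - 1) * sin y + (sin y - 0 - 1 * y)) <= 5 * k * m).
  { apply Rle_trans with (1 := Rabs_triang _ _); rewrite Rabs_mult.
    assert (Rabs (exp x - 1) * Rabs (sin y) <= 2 * k * (2 * Rabs y))
      by (apply Rmult_le_compat; try apply Rabs_pos; assumption).
    nra. }
  assert (0 <= m) by apply Cmod_ge_0.
  apply Rle_trans with (9 * k * m); [lra|].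
  apply Rmult_le_compat_r; lra.
Qed.

Lemma cdiff_Cexp z : cdiff Cexp z (Cexp z).
Proof.
  apply cdiff_ext with (fun w => Cexp z * Cexp (w + (- z)))%C.
  { intros w; rewrite <- Cexp_plus; f_equal; ring. }
  assert (H : cdiff (fun w => w + - z)%C z (RtoC 1)).
  { apply (cdiff_eq _ _ _ _ (cdiff_plus _ _ _ _ _ (cdiff_id z) (cdiff_const (- z) z))); ring. }
  assert (H0 : cdiff Cexp (z + - z)%C (RtoC 1)).
  { replace (z + - z)%C with (RtoC 0) by ring; apply cdiff_Cexp_0. }
  apply (cdiff_eq _ _ _ _ (cdiff_scal (Cexp z) _ _ _ (cdiff_comp _ _ _ _ _ H H0))); ring.
Qed.

Definition circle (r t : R) : C := (r * cos t, r * sin t).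

Lemma circle_Cexp s t : circle (exp s) t = Cexp (s, t).
Proof. reflexivity. Qed.

Lemma circle_Cexp_ln r t : 0 < r -> circle r t = Cexp (ln r, t).
Proof. intros Hr; rewrite <- circle_Cexp, exp_ln by exact Hr; reflexivity. Qed.

Lemma Cmod_circle r t : 0 < r -> Cmod (circle r t) = r.
Proof. intros Hr; rewrite circle_Cexp_ln, Cmod_Cexp by exact Hr; apply exp_ln, Hr. Qed.

Lemma circle_neq_0 r t : 0 < r -> circle r t <> RtoC 0.
Proof. intros Hr; apply Cmod_gt_0; rewrite Cmod_circle; exact Hr. Qed.

Lemma circle_inv r t : 0 < r -> (/ circle r t)%C = (RtoC (/ r) * (cos t, Ropp (sin t)))%C.
Proof.
  intros Hr.
  assert (H : (circle r t * (RtoC (/ r) * (cos t, Ropp (sin t))))%C = RtoC 1).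
  { pose proof (sin2_cos2 t) as E; unfold Rsqr in E.
    unfold circle, Cmult, RtoC; simpl; f_equal; [|field; lra].
    transitivity (sin t * sin t + cos t * cos t); [field; lra | exact E]. }
  pose proof (circle_neq_0 r t Hr).
  transitivity (/ circle r t * (circle r t * (RtoC (/ r) * (cos t, Ropp (sin t)))))%C.
  - rewrite H; ring.
  - field; assumption.
Qed.

Lemma ccont_circle r t : ccont (circle r) t.
Proof.
  apply ccont_components; split; unfold circle; simpl;
    apply (ex_derive_continuous (K := R_AbsRing) (V := R_NormedModule)); auto_derive; trivial.
Qed.

(** Equals the contour integral of [F(w) / (2 pi i w)]: for [F] holomorphic on a punctured disk this
    is the constant Laurent coefficient. *)
Definition Cmean (F : C -> C) (r : R) : C :=
  (Cint (fun t => F (circle r t)) 0 (2 * PI) / RtoC (2 * PI))%C.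

Definition differentiable_at (F : C -> C) (w : C) : Prop := exists e, cdiff F w e.

Lemma circle_ok F r : 0 < r -> (forall w, Cmod w = r -> differentiable_at F w) ->
  ccont_on (fun t => F (circle r t)) 0 (2 * PI).
Proof.
  intros Hr HF; pose proof PI_RGT_0; split; [lra|]; intros t _.
  destruct (HF (circle r t) (Cmod_circle r t Hr)) as [e He].
  exact (ccont_cdiff F (circle r) t e He (ccont_circle r t)).
Qed.

Lemma PI2_neq_0 : RtoC (2 * PI) <> RtoC 0.
Proof. pose proof PI_RGT_0; intros E; apply RtoC_inj in E; lra. Qed.

(* Goursat's lemma for F o exp on the rectangle [ln r1, ln r2] x [0, 2 pi]. *)
Lemma Cmean_constant_lt F R0 r1 r2 :
  (forall w, 0 < Cmod w < R0 -> differentiable_at F w) -> 0 < r1 -> r1 < r2 -> r2 < R0 ->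
  Cmean F r1 = Cmean F r2.
Proof.
  intros HF H1 H2 H3; pose proof PI_RGT_0 as Hpi.
  pose proof (ln_increasing r1 r2 H1 H2) as Hln.
  assert (G : rect_int (fun z => F (Cexp z)) (ln r1) (ln r2) 0 (2 * PI) = RtoC 0).
  { apply goursat; [exact Hln | lra |].
    intros x y Hx _; destruct (HF (Cexp (x, y))) as [e He].
    - rewrite Cmod_Cexp; simpl; split; [apply exp_pos|].
      apply Rle_lt_trans with r2; [|exact H3].
      rewrite <- (exp_ln r2) by lra.
      destruct (Rle_lt_or_eq_dec x (ln r2)) as [K | ->]; [lra | | lra].
      now apply Rlt_le, exp_increasing.
    - exists (e * Cexp (x, y))%C; exact (cdiff_comp _ _ _ _ _ (cdiff_Cexp _) He). }
  unfold rect_int in G.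
  (* The sides at heights [0] and [2 pi] have the same image under [Cexp], so they cancel and only
     the two circles remain. *)
  assert (E : Cint (fun x => F (Cexp (x, 2 * PI))) (ln r1) (ln r2)
    = Cint (fun x => F (Cexp (x, 0))) (ln r1) (ln r2)).
  { apply Cint_ext; [lra|]; intros t _; f_equal; unfold Cexp; simpl.
    rewrite cos_2PI, sin_2PI, cos_0, sin_0; reflexivity. }
  rewrite E in G.
  unfold Cmean; f_equal.
  rewrite (Cint_ext (fun t => F (circle r1 t)) (fun t => F (Cexp (ln r1, t))))
    by (lra || (intros; now rewrite circle_Cexp_ln)).
  rewrite (Cint_ext (fun t => F (circle r2 t)) (fun t => F (Cexp (ln r2, t))))
    by (lra || (intros; rewrite circle_Cexp_ln; [reflexivity | lra])).
  set (I1 := Cint (fun t => F (Cexp (ln r1, t))) 0 (2 * PI)) in *.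
  set (I2 := Cint (fun t => F (Cexp (ln r2, t))) 0 (2 * PI)) in *.
  set (K := Cint (fun x => F (Cexp (x, 0))) (ln r1) (ln r2)) in *.
  assert (Hi : (Ci * I1)%C = (Ci * I2)%C).
  { transitivity (Ci * I1 + (K + Ci * I2 - K - Ci * I1))%C; [rewrite G; ring | ring]. }
  assert (HCi : (Ci * Ci)%C = (- RtoC 1)%C)
    by (unfold Ci, Cmult, Copp, RtoC; simpl; f_equal; ring).
  transitivity (- (Ci * Ci) * I1)%C; [rewrite HCi; ring|].
  replace (- (Ci * Ci) * I1)%C with (- Ci * (Ci * I1))%C by ring.
  rewrite Hi; replace (- Ci * (Ci * I2))%C with (- (Ci * Ci) * I2)%C by ring; rewrite HCi; ring.
Qed.

Lemma Cmean_le F r M : 0 < r -> (forall w, Cmod w = r -> differentiable_at F w) ->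
  (forall w, Cmod w = r -> Cmod (F w) <= M) -> Cmod (Cmean F r) <= M.
Proof.
  intros Hr HF HM; pose proof PI_RGT_0.
  unfold Cmean; rewrite Cmod_div, Cmod_R, Rabs_pos_eq by (apply PI2_neq_0 || lra).
  apply Rle_div_l; [lra|].
  replace (2 * PI) with (2 * PI - 0) at 2 by ring.
  apply Cint_le; [now apply circle_ok|].
  intros t _; apply HM; now apply Cmod_circle.
Qed.

Lemma Cmean_minus F G r : 0 < r -> (forall w, Cmod w = r -> differentiable_at F w) ->
  (forall w, Cmod w = r -> differentiable_at G w) ->
  Cmean (fun w => F w - G w)%C r = (Cmean F r - Cmean G r)%C.
Proof.
  intros Hr HF HG; unfold Cmean; rewrite Cint_minus by now apply circle_ok.
  field; apply PI2_neq_0.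
Qed.

Lemma RInt_antiderivative (F f : R -> R) a b :
  (forall t, is_derive F t (f t)) -> (forall t, continuous f t) -> @eq R (RInt f a b) (F b - F a).
Proof.
  intros HF Hf; apply is_RInt_unique.
  apply (is_RInt_derive (V := R_CompleteNormedModule)); auto.
Qed.

Lemma RInt_cos_period : @eq R (RInt cos 0 (2 * PI)) 0.
Proof.
  transitivity (sin (2 * PI) - sin 0); [|rewrite sin_2PI, sin_0; ring].
  apply (RInt_antiderivative sin).
  - intros t; auto_derive; [trivial | ring].
  - intros t; apply continuity_pt_filterlim, continuity_cos.
Qed.

Lemma Cmean_polar_part (al be : C) r : 0 < r -> Cmean (fun w => al / w + be)%C r = be.
Proof.
  intros Hr; pose proof PI_RGT_0; unfold Cmean.
  assert (Hc : ccont_on (fun t => (cos t, Ropp (sin t)) : C) 0 (2 * PI)).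
  { split; [lra|]; intros t _; apply ccont_components; simpl.
    split; apply (ex_derive_continuous (K := R_AbsRing) (V := R_NormedModule)); auto_derive; trivial. }
  rewrite (Cint_ext _ (fun t => (al * RtoC (/ r)) * (cos t, Ropp (sin t)) + be)%C) by
    (lra || (intros t _; unfold Cdiv; rewrite circle_inv by exact Hr; ring)).
  assert (H0 : 0 <= 2 * PI) by lra.
  rewrite Cint_plus, Cint_Cmult, Cint_const;
    [| exact Hc | apply ccont_on_mult; [now apply ccont_on_const | exact Hc] | now apply ccont_on_const].
  assert (E : Cint (fun t => (cos t, Ropp (sin t)) : C) 0 (2 * PI) = RtoC 0).
  { unfold Cint; simpl.
    change (RInt (fun t => cos t) 0 (2 * PI)) with (RInt cos 0 (2 * PI)); rewrite RInt_cos_period.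
    unfold RtoC; f_equal.
    cut (@eq R (RInt (fun t => - sin t) 0 (2 * PI)) (cos (2 * PI) - cos 0)).
    { rewrite cos_2PI, cos_0, Rminus_diag; exact (fun H => H). }
    apply (RInt_antiderivative cos).
    - intros t; auto_derive; [trivial | ring].
    - intros t; apply (ex_derive_continuous (K := R_AbsRing) (V := R_NormedModule)).
      auto_derive; trivial. }
  rewrite E, Rminus_0_r; field; apply PI2_neq_0.
Qed.

Lemma differentiable_polar al be w : w <> RtoC 0 -> differentiable_at (fun w => al / w + be)%C w.
Proof.
  intros Hw; eexists; apply cdiff_plus; [|apply cdiff_const].
  apply cdiff_div; [exact Hw | apply cdiff_const | apply cdiff_id].
Qed.

Lemma Cmean_limit F R0 al be r :
  (forall w, 0 < Cmod w < R0 -> differentiable_at F w) ->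
  (forall eps, 0 < eps -> exists del, 0 < del /\
    forall w, 0 < Cmod w < del -> Cmod (F w - (al / w + be)) <= eps) ->
  0 < r < R0 -> Cmean F r = be.
Proof.
  intros HF Hlim Hr.
  cut (Cmean F r - be = RtoC 0)%C.
  { intros E; replace (Cmean F r) with (Cmean F r - be + be)%C by ring; rewrite E; ring. }
  apply (norm_le_eps (V := C_NormedModule) _ 1); intros eps Heps; rewrite Rmult_1_r.
  change (Cmod (Cmean F r - be) <= eps).
  destruct (Hlim eps Heps) as [del [Hdel Hd]].
  set (r' := Rmin (r / 2) (del / 2)).
  assert (0 < r') by (apply Rmin_pos; lra).
  assert (r' <= r / 2) by apply Rmin_l; assert (r' <= del / 2) by apply Rmin_r.
  rewrite <- (Cmean_constant_lt F R0 r' r) by (assumption || lra).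
  rewrite <- (Cmean_polar_part al be r') at 1 by assumption.
  assert (K1 : forall w, Cmod w = r' -> differentiable_at F w) by (intros w Hw; apply HF; lra).
  assert (K2 : forall w, Cmod w = r' -> differentiable_at (fun w => al / w + be)%C w)
    by (intros w Hw; apply differentiable_polar, Cmod_gt_0; lra).
  rewrite <- Cmean_minus by assumption.
  apply Cmean_le; [assumption | |].
  - intros w Hw; destruct (K1 w Hw) as [d1 D1], (K2 w Hw) as [d2 D2].
    exists (d1 - d2)%C; exact (cdiff_minus _ _ _ _ _ D1 D2).
  - intros w Hw; apply Hd; lra.
Qed.

(** Passes to real calculus along a line. The factor [c] selects the component: a rotation in the
    mean value inequality, [1] and [- Ci] for real and imaginary part in the fundamental theorem. *)
Lemma is_derive_real_part f (g : R -> C) (t : R) d v (c : C) :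
  cdiff f (g t) d -> (forall s : R, g (t + s)%R = (g t + RtoC s * v)%C) ->
  is_derive (fun s => fst (c * f (g s))%C) t (fst (c * (d * v))%C).
Proof.
  intros Hf Hg.
  apply is_derive_Reals; intros eps Heps.
  set (K := Cmod c * (Cmod v + 1) + 1).
  assert (HK : 0 < K).
  { unfold K; pose proof (Cmod_ge_0 c); pose proof (Cmod_ge_0 v); nra. }
  destruct (Hf (eps / (2 * K))) as [del [Hdel Hd]]; [apply Rdiv_lt_0_compat; lra|].
  pose proof (Cmod_ge_0 v) as Hv; pose proof (Cmod_ge_0 c) as Hc.
  assert (Hd0 : 0 < del / (Cmod v + 1)) by (apply Rdiv_lt_0_compat; lra).
  exists (mkposreal _ Hd0); intros h Hh0 Hh; simpl in Hh.
  assert (Hh1 : 0 < Rabs h) by now apply Rabs_pos_lt.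
  rewrite Hg.
  specialize (Hd (RtoC h * v)%C).
  rewrite Cmod_mult, Cmod_R in Hd.
  assert (Hsm : Rabs h * Cmod v < del).
  { apply Rle_lt_trans with (Rabs h * (Cmod v + 1)); [nra|].
    apply Rlt_div_r in Hh; lra. }
  specialize (Hd Hsm).
  set (A := (f (g t + RtoC h * v))%C) in *.
  replace ((fst (c * A)%C - fst (c * f (g t))%C) / h - fst (c * (d * v))%C)
    with (fst (c * (A - (f (g t) + d * (RtoC h * v))))%C / h).
  2:{ destruct c, A, (f (g t)), d, v; simpl; field; exact Hh0. }
  unfold Rdiv; rewrite Rabs_mult, Rabs_inv; apply Rlt_div_l; [exact Hh1|].
  apply Rle_lt_trans with (Cmod (c * (A - (f (g t) + d * (RtoC h * v))))%C);
    [exact (re_le_Cmod (c * (A - (f (g t) + d * (RtoC h * v))))%C)|].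
  rewrite Cmod_mult.
  apply Rle_lt_trans with (Cmod c * (eps / (2 * K) * (Rabs h * Cmod v)));
    [apply Rmult_le_compat_l; assumption|].
  apply Rle_lt_trans with (eps / (2 * K) * K * Rabs h).
  - replace (Cmod c * (eps / (2 * K) * (Rabs h * Cmod v)))
      with (eps / (2 * K) * (Cmod c * Cmod v) * Rabs h) by ring.
    apply Rmult_le_compat_r; [lra|]; apply Rmult_le_compat_l;
      [apply Rlt_le, Rdiv_lt_0_compat; lra | unfold K; nra].
  - replace (eps / (2 * K) * K) with (eps / 2) by (field; lra).
    apply Rmult_lt_compat_r; lra.
Qed.

(** The real mean value theorem applies to the real part of [c f], where [c] rotates the increment
    [f w - f z] onto its modulus. *)
Lemma C_mean_value f D z w M :
  (forall t, 0 <= t <= 1 -> cdiff f (z + RtoC t * (w - z)) (D (z + RtoC t * (w - z))%C)) ->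
  (forall t, 0 <= t <= 1 -> Cmod (D (z + RtoC t * (w - z))%C) <= M) ->
  Cmod (f w - f z) <= M * Cmod (w - z).
Proof.
  intros HD HM.
  set (g := fun t => (z + RtoC t * (w - z))%C) in *.
  set (I := (f w - f z)%C).
  destruct (unimodular_rotation I) as [c [Hc HcI]].
  assert (Hder : forall t, 0 <= t <= 1 ->
    is_derive (fun s => fst (c * f (g s))%C) t (fst (c * (D (g t) * (w - z)))%C)).
  { intros t Ht; apply is_derive_real_part; [apply HD, Ht|].
    intros s; unfold g; rewrite RtoC_plus; ring. }
  destruct (MVT_gen (fun s => fst (c * f (g s))%C) 0 1 (fun t => fst (c * (D (g t) * (w - z)))%C))
    as [t [Ht Heq]].
  - rewrite Rmin_left, Rmax_right by lra; intros t Ht; apply Hder; lra.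
  - rewrite Rmin_left, Rmax_right by lra; intros t Ht.
    apply continuity_pt_filterlim.
    apply (ex_derive_continuous (K := R_AbsRing) (V := R_NormedModule)).
    eexists; now apply Hder.
  - rewrite Rmin_left, Rmax_right in Ht by lra.
    replace (g 1) with w in Heq by (unfold g; ring).
    replace (g 0) with z in Heq by (unfold g; ring).
    replace (fst (c * f w)%C - fst (c * f z)%C) with (fst (c * I)%C) in Heq
      by (unfold I; destruct c, (f w), (f z); simpl; ring).
    rewrite HcI in Heq; simpl in Heq; rewrite Heq, Rminus_0_r, Rmult_1_r.
    apply Rle_trans with (1 := Rle_abs _).
    apply Rle_trans with (Cmod (c * (D (g t) * (w - z)))%C);
      [exact (re_le_Cmod (c * (D (g t) * (w - z)))%C)|].
    rewrite !Cmod_mult, Hc, Rmult_1_l; apply Rmult_le_compat_r; [apply Cmod_ge_0 | apply HM, Ht].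
Qed.

(** * Cauchy estimates and the second Schwarz coefficient *)

Lemma cdiff_shift f x z d : cdiff f (x + z)%C d -> cdiff (fun w => f (x + w))%C z d.
Proof.
  intros H; assert (K : cdiff (fun w => x + w)%C z (RtoC 1)).
  { apply (cdiff_eq _ _ _ _ (cdiff_plus _ _ _ _ _ (cdiff_const x z) (cdiff_id z))); ring. }
  apply (cdiff_eq _ _ _ _ (cdiff_comp _ _ _ _ _ K H)); ring.
Qed.

(** At [w = 0] the quotient is [f x / w + d + o(1)], so differentiability alone identifies its
    constant coefficient. *)
Lemma cauchy_coefficient f x d rho r :
  (forall w, Cmod (w - x) < rho -> differentiable_at f w) -> cdiff f x d -> 0 < r < rho ->
  Cmean (fun w => f (x + w) / w)%C r = d.
Proof.
  intros Hf Hd Hr; apply Cmean_limit with rho (f x); [| |exact Hr].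
  - intros w Hw; destruct (Hf (x + w)%C) as [e He].
    { replace (x + w - x)%C with w by ring; apply Hw. }
    eexists; apply cdiff_div; [apply Cmod_gt_0, Hw | now apply cdiff_shift, He | apply cdiff_id].
  - intros eps Heps; destruct (Hd eps Heps) as [del [Hdel H]].
    exists del; split; [exact Hdel|]; intros w Hw; specialize (H w (proj2 Hw)).
    assert (Hw0 : w <> RtoC 0) by apply Cmod_gt_0, Hw.
    replace (f (x + w) / w - (f x / w + d))%C with ((f (x + w) - (f x + d * w)) / w)%C
      by (field; exact Hw0).
    rewrite Cmod_div by exact Hw0; apply Rle_div_l; [apply Hw | exact H].
Qed.

Lemma cauchy_estimate f x d rho r M :
  (forall w, Cmod (w - x) < rho -> differentiable_at f w) -> cdiff f x d -> 0 < r < rho ->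
  (forall w, Cmod (w - x) = r -> Cmod (f w) <= M) -> Cmod d <= M / r.
Proof.
  intros Hf Hd Hr HM.
  rewrite <- (cauchy_coefficient f x d rho r Hf Hd Hr).
  apply Cmean_le; [apply Hr | |].
  - intros w Hw; destruct (Hf (x + w)%C) as [e He].
    { replace (x + w - x)%C with w by ring; lra. }
    eexists; apply cdiff_div; [apply Cmod_gt_0; lra | now apply cdiff_shift, He | apply cdiff_id].
  - intros w Hw; rewrite Cmod_div, Hw by (apply Cmod_gt_0; lra).
    apply Rmult_le_compat_r; [apply Rlt_le, Rinv_0_lt_compat; lra|].
    apply HM; replace (x + w - x)%C with w by ring; exact Hw.
Qed.

Lemma Cmod_segment (w : C) t : 0 <= t <= 1 -> Cmod (RtoC t * w) <= Cmod w.
Proof.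
  intros Ht; rewrite Cmod_mult, Cmod_R, Rabs_pos_eq by lra; pose proof (Cmod_ge_0 w); nra.
Qed.

(** The second derivative is bypassed. Cauchy's estimate bounds [D] on the half disk ([B1]), so
    [f (w + v) - f v] is of size [|w|]; Cauchy's estimate for this function of [v] makes [D]
    Lipschitz at the origin ([B2]), and the mean value inequality integrates that once. *)
Lemma cauchy_remainder f D rho M z : 0 < rho ->
  (forall w, Cmod w < rho -> cdiff f w (D w)) -> (forall w, Cmod w < rho -> Cmod (f w) <= M) ->
  Cmod z <= rho / 4 ->
  Cmod (f z - (f (RtoC 0) + D (RtoC 0) * z)) <= 16 * M / rho ^ 2 * Cmod z ^ 2.
Proof.
  intros Hrho Hf HM Hz.
  assert (B1 : forall w, Cmod w <= rho / 2 -> Cmod (D w) <= 4 * M / rho).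
  { intros w Hw.
    replace (4 * M / rho) with (M / (rho / 4)) by (field; lra).
    assert (Hin : forall v, Cmod (v - w) < rho / 2 -> Cmod v < rho).
    { intros v Hv; pose proof (Cmod_triangle (v - w) w) as K.
      replace (v - w + w)%C with v in K by ring; lra. }
    apply (cauchy_estimate f w (D w) (rho / 2) (rho / 4) M).
    - intros v Hv; exists (D v); now apply Hf, Hin.
    - apply Hf; lra.
    - lra.
    - intros v Hv; apply HM, Hin; lra. }
  assert (B2 : forall w, Cmod w <= rho / 4 ->
    Cmod (D w - D (RtoC 0)) <= 16 * M / rho ^ 2 * Cmod w).
  { intros w Hw.
    replace (16 * M / rho ^ 2 * Cmod w) with (4 * M / rho * Cmod w / (rho / 4)) by (field; lra).
    assert (Hin : forall v t, 0 <= t <= 1 -> Cmod (v + RtoC t * w) <= Cmod v + Cmod w).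
    { intros v t Ht; pose proof (Cmod_triangle v (RtoC t * w)); pose proof (Cmod_segment w t Ht).
      lra. }
    assert (Hdv : forall v, Cmod (v - RtoC 0) < rho / 2 ->
      cdiff (fun v => f (w + v) - f v)%C v (D (w + v) - D v)%C).
    { intros v Hv; replace (v - RtoC 0)%C with v in Hv by ring.
      apply cdiff_minus; [apply cdiff_shift|]; apply Hf; [|lra].
      pose proof (Cmod_triangle w v); lra. }
    apply (cauchy_estimate (fun v => f (w + v) - f v)%C (RtoC 0) _ (rho / 2) (rho / 4)).
    - intros v Hv; eexists; now apply Hdv.
    - specialize (Hdv (RtoC 0)); replace (w + RtoC 0)%C with w in Hdv by ring; apply Hdv.
      replace (RtoC 0 - RtoC 0)%C with (RtoC 0) by ring; rewrite Cmod_0; lra.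
    - lra.
    - intros v Hv; replace (v - RtoC 0)%C with v in Hv by ring.
      replace (Cmod w) with (Cmod (w + v - v)) by (f_equal; ring).
      apply C_mean_value with D; replace (w + v - v)%C with w by ring; intros t Ht;
        specialize (Hin v t Ht); [apply Hf | apply B1]; lra. }
  replace (f z - (f (RtoC 0) + D (RtoC 0) * z))%C with
    ((f z + - D (RtoC 0) * z) - (f (RtoC 0) + - D (RtoC 0) * RtoC 0))%C by ring.
  replace (16 * M / rho ^ 2 * Cmod z ^ 2) with (16 * M / rho ^ 2 * Cmod z * Cmod (z - RtoC 0))
    by (replace (z - RtoC 0)%C with z by ring; ring).
  assert (Hseg : forall t, (RtoC 0 + RtoC t * (z - RtoC 0) = RtoC t * z)%C) by (intros; ring).
  assert (HM0 : 0 <= M).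
  { apply Rle_trans with (Cmod (f (RtoC 0))); [apply Cmod_ge_0 | apply HM; rewrite Cmod_0; lra]. }
  apply (C_mean_value (fun w => f w + - D (RtoC 0) * w)%C (fun w => D w - D (RtoC 0))%C);
    intros t Ht; rewrite Hseg; pose proof (Cmod_segment z t Ht) as Hs.
  - apply (cdiff_eq _ _ (D (RtoC t * z) + - D (RtoC 0) * RtoC 1)%C); [|ring].
    apply cdiff_plus; [apply Hf; lra | apply cdiff_scal, cdiff_id].
  - apply Rle_trans with (1 := B2 (RtoC t * z)%C ltac:(lra)).
    apply Rmult_le_compat_l; [|exact Hs].
    apply Rmult_le_pos; [lra | apply Rlt_le, Rinv_0_lt_compat, pow_lt, Hrho].
Qed.

Lemma taylor_second f D e rho : 0 < rho ->
  (forall w, Cmod w < rho -> cdiff f w (D w)) -> cdiff D (RtoC 0) e ->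
  forall eps, 0 < eps -> exists del, 0 < del /\ forall w, Cmod w < del ->
    Cmod (f w - (f (RtoC 0) + D (RtoC 0) * w + e / RtoC 2 * (w * w))) <= eps * Cmod w ^ 2.
Proof.
  intros Hrho Hf HD eps Heps; destruct (HD eps Heps) as [del [Hdel H]].
  exists (Rmin del rho); split; [now apply Rmin_pos|]; intros w Hw.
  pose proof (Rmin_l del rho); pose proof (Rmin_r del rho).
  assert (H2 : RtoC 2 <> RtoC 0) by (intros E; apply RtoC_inj in E; lra).
  (* The derivative of [R] at [v] is the first-order remainder of [D], at most [eps |v|]; the mean
     value inequality supplies the second factor [|w|]. *)
  pose (R := fun w => (f w + (- D (RtoC 0) * w + (- e / RtoC 2) * (w * w)))%C).
  replace (f w - (f (RtoC 0) + D (RtoC 0) * w + e / RtoC 2 * (w * w)))%C with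
    (R w - R (RtoC 0))%C by (unfold R; field; exact H2).
  replace (eps * Cmod w ^ 2) with (eps * Cmod w * Cmod (w - RtoC 0))
    by (replace (w - RtoC 0)%C with w by ring; ring).
  assert (Hseg : forall t, (RtoC 0 + RtoC t * (w - RtoC 0) = RtoC t * w)%C) by (intros; ring).
  apply (C_mean_value R (fun w => D w - (D (RtoC 0) + e * w))%C);
    intros t Ht; rewrite Hseg; pose proof (Cmod_segment w t Ht) as Hs;
    set (v := (RtoC t * w)%C) in *.
  - apply (cdiff_eq _ _ (D v + (- D (RtoC 0) * RtoC 1 + (- e / RtoC 2) * (RtoC 1 * v + v * RtoC 1)))%C).
    + apply cdiff_plus; [apply Hf; lra|]; apply cdiff_plus; apply cdiff_scal;
        [|apply cdiff_mult]; apply cdiff_id.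
    + field; exact H2.
  - specialize (H v ltac:(lra)); replace (RtoC 0 + v)%C with v in H by ring.
    apply Rle_trans with (1 := H); apply Rmult_le_compat_l; lra.
Qed.

Lemma Cmod_sqr_1_plus (c : C) r t :
  Cmod (RtoC 1 + c * circle r t) ^ 2 =
    1 + (Cmod c * r) ^ 2 + (2 * fst c * r) * cos t + (- (2 * snd c * r)) * sin t.
Proof.
  rewrite Rpow_mult_distr; unfold Cmod; rewrite !pow2_sqrt; try (destruct c; simpl; nra).
  - destruct c as [a b]; unfold circle; simpl.
    pose proof (sin2_cos2 t) as H; unfold Rsqr in H.
    transitivity (1 + (a * a + b * b) * r ^ 2 * (sin t * sin t + cos t * cos t)
      + 2 * a * r * cos t - 2 * b * r * sin t); [ring | rewrite H; ring].
  - pose proof (pow2_ge_0 (fst (RtoC 1 + c * circle r t)%C)).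
    pose proof (pow2_ge_0 (snd (RtoC 1 + c * circle r t)%C)); lra.
Qed.

(** On the circle the weight is [1 + (|c| r)^2] plus multiples of [cos t] and [sin t], which
    integrate to zero over a period; [G] is an antiderivative of the bound [g]. *)
Lemma Cmean_weighted_bound F (c : C) r k : 0 < r -> 0 <= k ->
  (forall w, Cmod w = r -> differentiable_at F w) ->
  (forall w, Cmod w = r -> Cmod (F w) <= k * Cmod (RtoC 1 + c * w) ^ 2) ->
  Cmod (Cmean F r) <= k * (1 + (Cmod c * r) ^ 2).
Proof.
  intros Hr Hk HF HM; pose proof PI_RGT_0.
  unfold Cmean; rewrite Cmod_div, Cmod_R, Rabs_pos_eq by (apply PI2_neq_0 || lra).
  apply Rle_div_l; [lra|].
  set (A := 1 + (Cmod c * r) ^ 2).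
  pose (g := fun t => k * (A + (2 * fst c * r) * cos t + (- (2 * snd c * r)) * sin t)).
  pose (G := fun t => k * (A * t + (2 * fst c * r) * sin t + (2 * snd c * r) * cos t)).
  assert (Hg : forall t, continuous g t).
  { intros t; apply (ex_derive_continuous (K := R_AbsRing) (V := R_NormedModule)).
    unfold g; auto_derive; trivial. }
  replace (k * A * (2 * PI)) with (RInt g 0 (2 * PI)).
  - apply Cint_le_RInt; [now apply circle_ok | |].
    + apply (ex_RInt_continuous (V := R_CompleteNormedModule)); auto.
    + intros t _; unfold g; unfold A; rewrite <- Cmod_sqr_1_plus.
      apply HM; now apply Cmod_circle.
  - assert (E : @eq R (RInt g 0 (2 * PI)) (G (2 * PI) - G 0)).
    { apply RInt_antiderivative; [|exact Hg].
      intros t; unfold G, g; auto_derive; [trivial | ring]. }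
    etransitivity; [exact E|].
    cut (@eq R (G (2 * PI) - G 0) (k * A * (2 * PI))); [exact (fun H => H)|].
    unfold G; rewrite cos_2PI, sin_2PI, cos_0, sin_0; ring.
Qed.

(* The test weight (1 + c w)^2 / w^2 with c = conj(w1) eta, |eta| = 1, turns the mean of
   |f| <= 1 against it into 2 |w1|^2 + |w2| <= (1 + |w1|^2 r^2) / r^2 . *)
Lemma schwarz_second f D e :
  (forall w, Cmod w < 1 -> cdiff f w (D w)) -> cdiff D (RtoC 0) e -> f (RtoC 0) = RtoC 0 ->
  (forall w, Cmod w < 1 -> Cmod (f w) <= 1) ->
  Cmod (e / RtoC 2) <= 1 - Cmod (D (RtoC 0)) ^ 2.
Proof.
  intros Hf HD H0 H1.
  assert (H2 : RtoC 2 <> RtoC 0) by (intros E; apply RtoC_inj in E; lra).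
  set (w1 := D (RtoC 0)); set (w2 := (e / RtoC 2)%C).
  destruct (unimodular_rotation w2) as [eta' [Heta Hw2]].
  (* The phase of [w2]: then [w2 = m eta] and [2 c w1 = 2 s^2 eta] point in the same direction, and
     their moduli add up in [Hval]. *)
  pose (eta := Cconj eta').
  assert (Heta' : (eta' * eta)%C = RtoC 1)
    by (unfold eta; rewrite <- Cmod2_conj, Heta; f_equal; ring).
  set (c := (Cconj w1 * eta)%C).
  assert (Hc : Cmod c = Cmod w1)
    by (unfold c, eta; rewrite Cmod_mult, !Cmod_conj, Heta; ring).
  set (s := Cmod w1) in *; set (m := Cmod w2) in *.
  pose (F := fun w => (f w * ((RtoC 1 + c * w) * (RtoC 1 + c * w)) / (w * w))%C).
  assert (HFd : forall w, 0 < Cmod w < 1 -> differentiable_at F w).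
  { intros w Hw; assert (Hw0 : w <> RtoC 0) by apply Cmod_gt_0, Hw.
    assert (K : exists d, cdiff (fun w => RtoC 1 + c * w)%C w d)
      by (eexists; apply cdiff_plus; [apply cdiff_const | apply cdiff_scal, cdiff_id]).
    destruct K as [d K].
    eexists; unfold F; apply (cdiff_div (fun w => f w * ((RtoC 1 + c * w) * (RtoC 1 + c * w)))%C
      (fun w => w * w)%C).
    - now apply Cmult_neq_0.
    - apply cdiff_mult; [now apply Hf|]; apply cdiff_mult; exact K.
    - apply cdiff_mult; apply cdiff_id. }
  assert (Hmean : forall r, 0 < r < 1 -> Cmean F r = (w2 + RtoC 2 * c * w1)%C).
  { intros r Hr; apply Cmean_limit with 1 w1; [exact HFd | | exact Hr].
    intros eps Heps.
    (* Without its pole and constant term, [F] consists of the Taylor remainder [E] times the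
       weight, controlled by [L], and of [w] times a polynomial, controlled by [K]. *)
    set (K := Cmod (RtoC 2 * c * w2 + c * c * w1) + Cmod (c * c * w2) + 1).
    assert (HK : 1 <= K).
    { unfold K; pose proof (Cmod_ge_0 (RtoC 2 * c * w2 + c * c * w1)).
      pose proof (Cmod_ge_0 (c * c * w2)); lra. }
    pose proof (Cmod_ge_0 c) as Hc0.
    set (L := (1 + Cmod c) ^ 2).
    assert (HL : 1 <= L) by (unfold L; nra).
    destruct (taylor_second f D e 1 Rlt_0_1 Hf HD (eps / (2 * L))) as [del [Hdel Ht]].
    { apply Rdiv_lt_0_compat; lra. }
    assert (He2 : 0 < eps / (2 * K)) by (apply Rdiv_lt_0_compat; lra).
    exists (Rmin del (Rmin 1 (eps / (2 * K)))); split.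
    { repeat apply Rmin_pos; lra. }
    intros w [Hw Hwd].
    pose proof (Rmin_l del (Rmin 1 (eps / (2 * K)))).
    pose proof (Rmin_r del (Rmin 1 (eps / (2 * K)))).
    pose proof (Rmin_l 1 (eps / (2 * K))); pose proof (Rmin_r 1 (eps / (2 * K))).
    assert (Hw0 : w <> RtoC 0) by now apply Cmod_gt_0.
    specialize (Ht w ltac:(lra)); rewrite H0 in Ht; fold w1 w2 in Ht.
    set (E := (f w - (RtoC 0 + w1 * w + w2 * (w * w)))%C) in *.
    replace (F w - (w1 / w + (w2 + RtoC 2 * c * w1)))%C with
      (E * ((RtoC 1 + c * w) * (RtoC 1 + c * w)) / (w * w)
       + w * ((RtoC 2 * c * w2 + c * c * w1) + w * (c * c * w2)))%C
      by (unfold F, E; field; exact Hw0).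
    assert (B1 : Cmod (E * ((RtoC 1 + c * w) * (RtoC 1 + c * w)) / (w * w)) <= eps / 2).
    { rewrite Cmod_div, !Cmod_mult by now apply Cmult_neq_0.
      apply Rle_div_l; [nra|].
      assert (B : Cmod (RtoC 1 + c * w) <= 1 + Cmod c).
      { apply Rle_trans with (1 := Cmod_triangle _ _); rewrite Cmod_1, Cmod_mult; nra. }
      pose proof (Cmod_ge_0 (RtoC 1 + c * w)).
      apply Rle_trans with (eps / (2 * L) * Cmod w ^ 2 * L).
      - apply Rmult_le_compat; [apply Cmod_ge_0 | nra | exact Ht | unfold L; nra].
      - right; field; lra. }
    assert (B2 : Cmod (w * ((RtoC 2 * c * w2 + c * c * w1) + w * (c * c * w2))) <= eps / 2).
    { rewrite Cmod_mult.
      apply Rle_trans with (eps / (2 * K) * K); [|right; field; lra].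
      apply Rmult_le_compat; [apply Cmod_ge_0 | apply Cmod_ge_0 | lra |].
      apply Rle_trans with (1 := Cmod_triangle _ _).
      rewrite (Cmod_mult w); unfold K; pose proof (Cmod_ge_0 (c * c * w2)); nra. }
    apply Rle_trans with (1 := Cmod_triangle _ _); lra. }
  assert (Hval : Cmod (w2 + RtoC 2 * c * w1) = m + 2 * s ^ 2).
  { assert (Ew2 : w2 = (RtoC m * eta)%C)
      by (rewrite <- Hw2; transitivity (eta' * eta * w2)%C; [rewrite Heta'; ring | ring]).
    assert (Ecw : (c * w1)%C = (RtoC (s ^ 2) * eta)%C)
      by (unfold c, s; rewrite Cmod2_conj; ring).
    replace (w2 + RtoC 2 * c * w1)%C with (RtoC (m + 2 * s ^ 2) * eta)%C
      by (rewrite Ew2 at 1; rewrite RtoC_plus, RtoC_mult;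
          transitivity (RtoC m * eta + RtoC 2 * (c * w1))%C; [rewrite Ecw|]; ring).
    unfold eta; rewrite Cmod_mult, Cmod_conj, Heta, Cmod_R, Rabs_pos_eq; [ring|].
    pose proof (Cmod_ge_0 w2); fold m in H; nra. }
  assert (Hineq : forall r, 0 < r < 1 -> m + 2 * s ^ 2 <= / r ^ 2 * (1 + (s * r) ^ 2)).
  { intros r Hr; rewrite <- Hval, <- (Hmean r Hr), <- Hc.
    assert (Hr2 : 0 < r ^ 2) by (apply pow_lt; lra).
    apply Cmean_weighted_bound; [lra | apply Rlt_le, Rinv_0_lt_compat, Hr2 | |].
    - intros w Hw; apply HFd; lra.
    - intros w Hw; unfold F.
      rewrite Cmod_div, !Cmod_mult, Hw by (apply Cmult_neq_0; apply Cmod_gt_0; lra).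
      specialize (H1 w ltac:(lra)); pose proof (pow2_ge_0 (Cmod (RtoC 1 + c * w))).
      replace (Cmod (f w) * (Cmod (RtoC 1 + c * w) * Cmod (RtoC 1 + c * w)) / (r * r))
        with (/ r ^ 2 * (Cmod (f w) * Cmod (RtoC 1 + c * w) ^ 2)) by (field; lra).
      apply Rmult_le_compat_l; [apply Rlt_le, Rinv_0_lt_compat, Hr2|]; nra. }
  assert (Hs : 0 <= s) by apply Cmod_ge_0.
  apply le_epsilon; intros eps Heps.
  (* The limit [r -> 1], parametrized so that [1 / r^2 = 1 + eps]; the inequality then reads
     [m + 2 s^2 <= 1 + eps + s^2]. *)
  pose (r := / sqrt (1 + eps)).
  assert (Hsq : 1 < sqrt (1 + eps)) by (rewrite <- sqrt_1 at 1; apply sqrt_lt_1; lra).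
  assert (Hr : 0 < r < 1).
  { unfold r; split; [apply Rinv_0_lt_compat; lra|].
    apply Rmult_lt_reg_l with (sqrt (1 + eps)); [lra|]; rewrite Rinv_r; lra. }
  assert (Hr2 : / r ^ 2 = 1 + eps).
  { unfold r; rewrite pow_inv, Rinv_inv, pow2_sqrt; lra. }
  specialize (Hineq r Hr).
  replace (/ r ^ 2 * (1 + (s * r) ^ 2)) with (/ r ^ 2 + s ^ 2) in Hineq by (field; lra).
  rewrite Hr2 in Hineq; lra.
Qed.

(** * Fréchet derivatives of holomorphic maps are holomorphic *)

Definition vlim {V : CNormedModule} (u : nat -> V) (l : V) : Prop :=
  forall eps, 0 < eps -> exists N, forall n, (N <= n)%nat -> norm (minus (u n) l) <= eps.

(** Completeness as a property of a plain normed module. It passes from [V] to [L(U, V)], hence to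
    every [MultLin U V k], without giving these spaces a [CompleteNormedModule] structure. *)
Definition seq_complete (V : CNormedModule) : Prop :=
  forall u : nat -> V,
    (forall eps, 0 < eps -> exists N, forall n m, (N <= n)%nat -> (N <= m)%nat ->
      norm (minus (u n) (u m)) <= eps) ->
    exists l, vlim u l.

Lemma Banach_seq_complete (V : CBanach) : seq_complete V.
Proof.
  intros u Hu.
  pose (F := filtermap u Hierarchy.eventually).
  assert (HF : ProperFilter F) by (apply filtermap_proper_filter; apply eventually_filter).
  assert (HC : cauchy F).
  { intros eps; destruct (Hu (eps / 2)) as [N HN]; [apply is_pos_div_2|].
    exists (u N), N; intros n Hn; apply (norm_compat1 (V := V)).
    apply Rle_lt_trans with (1 := HN n N Hn (le_n N)); destruct eps; simpl; lra. }
  exists (lim F); intros eps Heps.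
  pose proof (norm_factor_gt_0 (V := V)) as Hnf.
  assert (He : 0 < eps / norm_factor (V := V)) by (apply Rdiv_lt_0_compat; lra).
  destruct (complete_cauchy F HF HC (mkposreal _ He)) as [N HN].
  exists N; intros n Hn; specialize (HN n Hn).
  apply (norm_compat2 (V := V)) in HN; simpl in HN.
  replace (norm_factor (V := V) * (eps / norm_factor (V := V))) with eps in HN by (field; lra).
  now apply Rlt_le.
Qed.

Lemma vlim_norm_le {V : CNormedModule} (u : nat -> V) l y M N :
  vlim u l -> (forall n, (N <= n)%nat -> norm (minus (u n) y) <= M) -> norm (minus l y) <= M.
Proof.
  intros Hl HM; apply le_epsilon; intros eps Heps; destruct (Hl eps Heps) as [N' HN'].
  specialize (HM (max N N') (Nat.le_max_l _ _)); specialize (HN' (max N N') (Nat.le_max_r _ _)).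
  apply Rle_trans with (1 := norm_minus_triangle l (u (max N N')) y).
  rewrite (norm_minus_sym l); lra.
Qed.

Lemma vlim_unique {V : CNormedModule} (u : nat -> V) l m : vlim u l -> vlim u m -> l = m.
Proof.
  intros Hl Hm; cut (minus l m = zero).
  { intros E; vreplace V : l with (plus (minus l m) m); rewrite E; apply plus_zero_l. }
  apply (norm_le_eps _ 1); intros eps Heps; rewrite Rmult_1_r.
  destruct (Hm eps Heps) as [N HN]; exact (vlim_norm_le u l m eps N Hl HN).
Qed.

Lemma vlim_lincomb {V : CNormedModule} (u w : nat -> V) l m (c : C) :
  vlim u l -> vlim w m ->
  vlim (fun n => plus (scal (c : C_AbsRing) (u n)) (w n)) (plus (scal (c : C_AbsRing) l) m).
Proof.
  intros Hl Hm eps Heps.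
  pose proof (Cmod_ge_0 c).
  destruct (Hl (eps / (2 * (Cmod c + 1)))) as [N HN]; [apply Rdiv_lt_0_compat; lra|].
  destruct (Hm (eps / 2)) as [N' HN']; [lra|].
  exists (max N N'); intros n Hn.
  specialize (HN n ltac:(lia)); specialize (HN' n ltac:(lia)).
  vreplace V : (minus (plus (scal c (u n)) (w n)) (plus (scal c l) m))
    with (plus (scal c (minus (u n) l)) (minus (w n) m)).
  apply Rle_trans with (1 := norm_triangle _ _); rewrite norm_scal_C.
  apply Rle_trans with ((Cmod c + 1) * (eps / (2 * (Cmod c + 1))) + eps / 2).
  - apply Rplus_le_compat; [|exact HN'].
    apply Rmult_le_compat; [assumption | apply norm_ge_0 | lra | exact HN].
  - right; field; lra.
Qed.

Lemma vlim_Lin {U V : CNormedModule} (A : Lin U V) u l : vlim u l -> vlim (fun n => A (u n)) (A l).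
Proof.
  intros Hl eps Heps; pose proof (norm_ge_0 A) as HA.
  destruct (Hl (eps / (norm A + 1))) as [N HN]; [apply Rdiv_lt_0_compat; lra|].
  exists N; intros n Hn; specialize (HN n Hn).
  rewrite <- Lin_minusE; apply Rle_trans with (1 := Lin_norm_apply A _).
  apply Rle_trans with ((norm A + 1) * (eps / (norm A + 1))); [|right; field; lra].
  apply Rmult_le_compat; [exact HA | apply norm_ge_0 | lra | exact HN].
Qed.

Lemma Lin_eval_linear (U V : CNormedModule) (v : U) :
  is_linear (U := Lin_NormedModule U V) (V := V) (fun A : Lin U V => A v).
Proof.
  split; [reflexivity | reflexivity |].
  exists (norm v + 1); pose proof (norm_ge_0 v); split; [lra|]; intros A.
  pose proof (norm_ge_0 A).
  apply Rle_trans with (1 := Lin_norm_apply A v); rewrite Rmult_comm.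
  apply Rmult_le_compat_r; [assumption | lra].
Qed.

Definition Lin_eval {U V : CNormedModule} (v : U) : Lin (Lin_NormedModule U V) V :=
  mkLin _ _ _ (Lin_eval_linear U V v).

Lemma Lin_minus_apply {U V : CNormedModule} (A B : Lin_NormedModule U V) (x : U) :
  lin_fun (minus A B) x = minus (A x) (B x).
Proof.
  change (plus (A x) (scal (opp (one : C_AbsRing)) (B x)) = minus (A x) (B x)).
  change (opp (one : C_AbsRing)) with (- RtoC 1)%C; module_eq V.
Qed.

Lemma Lin_minus_norm_apply {U V : CNormedModule} (A B : Lin_NormedModule U V) (x : U) :
  norm (minus (A x) (B x)) <= norm (minus A B) * norm x.
Proof. rewrite <- Lin_minus_apply; apply (Lin_norm_apply (minus A B) x). Qed.

(** The pointwise limit is taken. Letting one index of the Cauchy condition tend to infinity gives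
    [Hbd], which is uniform over directions and yields both the boundedness of the limit and
    convergence in norm. *)
Lemma Lin_seq_complete (U V : CNormedModule) :
  seq_complete V -> seq_complete (Lin_NormedModule U V).
Proof.
  intros HV u Hu.
  assert (Hpt : forall x, exists l, vlim (fun n => u n x) l).
  { intros x; apply HV; intros eps Heps; pose proof (norm_ge_0 x) as Hx.
    destruct (Hu (eps / (norm x + 1))) as [N HN]; [apply Rdiv_lt_0_compat; lra|].
    exists N; intros n m Hn Hm; specialize (HN n m Hn Hm).
    apply Rle_trans with (1 := Lin_minus_norm_apply (u n) (u m) x).
    apply Rle_trans with ((eps / (norm x + 1)) * (norm x + 1)); [|right; field; lra].
    apply Rmult_le_compat; [apply norm_ge_0 | exact Hx | exact HN | lra]. }
  pose (l := fun x => proj1_sig (constructive_indefinite_description _ (Hpt x))).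
  assert (Hl : forall x, vlim (fun n => u n x) (l x))
    by (intros x; exact (proj2_sig (constructive_indefinite_description _ (Hpt x)))).
  assert (Hbd : forall eps, 0 < eps -> exists N, forall n x, (N <= n)%nat ->
    norm (minus (l x) (u n x)) <= eps * norm x).
  { intros eps Heps; destruct (Hu eps Heps) as [N HN]; exists N; intros n x Hn.
    apply (vlim_norm_le (fun m => u m x) (l x) _ _ N (Hl x)); intros m Hm.
    apply Rle_trans with (1 := Lin_minus_norm_apply (u m) (u n) x).
    apply Rmult_le_compat_r; [apply norm_ge_0 | now apply HN]. }
  assert (Hlin : is_linear l).
  { split.
    - intros x y; apply (vlim_unique (fun n => u n (plus x y))); [apply Hl|].
      intros eps Heps.
      destruct (vlim_lincomb _ _ _ _ (RtoC 1) (Hl x) (Hl y) eps Heps) as [N HN].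
      exists N; intros n Hn; specialize (HN n Hn).
      rewrite Lin_plusE, !scal_C_one in *; exact HN.
    - intros k x; apply (vlim_unique (fun n => u n (scal k x))); [apply Hl|].
      intros eps Heps.
      destruct (vlim_lincomb _ _ _ _ k (Hl x) (Hl zero) eps Heps) as [N HN].
      assert (E0 : l zero = zero).
      { apply (vlim_unique (fun n => u n zero)); [apply Hl|].
        intros e He; exists O; intros n _; rewrite Lin_zeroE, norm_minus_self; lra. }
      exists N; intros n Hn; specialize (HN n Hn).
      rewrite E0, Lin_zeroE, !plus_zero_r in HN; rewrite Lin_scalE; exact HN.
    - destruct (Hbd 1 Rlt_0_1) as [N HN].
      pose proof (norm_ge_0 (u N)) as HuN.
      exists (norm (u N) + 1); split; [lra|]; intros x; specialize (HN N x (le_n N)).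
      replace (l x) with (plus (minus (l x) (u N x)) (u N x)) by module_eq V.
      apply Rle_trans with (1 := norm_triangle _ _).
      pose proof (Lin_norm_apply (u N) x); lra. }
  exists (mkLin _ _ l Hlin); intros eps Heps; destruct (Hbd eps Heps) as [N HN].
  exists N; intros n Hn; rewrite norm_minus_sym.
  apply Lin_norm_le_of; [lra|]; intros x; rewrite Lin_minus_apply; exact (HN n x Hn).
Qed.

(** The chain rule along a complex line, which makes the one-variable theory available. *)
Lemma slice_cdiff {U V : CNormedModule} (f : U -> V) (A : Lin U V) (l : Lin V C_NormedModule) x v (z : C) :
  fdiff f (plus x (scal (z : C_AbsRing) v)) A ->
  cdiff (fun w => l (f (plus x (scal (w : C_AbsRing) v)))) z (l (A v)).
Proof.
  intros H.
  assert (Hlin : is_linear (U := C_NormedModule) (fun w : C => scal (w : C_AbsRing) v)).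
  { split.
    - intros a b; change (plus a b) with (a + b)%C; module_eq U.
    - intros k a; change (scal k a) with (k * a)%C; module_eq U.
    - exists (norm v + 1); pose proof (norm_ge_0 v); split; [lra|]; intros w.
      rewrite norm_scal_C; change (norm w) with (Cmod w); pose proof (Cmod_ge_0 w); nra. }
  pose (S := mkLin C_NormedModule U _ Hlin).
  assert (HS : fdiff (U := C_NormedModule) (fun w : C => plus x (scal (w : C_AbsRing) v)) z
    (Lin_plus _ _ (Lin_zero _ _) S))
    by exact (fdiff_plus (U := C_NormedModule) _ _ _ _ _ (fdiff_const x _) (fdiff_lin S z)).
  pose proof (fdiff_comp _ _ _ _ _ (fdiff_comp _ _ _ _ _ HS H) (fdiff_lin l _)) as K.
  apply (proj2 (cdiff_fdiff _ _ _)).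
  replace (Cmul (l (A v))) with (Lin_comp l (Lin_comp A (Lin_plus _ _ (Lin_zero _ _) S))); [exact K|].
  apply Lin_ext; intros h; simpl.
  change (l (A (plus zero (scal (h : C_AbsRing) v))) = (l (A v) * h)%C).
  rewrite plus_zero_l, !Lin_scalE; apply Cmult_comm.
Qed.

Section Cauchy_estimates.

Context {U V : CNormedModule}.
Variables (f : U -> V) (D : U -> Lin U V) (y : U) (r M : R).
Hypothesis Hr : 0 < r.
Hypothesis Hf : forall k, norm k < r -> fdiff f (plus y k) (D (plus y k)).
Hypothesis HM : forall k, norm k < r -> norm (f (plus y k)) <= M.

Lemma slice_in_ball (h : U) (w : C) : h <> zero -> Cmod w < r / norm h -> norm (scal (w : C_AbsRing) h) < r.
Proof.
  intros Hh Hw; apply norm_pos_neq0 in Hh.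
  rewrite norm_scal_C; apply Rlt_div_r in Hw; [exact Hw | exact Hh].
Qed.

Lemma slice_bound (l : Lin V C_NormedModule) : (forall x, Cmod (l x) <= norm x) ->
  forall (h : U) (w : C), h <> zero -> Cmod w < r / norm h ->
  Cmod (l (f (plus y (scal (w : C_AbsRing) h)))) <= M.
Proof.
  intros Hl h w Hh Hw; apply Rle_trans with (1 := Hl _), HM; now apply slice_in_ball.
Qed.

Lemma bound_nonneg : 0 <= M.
Proof.
  apply Rle_trans with (norm (f (plus y zero))); [apply norm_ge_0 | apply HM; rewrite norm_zero; lra].
Qed.

(** On the slice in direction [h] the disk has radius [r / norm h] and the point of interest is
    [w = 1], so [cauchy_remainder] applies exactly when [norm h <= r / 4]. Its constant does not
    involve [l]. *)
Lemma frechet_remainder h : norm h <= r / 4 ->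
  norm (minus (f (plus y h)) (plus (f y) (D y h))) <= 16 * M / r ^ 2 * norm h ^ 2.
Proof.
  intros Hh.
  destruct (classic (h = zero)) as [-> | Hh0].
  { rewrite Lin_zeroE, !plus_zero_r, norm_minus_self, norm_zero; right; ring. }
  pose proof (norm_pos_neq0 h Hh0) as Hn.
  apply norm_le_functionals; intros l Hl.
  pose (ph := fun w : C => l (f (plus y (scal (w : C_AbsRing) h)))).
  pose (Dph := fun w : C => l (D (plus y (scal (w : C_AbsRing) h)) h)).
  assert (Hrho : 0 < r / norm h) by (apply Rdiv_lt_0_compat; lra).
  assert (H : Cmod (ph (RtoC 1) - (ph (RtoC 0) + Dph (RtoC 0) * RtoC 1))
    <= 16 * M / (r / norm h) ^ 2 * Cmod (RtoC 1) ^ 2).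
  { apply cauchy_remainder; [exact Hrho | | |].
    - intros w Hw; apply slice_cdiff, Hf; now apply slice_in_ball.
    - intros w Hw; now apply slice_bound.
    - rewrite Cmod_1; replace (r / norm h / 4) with (r / 4 / norm h) by (field; lra).
      apply Rle_div_r; lra. }
  unfold ph, Dph in H; rewrite scal_C_one, scal_C_zero, plus_zero_r, Cmod_1 in H.
  rewrite Lin_minusE, Lin_plusE.
  change (Cmod (l (f (plus y h)) - (l (f y) + l (D y h))) <= 16 * M / r ^ 2 * norm h ^ 2).
  replace (16 * M / r ^ 2 * norm h ^ 2) with (16 * M / (r / norm h) ^ 2 * 1 ^ 2)
    by (field; lra).
  rewrite Cmult_1_r in H; exact H.
Qed.

Lemma frechet_bound : norm (D y) <= 2 * M / r.
Proof.
  pose proof bound_nonneg as HM0.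
  assert (Hq : 0 <= 2 * M / r) by (apply Rmult_le_pos; [lra | now apply Rlt_le, Rinv_0_lt_compat]).
  apply Lin_norm_le_of; [exact Hq|]; intros h.
  destruct (classic (h = zero)) as [-> | Hh0].
  { rewrite Lin_zeroE, !norm_zero; lra. }
  pose proof (norm_pos_neq0 h Hh0) as Hn.
  apply norm_le_functionals; intros l Hl.
  assert (Hrho : 0 < r / norm h) by (apply Rdiv_lt_0_compat; lra).
  (* Cauchy's estimate needs a radius strictly inside the disk of radius [r / norm h]; half of it is
     used, hence the factor 2. *)
  replace (2 * M / r * norm h) with (M / (r / norm h / 2)) by (field; lra).
  assert (Hz : forall w : C, (w - RtoC 0)%C = w) by (intros; ring).
  apply (cauchy_estimate (fun w : C => l (f (plus y (scal (w : C_AbsRing) h)))) (RtoC 0) _ (r / norm h)).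
  - intros w Hw; rewrite Hz in Hw; eexists; apply slice_cdiff, Hf; now apply slice_in_ball.
  - replace (D y) with (D (plus y (scal (RtoC 0 : C_AbsRing) h)))
      by (rewrite scal_C_zero, plus_zero_r; reflexivity).
    apply slice_cdiff, Hf; rewrite scal_C_zero, norm_zero; exact Hr.
  - lra.
  - intros w Hw; rewrite Hz in Hw; apply slice_bound; [exact Hl | exact Hh0 | lra].
Qed.

End Cauchy_estimates.

Lemma fdiff_minus {U V : CNormedModule} (f g : U -> V) x (A B : Lin_NormedModule U V) :
  fdiff f x A -> fdiff g x B -> fdiff (fun y => minus (f y) (g y)) x (minus A B).
Proof.
  intros HA HB; apply fdiff_filterdiff in HA, HB.
  pose proof (filterdiff_minus_fct f g _ _ HA HB) as H.
  pose proof (proj1 (fdiff_filterdiff _ x (mkLin _ _ _ (proj1 H))) H) as K.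
  replace (minus A B) with (mkLin U V _ (proj1 H)); [exact K|].
  apply Lin_ext; intros h; rewrite Lin_minus_apply; reflexivity.
Qed.

Section Holomorphic_derivative.

Context {U V : CNormedModule}.
Hypothesis V_complete : seq_complete V.
Variables (f : U -> V) (D : U -> Lin U V) (x0 : U) (r M : R).
Hypothesis Hr : 0 < r.
Hypothesis HM0 : 0 < M.
Hypothesis Hf : forall k, norm k < r -> fdiff f (plus x0 k) (D (plus x0 k)).
Hypothesis HM : forall k, norm k < r -> norm (f (plus x0 k)) <= M.

Lemma plus_in_ball (k k' : U) : norm k <= r / 2 -> norm k' < r / 2 -> norm (plus k k') < r.
Proof. intros H1 H2; apply Rle_lt_trans with (1 := norm_triangle _ _); lra. Qed.

Lemma derivative_bound k : norm k <= r / 2 -> norm (D (plus x0 k)) <= 4 * M / r.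
Proof.
  intros Hk; replace (4 * M / r) with (2 * M / (r / 2)) by (field; lra).
  apply (frechet_bound f D (plus x0 k) (r / 2) M); [lra | |];
    intros k' Hk'; rewrite <- plus_assoc; [apply Hf | apply HM]; now apply plus_in_ball.
Qed.

Lemma second_order_bound k h : norm k <= r / 2 -> norm h <= r / 8 ->
  norm (minus (f (plus (plus x0 k) h)) (plus (f (plus x0 k)) (D (plus x0 k) h)))
    <= 64 * M / r ^ 2 * norm h ^ 2.
Proof.
  intros Hk Hh; replace (64 * M / r ^ 2) with (16 * M / (r / 2) ^ 2) by (field; lra).
  apply frechet_remainder; [lra | | | lra];
    intros k' Hk'; rewrite <- plus_assoc; [apply Hf | apply HM]; now apply plus_in_ball.
Qed.

(* The difference quotients [quot v n] of [f] in direction [v] converge uniformly to [D _ v]. *)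
Let step n : R := / (INR n + 1).
Let quot (v : U) n (y : U) : V :=
  scal (RtoC (/ step n) : C_AbsRing)
    (minus (f (plus y (scal (RtoC (step n) : C_AbsRing) v))) (f y)).

Lemma step_pos n : 0 < step n.
Proof. unfold step; apply Rinv_0_lt_compat; pose proof (pos_INR n); lra. Qed.

Lemma step_small eps : 0 < eps -> exists N, forall n, (N <= n)%nat -> step n <= eps.
Proof.
  intros Heps; destruct (INR_unbounded (/ eps)) as [N HN]; exists N; intros n Hn.
  apply le_INR in Hn; unfold step.
  rewrite <- (Rinv_inv eps); apply Rinv_le_contravar; [now apply Rinv_0_lt_compat | lra].
Qed.

Lemma quot_near v n k : norm k <= r / 2 -> step n * norm v <= r / 8 ->
  norm (minus (quot v n (plus x0 k)) (D (plus x0 k) v)) <= 64 * M / r ^ 2 * norm v ^ 2 * step n.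
Proof.
  intros Hk Hv; pose proof (step_pos n) as Hs.
  assert (Hn : norm (scal (RtoC (step n) : C_AbsRing) v) = step n * norm v)
    by (rewrite norm_scal_C, Cmod_R, Rabs_pos_eq; lra).
  pose proof (second_order_bound k (scal (RtoC (step n) : C_AbsRing) v) Hk ltac:(lra)) as H.
  rewrite Hn, Lin_scalE in H.
  apply Rmult_le_reg_l with (step n); [exact Hs|].
  rewrite <- (Rabs_pos_eq (step n)) at 1 by lra; rewrite <- Cmod_R, <- norm_scal_C.
  unfold quot; set (y := plus x0 k) in *.
  assert (E : (RtoC (step n) * RtoC (/ step n))%C = RtoC 1)
    by (rewrite <- RtoC_mult; f_equal; field; lra).
  assert (E' : forall a b c : V, scal (RtoC (step n) : C_AbsRing)
    (minus (scal (RtoC (/ step n) : C_AbsRing) (minus a b)) c)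
    = minus a (plus b (scal (RtoC (step n) : C_AbsRing) c))).
  { intros a b c.
    transitivity (minus (scal ((RtoC (step n) * RtoC (/ step n))%C : C_AbsRing) (minus a b))
      (scal (RtoC (step n) : C_AbsRing) c)); [module_eq V|].
    rewrite E; module_eq V. }
  rewrite E'; apply Rle_trans with (1 := H); right; ring.
Qed.

Let quot_D (v : U) n (y : U) : Lin U V :=
  Lin_scal U V (RtoC (/ step n))
    (Lin_plus U V (D (plus y (scal (RtoC (step n) : C_AbsRing) v))) (Lin_opp U V (D y))).

Lemma quot_fdiff v n k : norm k < r / 2 -> step n * norm v <= r / 8 ->
  fdiff (quot v n) (plus x0 k) (quot_D v n (plus x0 k)).
Proof.
  intros Hk Hv; pose proof (step_pos n) as Hs.
  assert (Hn : norm (scal (RtoC (step n) : C_AbsRing) v) = step n * norm v)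
    by (rewrite norm_scal_C, Cmod_R, Rabs_pos_eq; lra).
  set (sv := scal (RtoC (step n) : C_AbsRing) v) in *.
  assert (H1 : fdiff f (plus x0 k) (D (plus x0 k))) by (apply Hf; lra).
  assert (H2 : fdiff f (plus (plus x0 k) sv) (D (plus (plus x0 k) sv))).
  { rewrite <- plus_assoc; apply Hf, plus_in_ball; lra. }
  assert (H3 : fdiff (fun y => plus y sv) (plus x0 k) (Lin_plus U U (mkLin U U _ is_linear_id) (Lin_zero U U)))
    by exact (fdiff_plus _ _ _ _ _ (fdiff_lin (mkLin U U _ is_linear_id) _) (fdiff_const sv _)).
  pose proof (fdiff_comp _ _ _ _ _ H3 H2) as H4.
  assert (Hl : forall (c : C), is_linear (fun y : V => scal (c : C_AbsRing) y)).
  { intros c; split.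
    - intros a b; module_eq V.
    - intros j a; module_eq V.
    - exists (Cmod c + 1); pose proof (Cmod_ge_0 c); split; [lra|]; intros a.
      rewrite norm_scal_C; apply Rmult_le_compat_r; [apply norm_ge_0 | lra]. }
  pose proof (fdiff_comp _ _ _ _ _ H1 (fdiff_lin (mkLin V V _ (Hl (- RtoC 1)%C)) _)) as H5.
  pose proof (fdiff_plus _ _ _ _ _ H4 H5) as H6.
  pose proof (fdiff_comp _ _ _ _ _ H6 (fdiff_lin (mkLin V V _ (Hl (RtoC (/ step n)))) _)) as H7.
  simpl in H7.
  replace (quot_D v n (plus x0 k)) with
    (Lin_comp (mkLin V V _ (Hl (RtoC (/ step n)))) (Lin_plus U V
      (Lin_comp (D (plus (plus x0 k) sv)) (Lin_plus U U (mkLin U U _ is_linear_id) (Lin_zero U U)))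
      (Lin_comp (mkLin V V _ (Hl (- RtoC 1)%C)) (D (plus x0 k))))).
  - apply (fdiff_ext_near _ _ _ _ 1 Rlt_0_1) with (2 := H7); intros h _.
    unfold quot; fold sv; module_eq V.
  - apply Lin_ext; intros h; simpl; fold sv.
    change (scal (RtoC (/ step n) : C_AbsRing)
      (plus (D (plus (plus x0 k) sv) (plus h zero)) (scal ((- RtoC 1)%C : C_AbsRing) (D (plus x0 k) h)))
      = scal (RtoC (/ step n) : C_AbsRing)
      (plus (D (plus (plus x0 k) sv) h) (scal (opp (one : C_AbsRing)) (D (plus x0 k) h)))).
    rewrite plus_zero_r; reflexivity.
Qed.

Lemma quot_bound v n k : norm k <= r / 2 -> step n * norm v <= r / 16 ->
  norm (quot v n (plus x0 k)) <= 8 * M / r * norm v.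
Proof.
  intros Hk Hv; pose proof (quot_near v n k Hk ltac:(lra)) as H.
  pose proof (derivative_bound k Hk) as HD.
  pose proof (Lin_norm_apply (D (plus x0 k)) v) as Hv'.
  pose proof (norm_ge_0 v) as Hv0.
  replace (quot v n (plus x0 k)) with
    (plus (minus (quot v n (plus x0 k)) (D (plus x0 k) v)) (D (plus x0 k) v)) by module_eq V.
  apply Rle_trans with (1 := norm_triangle _ _).
  apply (Rmult_le_compat_r (norm v)) in HD; [|exact Hv0].
  assert (HK : 64 * M / r ^ 2 * norm v ^ 2 * step n <= 4 * M / r * norm v).
  { replace (64 * M / r ^ 2 * norm v ^ 2 * step n)
      with (64 * M / r ^ 2 * norm v * (step n * norm v)) by ring.
    replace (4 * M / r * norm v) with (64 * M / r ^ 2 * norm v * (r / 16)) by (field; lra).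
    apply Rmult_le_compat_l; [|exact Hv].
    apply Rmult_le_pos; [|exact Hv0].
    apply Rmult_le_pos; [lra | apply Rlt_le, Rinv_0_lt_compat, pow_lt, Hr]. }
  replace (8 * M / r * norm v) with (4 * M / r * norm v + 4 * M / r * norm v) by (field; lra); lra.
Qed.

(** Both quotients are uniformly close to [D _ v], so their difference is uniformly small on a ball,
    and [frechet_bound] makes its derivative at the centre small. *)
Lemma quot_D_cauchy v n m : step n * norm v <= r / 16 -> step m * norm v <= r / 16 ->
  norm (minus (quot_D v n x0 : Lin_NormedModule U V) (quot_D v m x0))
    <= 4 * (64 * M / r ^ 2 * norm v ^ 2) / r * (step n + step m).
Proof.
  intros Hn Hm; set (K := 64 * M / r ^ 2 * norm v ^ 2).
  replace (4 * K / r * (step n + step m)) with (2 * (K * (step n + step m)) / (r / 2)) by (field; lra).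
  apply (frechet_bound (fun y => minus (quot v n y) (quot v m y))
    (fun y => minus (quot_D v n y : Lin_NormedModule U V) (quot_D v m y)) x0 (r / 2)); [lra | |].
  - intros k Hk; apply fdiff_minus; apply quot_fdiff; lra.
  - intros k Hk.
    pose proof (quot_near v n k ltac:(lra) ltac:(lra)) as H1.
    pose proof (quot_near v m k ltac:(lra) ltac:(lra)) as H2.
    rewrite norm_minus_sym in H2; fold K in H1, H2.
    apply Rle_trans with (1 := norm_minus_triangle _ (D (plus x0 k) v) _); lra.
Qed.

Lemma step_mult_small (c eps : R) : 0 < eps -> exists N, forall n, (N <= n)%nat -> step n * c <= eps.
Proof.
  intros Heps; pose proof (Rabs_pos c).
  destruct (step_small (eps / (Rabs c + 1))) as [N HN]; [apply Rdiv_lt_0_compat; lra|].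
  exists N; intros n Hn; specialize (HN n Hn); pose proof (step_pos n).
  apply Rle_trans with (eps / (Rabs c + 1) * (Rabs c + 1)); [|right; field; lra].
  apply Rle_trans with (step n * (Rabs c + 1)).
  - apply Rmult_le_compat_l; [lra|]; pose proof (Rle_abs c); lra.
  - apply Rmult_le_compat_r; lra.
Qed.

(** [L] is the limit of the derivatives of the quotients. Each quotient satisfies
    [frechet_remainder] on the ball of radius [r / 2] with the bound [8 M / r norm v], so the
    estimate passes to the limit with [512 = 16 * 8 * 4]. Its linearity in [norm v] is what later
    gives a remainder in operator norm. *)
Lemma directional_derivative v : exists L : Lin U V, forall h, norm h <= r / 8 ->
  norm (minus (D (plus x0 h) v) (plus (D x0 v) (L h))) <= 512 * M / r ^ 3 * norm v * norm h ^ 2.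
Proof.
  destruct (step_mult_small (norm v) (r / 16)) as [N HN]; [lra|].
  set (K := 64 * M / r ^ 2 * norm v ^ 2).
  destruct (Lin_seq_complete U V V_complete (fun n => quot_D v n x0)) as [L HL].
  { intros eps Heps.
    destruct (step_mult_small (4 * K / r) (eps / 2)) as [N' HN']; [lra|].
    exists (max N N'); intros n m Hn Hm.
    pose proof (quot_D_cauchy v n m (HN n ltac:(lia)) (HN m ltac:(lia))) as H; fold K in H.
    pose proof (HN' n ltac:(lia)); pose proof (HN' m ltac:(lia)); lra. }
  exists L; intros h Hh.
  assert (Hq : forall k, norm k <= r / 2 -> vlim (fun n => quot v n (plus x0 k)) (D (plus x0 k) v)).
  { intros k Hk eps Heps; destruct (step_mult_small K eps Heps) as [N' HN'].
    exists (max N N'); intros n Hn.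
    pose proof (HN n ltac:(lia)).
    pose proof (quot_near v n k Hk ltac:(lra)) as H1; fold K in H1.
    pose proof (HN' n ltac:(lia)); lra. }
  pose proof (Hq h ltac:(lra)) as Q1.
  pose proof (Hq zero ltac:(rewrite norm_zero; lra)) as Q0; rewrite plus_zero_r in Q0.
  pose proof (vlim_Lin (Lin_eval h) _ _ HL) as QL;
  change (vlim (fun n => quot_D v n x0 h) (L h)) in QL.
  (* The limits at [x0 + h], at [x0] and of the derivatives combine to the limit of the first-order
     remainders of [quot v n]. *)
  pose proof (vlim_lincomb _ _ _ _ (- RtoC 1)%C QL (vlim_lincomb _ _ _ _ (- RtoC 1)%C Q0 Q1)) as Q.
  set (T := minus (D (plus x0 h) v) (plus (D x0 v) (L h))).
  replace T with (minus T zero) by module_eq V.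
  match type of Q with vlim ?u ?l => replace l with T in Q by (unfold T; module_eq V);
    apply (vlim_norm_le u T zero _ N Q) end.
  intros n Hn; specialize (HN n Hn).
  pose proof (frechet_remainder (quot v n) (quot_D v n) x0 (r / 2) (8 * M / r * norm v) ltac:(lra)
    (fun k Hk => quot_fdiff v n k Hk ltac:(lra))
    (fun k Hk => quot_bound v n k (Rlt_le _ _ Hk) HN) h ltac:(lra)) as HR.
  replace (512 * M / r ^ 3 * norm v * norm h ^ 2)
    with (16 * (8 * M / r * norm v) / (r / 2) ^ 2 * norm h ^ 2) by (field; lra).
  apply Rle_trans with (2 := HR); right; f_equal; cbv beta; module_eq V.
Qed.

(** Homogeneity of degree one against a bound of degree two, tested at small multiples of [h]. It
    identifies the operators chosen for different directions [v]. *)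
Lemma Lin_quadratic_zero (A : Lin U V) (K d : R) : 0 < d ->
  (forall h, norm h <= d -> norm (A h) <= K * norm h ^ 2) -> forall h, A h = zero.
Proof.
  intros Hd H h; apply (norm_le_eps _ (norm h)); intros eps Heps.
  pose proof (Rabs_pos K) as HK.
  destruct (small_multiple h (Rmin d (eps / (Rabs K + 1)))) as [t [Ht Hth]].
  { apply Rmin_pos; [exact Hd | apply Rdiv_lt_0_compat; lra]. }
  pose proof (Rmin_l d (eps / (Rabs K + 1))); pose proof (Rmin_r d (eps / (Rabs K + 1))).
  specialize (H _ (Rlt_le _ _ (Rlt_le_trans _ _ _ Hth (Rmin_l _ _)))).
  set (th := scal (RtoC t : C_AbsRing) h) in *.
  assert (Hn : norm th = t * norm h) by (unfold th; rewrite norm_scal_C, Cmod_R, Rabs_pos_eq; lra).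
  assert (HA : norm (A th) = t * norm (A h))
    by (unfold th; rewrite Lin_scalE, norm_scal_C, Cmod_R, Rabs_pos_eq; lra).
  apply Rmult_le_reg_l with t; [exact Ht|]; rewrite <- HA.
  apply Rle_trans with (1 := H).
  replace (t * (eps * norm h)) with (eps * norm th) by (rewrite Hn; ring).
  replace (K * norm th ^ 2) with (K * norm th * norm th) by ring.
  apply Rmult_le_compat_r; [apply norm_ge_0|].
  apply Rle_trans with ((Rabs K + 1) * (eps / (Rabs K + 1))); [|right; field; lra].
  pose proof (Rle_abs K); pose proof (norm_ge_0 th).
  apply Rle_trans with ((Rabs K + 1) * norm th); [nra|].
  apply Rmult_le_compat_l; lra.
Qed.

(** The operators [Lv v] are chosen one direction at a time; their quadratic remainders force
    linearity in [v], and the local bound of [D] makes them bounded in [v]. Exchanging the arguments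
    gives the second derivative [h |-> (v |-> Lv v h)]. *)
Lemma derivative_fdiff : exists A, fdiff (V := Lin_NormedModule U V) D x0 A.
Proof.
  pose (Lv := fun v => proj1_sig (constructive_indefinite_description _ (directional_derivative v))).
  set (K := 512 * M / r ^ 3).
  assert (HK : 0 <= K)
    by (apply Rmult_le_pos; [lra | apply Rlt_le, Rinv_0_lt_compat, pow_lt, Hr]).
  assert (HL : forall v h, norm h <= r / 8 ->
    norm (minus (D (plus x0 h) v) (plus (D x0 v) (Lv v h))) <= K * norm v * norm h ^ 2)
    by (intros v; exact (proj2_sig (constructive_indefinite_description _ (directional_derivative v)))).
  assert (Hlin : forall (c : C) v w h,
    Lv (plus (scal (c : C_AbsRing) v) w) h = plus (scal (c : C_AbsRing) (Lv v h)) (Lv w h)).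
  { intros c v w h; set (s := plus (scal (c : C_AbsRing) v) w).
    pose (A := Lin_plus U V (Lv s) (Lin_scal U V (- RtoC 1)%C
      (Lin_plus U V (Lin_scal U V c (Lv v)) (Lv w)))).
    assert (HA : forall h, A h = minus (Lv s h) (plus (scal (c : C_AbsRing) (Lv v h)) (Lv w h))).
    { intros k; change (plus (Lv s k) (scal ((- RtoC 1)%C : C_AbsRing)
        (plus (scal (c : C_AbsRing) (Lv v k)) (Lv w k))) =
        minus (Lv s k) (plus (scal (c : C_AbsRing) (Lv v k)) (Lv w k))); module_eq V. }
    assert (HBs : forall B : Lin U V, B s = plus (scal (c : C_AbsRing) (B v)) (B w))
      by (intros B; rewrite <- Lin_scalE; exact (Lin_plusE B _ _)).
    assert (H0 : A h = zero).
    { apply (Lin_quadratic_zero A (K * norm s + Cmod c * (K * norm v) + K * norm w) (r / 8)); [lra|].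
      intros k Hk; rewrite HA.
      pose proof (HL s k Hk) as H1; pose proof (HL v k Hk) as H2; pose proof (HL w k Hk) as H3.
      rewrite !HBs in H1.
      match type of H1 with norm ?e <= _ => set (e1 := e) in H1 end.
      match type of H2 with norm ?e <= _ => set (e2 := e) in H2 end.
      match type of H3 with norm ?e <= _ => set (e3 := e) in H3 end.
      replace (minus (Lv s k) (plus (scal (c : C_AbsRing) (Lv v k)) (Lv w k)))
        with (minus (plus (scal (c : C_AbsRing) e2) e3) e1) by (unfold e1, e2, e3; module_eq V).
      apply Rle_trans with (1 := norm_minus_le _ _).
      apply Rle_trans with (1 := Rplus_le_compat_r _ _ _ (norm_triangle _ _)).
      rewrite norm_scal_C.
      apply (Rmult_le_compat_l (Cmod c)) in H2; [|apply Cmod_ge_0]; lra. }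
    rewrite HA in H0.
    replace (Lv s h) with (plus (minus (Lv s h) (plus (scal (c : C_AbsRing) (Lv v h)) (Lv w h)))
      (plus (scal (c : C_AbsRing) (Lv v h)) (Lv w h))) by module_eq V.
    rewrite H0, plus_zero_l; reflexivity. }
  assert (Hz : forall h, Lv zero h = zero).
  { intros h; pose proof (Hlin (- RtoC 1)%C zero zero h) as H.
    etransitivity; [|etransitivity; [exact H | module_eq V]].
    apply (f_equal (fun s => lin_fun (Lv s) h)); module_eq U. }
  (* For [norm h <= r / 8]: twice the bound [4 M / r] of [D], at [x0 + h] and at [x0], plus the
     remainder at the largest admissible [norm h]. In [Hbd] a general [h] is rescaled to norm
     [r / 8]. *)
  set (B := 8 * M / r + K * (r / 8) ^ 2).
  assert (HB : 0 <= B).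
  { unfold B; apply Rplus_le_le_0_compat; [|apply Rmult_le_pos; [exact HK | apply pow2_ge_0]].
    apply Rmult_le_pos; [lra | now apply Rlt_le, Rinv_0_lt_compat]. }
  assert (Hsmall : forall v h, norm h <= r / 8 -> norm (Lv v h) <= B * norm v).
  { intros v h Hh; pose proof (HL v h Hh) as H.
    pose proof (norm_ge_0 v); pose proof (norm_ge_0 h).
    pose proof (derivative_bound h ltac:(lra)) as D1.
    pose proof (derivative_bound zero ltac:(rewrite norm_zero; lra)) as D0.
    rewrite plus_zero_r in D0.
    pose proof (Lin_norm_apply (D (plus x0 h)) v) as E1; pose proof (Lin_norm_apply (D x0) v) as E0.
    apply (Rmult_le_compat_r (norm v)) in D1; [|assumption].
    apply (Rmult_le_compat_r (norm v)) in D0; [|assumption].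
    set (e := minus (D (plus x0 h) v) (plus (D x0 v) (Lv v h))) in *.
    replace (Lv v h) with (minus (minus (D (plus x0 h) v) (D x0 v)) e) by (unfold e; module_eq V).
    apply Rle_trans with (1 := norm_minus_le _ _).
    apply Rle_trans with (1 := Rplus_le_compat_r _ _ _ (norm_minus_le _ _)).
    assert (K * norm v * norm h ^ 2 <= K * (r / 8) ^ 2 * norm v).
    { replace (K * (r / 8) ^ 2 * norm v) with (K * norm v * (r / 8) ^ 2) by ring.
      apply Rmult_le_compat_l; [now apply Rmult_le_pos|]; apply pow_incr; lra. }
    unfold B; replace ((8 * M / r + K * (r / 8) ^ 2) * norm v) with
      (4 * M / r * norm v + 4 * M / r * norm v + K * (r / 8) ^ 2 * norm v) by (field; lra); lra. }
  assert (Hbd : forall v h, norm (Lv v h) <= (8 / r * B * norm h) * norm v).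
  { intros v h; destruct (classic (h = zero)) as [-> | Hh0].
    - rewrite Lin_zeroE, !norm_zero; lra.
    - pose proof (norm_pos_neq0 h Hh0) as Hn.
      assert (Ht : 0 < r / 8 / norm h) by (apply Rdiv_lt_0_compat; lra).
      pose proof (Hsmall v (scal (RtoC (r / 8 / norm h) : C_AbsRing) h)) as H.
      rewrite Lin_scalE, !norm_scal_C, Cmod_R, Rabs_pos_eq in H by lra.
      specialize (H ltac:(right; field; lra)).
      apply Rmult_le_reg_l with (r / 8 / norm h); [exact Ht|].
      apply Rle_trans with (1 := H); right; field; lra. }
  assert (HAh : forall h, is_linear (fun v => Lv v h)).
  { intros h; split.
    - intros v w; pose proof (Hlin (RtoC 1) v w h) as H; rewrite !scal_C_one in H; exact H.
    - intros c v; pose proof (Hlin c v zero h) as H; rewrite Hz, !plus_zero_r in H; exact H.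
    - exists (8 / r * B * norm h + 1).
      assert (0 <= 8 / r * B * norm h).
      { apply Rmult_le_pos; [|apply norm_ge_0]; apply Rmult_le_pos; [|exact HB].
        apply Rlt_le, Rdiv_lt_0_compat; lra. }
      split; [lra|]; intros v; apply Rle_trans with (1 := Hbd v h).
      apply Rmult_le_compat_r; [apply norm_ge_0 | lra]. }
  pose (Ah := fun h => mkLin U V _ (HAh h)).
  assert (HA : is_linear (V := Lin_NormedModule U V) Ah).
  { split.
    - intros h k; apply Lin_ext; intros v; exact (Lin_plusE (Lv v) h k).
    - intros c h; apply Lin_ext; intros v; exact (Lin_scalE (Lv v) c h).
    - exists (8 / r * B + 1).
      assert (0 <= 8 / r * B) by (apply Rmult_le_pos; [apply Rlt_le, Rdiv_lt_0_compat; lra | exact HB]).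
      split; [lra|]; intros h; pose proof (norm_ge_0 h) as Hh.
      apply (Lin_norm_le_of (Ah h)); [apply Rmult_le_pos; lra|]; intros v.
      apply Rle_trans with (1 := Hbd v h); apply Rmult_le_compat_r; [apply norm_ge_0|].
      apply Rmult_le_compat_r; lra. }
  exists (mkLin U (Lin_NormedModule U V) Ah HA); intros eps Heps.
  exists (Rmin (r / 8) (eps / (K + 1))); split.
  { apply Rmin_pos; [lra | apply Rdiv_lt_0_compat; lra]. }
  intros h Hh; pose proof (Rmin_l (r / 8) (eps / (K + 1))); pose proof (Rmin_r (r / 8) (eps / (K + 1))).
  pose proof (norm_ge_0 h).
  apply (Lin_norm_le_of (U := U) (V := V)); [apply Rmult_le_pos; lra|]; intros v.
  rewrite Lin_minus_apply.
  apply Rle_trans with (1 := HL v h ltac:(lra)).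
  replace (K * norm v * norm h ^ 2) with (K * norm h * norm h * norm v) by ring.
  apply Rmult_le_compat_r; [apply norm_ge_0|]; apply Rmult_le_compat_r; [assumption|].
  apply Rle_trans with ((K + 1) * (eps / (K + 1))); [|right; field; lra].
  apply Rle_trans with ((K + 1) * norm h); [nra|]; apply Rmult_le_compat_l; lra.
Qed.

End Holomorphic_derivative.

Lemma Frechet_holomorphic {U V : CNormedModule} (f : U -> V) :
  seq_complete V -> holomorphic_on_ball f -> holomorphic_on_ball (V := Lin_NormedModule U V) (Frechet f).
Proof.
  intros HV Hf x Hx; unfold unit_ball in Hx.
  apply fdiff_ex.
  (* Holomorphic maps need not be bounded on the unit ball; continuity at [x] provides a small ball
     with the bound [norm (f x) + 1]. *)
  destruct (fdiff_cont _ _ _ (Frechet_spec f x (Hf x Hx)) 1 Rlt_0_1) as [d [Hd Hc]].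
  pose proof (norm_ge_0 (f x)).
  apply (derivative_fdiff HV f (Frechet f) x (Rmin d (1 - norm x)) (norm (f x) + 1)).
  - apply Rmin_pos; lra.
  - lra.
  - intros k Hk; pose proof (Rmin_r d (1 - norm x)).
    apply Frechet_spec, Hf; apply Rle_lt_trans with (1 := norm_triangle _ _); lra.
  - intros k Hk; pose proof (Rmin_l d (1 - norm x)); specialize (Hc k ltac:(lra)).
    replace (f (plus x k)) with (plus (minus (f (plus x k)) (f x)) (f x)) by module_eq V.
    apply Rle_trans with (1 := norm_triangle _ _); lra.
Qed.

(** * Subordination on the unit disk *)

Definition der (f D : C -> C) : Prop := forall w, Cmod w < 1 -> cdiff f w (D w).

Lemma Cmod_0_lt_1 : Cmod (RtoC 0) < 1.
Proof. rewrite Cmod_0; lra. Qed.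

Lemma disk_shift (z w : C) : Cmod (w - z) < 1 - Cmod z -> Cmod w < 1.
Proof.
  intros H; pose proof (Cmod_triangle (w - z) z) as K.
  replace (w - z + z)%C with w in K by ring; lra.
Qed.

Lemma cdiff_ext_disk f g z d :
  Cmod z < 1 -> (forall w, Cmod w < 1 -> f w = g w) -> cdiff f z d -> cdiff g z d.
Proof.
  intros Hz E; apply cdiff_ext_near with (1 - Cmod z); [lra|].
  intros w Hw; apply E; exact (disk_shift z w Hw).
Qed.

(** Allows both sides of an identity on the disk to be differentiated. *)
Lemma der_unique f g D E : (forall w, Cmod w < 1 -> f w = g w) -> der f D -> der g E ->
  forall w, Cmod w < 1 -> D w = E w.
Proof.
  intros H HD HE w Hw; apply (cdiff_unique g w); [|now apply HE].
  apply cdiff_ext_disk with f; auto.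
Qed.

Lemma der_C_derive f : (forall w, Cmod w < 1 -> differentiable_at f w) -> der f (C_derive f).
Proof. intros H w Hw; destruct (H w Hw) as [d Hd]; rewrite (C_derive_eq f w d Hd); exact Hd. Qed.

(** The case [U = V = C] of [Frechet_holomorphic]; evaluation of the operator-valued derivative at
    [1] recovers [D]. *)
Lemma der_der f D : der f D -> der D (C_derive D).
Proof.
  intros Hf; apply der_C_derive; intros w Hw.
  assert (Hh : holomorphic_on_ball (U := C_NormedModule) (V := C_NormedModule) f).
  { intros z Hz; apply fdiff_ex; exists (Cmul (D z)); apply cdiff_fdiff, Hf, Hz. }
  pose proof (Frechet_holomorphic f (Banach_seq_complete C_CompleteNormedModule) Hh w Hw) as H.
  apply fdiff_ex in H; destruct H as [A HA].
  pose proof (fdiff_comp _ _ _ _ _ HA (fdiff_lin (Lin_eval (RtoC 1 : C_NormedModule)) _)) as K.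
  set (B := Lin_comp _ A) in K; exists (B (RtoC 1)).
  apply cdiff_ext_disk with (fun z => Frechet (U := C_NormedModule) (V := C_NormedModule) f z (RtoC 1));
    [exact Hw | |].
  - intros z Hz.
    rewrite (Frechet_eq (U := C_NormedModule) (V := C_NormedModule) f z (Cmul (D z)))
      by (apply cdiff_fdiff, Hf, Hz).
    simpl; ring.
  - apply cdiff_fdiff; rewrite <- Lin_C_eq; exact K.
Qed.

Lemma der_mult f g D E : der f D -> der g E ->
  der (fun w => f w * g w)%C (fun w => D w * g w + f w * E w)%C.
Proof. intros Hf Hg w Hw; apply cdiff_mult; auto. Qed.

Lemma der_plus f g D E : der f D -> der g E ->
  der (fun w => f w + g w)%C (fun w => D w + E w)%C.
Proof. intros Hf Hg w Hw; apply cdiff_plus; auto. Qed.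

Lemma der_id : der (fun w => w) (fun _ => RtoC 1).
Proof. intros w _; apply cdiff_id. Qed.

Lemma der_minus_const f D c : der f D -> der (fun w => f w - c)%C D.
Proof.
  intros Hf w Hw; apply (cdiff_eq _ _ (D w - RtoC 0)%C); [|ring].
  apply cdiff_minus; [now apply Hf | apply cdiff_const].
Qed.

(* Differentiating [w h' = (q - 1) h] twice at the origin. *)
Lemma starlike_coefficients h h' h'' q q' q'' :
  der h h' -> der h' h'' -> der q q' -> der q' q'' -> h (RtoC 0) = RtoC 1 -> q (RtoC 0) = RtoC 1 ->
  (forall w, Cmod w < 1 -> w * h' w = (q w - RtoC 1) * h w)%C ->
  h' (RtoC 0) = q' (RtoC 0) /\
  (RtoC 2 * h'' (RtoC 0) = q'' (RtoC 0) + RtoC 2 * q' (RtoC 0) * q' (RtoC 0))%C.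
Proof.
  intros Hh Hh' Hq Hq' h0 q0 E0.
  pose proof (der_unique _ _ _ _ E0 (der_mult _ _ _ _ der_id Hh')
    (der_mult _ _ _ _ (der_minus_const _ _ (RtoC 1) Hq) Hh)) as E1.
  pose proof (E1 _ Cmod_0_lt_1) as F1; cbv beta in F1; rewrite h0, q0 in F1.
  assert (F : h' (RtoC 0) = q' (RtoC 0)).
  { transitivity (RtoC 1 * h' (RtoC 0) + RtoC 0 * h'' (RtoC 0))%C; [ring | rewrite F1; ring]. }
  split; [exact F|].
  pose proof (der_der _ _ Hh') as Hh''.
  assert (H1 : der (fun _ => RtoC 1) (fun _ => RtoC 0)) by (intros w _; apply cdiff_const).
  pose proof (der_unique _ _ _ _ E1
    (der_plus _ _ _ _ (der_mult _ _ _ _ H1 Hh') (der_mult _ _ _ _ der_id Hh''))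
    (der_plus _ _ _ _ (der_mult _ _ _ _ Hq' Hh)
      (der_mult _ _ _ _ (der_minus_const _ _ (RtoC 1) Hq) Hh')) _ Cmod_0_lt_1) as F2.
  cbv beta in F2; rewrite h0, q0, F in F2.
  transitivity (RtoC 0 * q' (RtoC 0) + RtoC 1 * h'' (RtoC 0)
    + (RtoC 1 * h'' (RtoC 0) + RtoC 0 * C_derive h'' (RtoC 0)))%C; [ring | rewrite F2; ring].
Qed.

Section Phi.

Variables (Phi : C -> C) (a b : R).
Hypothesis Phi_biholomorphic : biholomorphic_onto_image Phi.
Hypothesis Phi_0 : Phi (RtoC 0) = RtoC 1.
Hypothesis Phi_d1 : C_derive Phi (RtoC 0) = RtoC a.
Hypothesis a_pos : 0 < a.
Hypothesis Phi_d2 : C_derive (C_derive Phi) (RtoC 0) = RtoC b.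

Lemma Phi_der : der Phi (C_derive Phi).
Proof.
  intros w Hw; apply ex_derive_cdiff; exact (proj1 Phi_biholomorphic w Hw).
Qed.

(** With [q = Phi(om)] one has [q'(0) = a w1] and [q''(0) = b w1^2 + 2 a w2], so
    [h''(0) / 2 = (q''(0) + 2 q'(0)^2) / 4]; taking out [a / 2] leaves [lam = b / (2 a) + a] in
    front of [w1^2]. *)
Lemma subordination_coefficients h h' h'' om om' om'' :
  der h h' -> der h' h'' -> der om om' -> der om' om'' ->
  h (RtoC 0) = RtoC 1 -> om (RtoC 0) = RtoC 0 -> (forall w, Cmod w < 1 -> Cmod (om w) < 1) ->
  (forall w, Cmod w < 1 -> w * h' w = (Phi (om w) - RtoC 1) * h w)%C ->
  h' (RtoC 0) = (RtoC a * om' (RtoC 0))%C /\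
  (h'' (RtoC 0) / RtoC 2 = RtoC (a / 2) *
    (om'' (RtoC 0) / RtoC 2 + RtoC (1 / 2 * (b / a) + a) * (om' (RtoC 0) * om' (RtoC 0))))%C.
Proof.
  intros Hh Hh' Hom Hom' h0 om0 om1 E.
  assert (H2 : RtoC 2 <> RtoC 0) by (intros K; apply RtoC_inj in K; lra).
  assert (Ha : RtoC a <> RtoC 0) by (intros K; apply RtoC_inj in K; lra).
  assert (Hq : der (fun w => Phi (om w)) (fun w => C_derive Phi (om w) * om' w)%C)
    by (intros w Hw; apply cdiff_comp; [now apply Hom | now apply Phi_der, om1]).
  assert (Hq' : der (fun w => C_derive Phi (om w) * om' w)%C (fun w =>
    (C_derive (C_derive Phi) (om w) * om' w) * om' w + C_derive Phi (om w) * om'' w)%C).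
  { intros w Hw; apply (cdiff_mult (fun w => C_derive Phi (om w))); [|now apply Hom'].
    apply cdiff_comp; [now apply Hom | apply (der_der _ _ Phi_der), om1, Hw]. }
  destruct (starlike_coefficients h h' h'' _ _ _ Hh Hh' Hq Hq' h0) as [E1 E2];
    [rewrite om0; exact Phi_0 | exact E|].
  rewrite om0, Phi_d1 in E1; rewrite om0, Phi_d1, Phi_d2 in E2.
  split; [exact E1|].
  set (w1 := om' (RtoC 0)) in *; set (w2 := om'' (RtoC 0)) in *.
  replace (h'' (RtoC 0) / RtoC 2)%C with ((RtoC 2 * h'' (RtoC 0)) / (RtoC 2 * RtoC 2))%C
    by (field; exact H2).
  rewrite E2, RtoC_plus, RtoC_mult, !RtoC_div by lra; field; repeat split; assumption.
Qed.

Lemma coefficient_bound h h' h'' :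
  Rabs (b + 2 * a ^ 2) >= 2 * a ->
  der h h' -> der h' h'' -> h (RtoC 0) = RtoC 1 ->
  (forall w, Cmod w < 1 -> h w <> RtoC 0 /\ disk_image Phi (RtoC 1 + w * h' w / h w)%C) ->
  Cmod (h' (RtoC 0) ^ 2 - (h'' (RtoC 0) / RtoC 2) ^ 2)%C
    <= a ^ 2 / 4 * (1 / 2 * (b / a) + a) ^ 2 + a ^ 2.
Proof.
  intros Hab Hh Hh' h0 Him.
  destruct Phi_biholomorphic as [_ [_ [Psi [HPsi HPsi']]]].
  pose (q := fun w => (RtoC 1 + w * h' w / h w)%C).
  pose (om := fun w => Psi (q w)).
  assert (Hom1 : forall w, Cmod w < 1 -> Cmod (om w) < 1 /\ Phi (om w) = q w).
  { intros w Hw; destruct (Him w Hw) as [_ [u [Hu Eu]]]; fold (q w) in Eu.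
    unfold om; rewrite Eu, HPsi by exact Hu; split; [exact Hu | reflexivity]. }
  assert (Hom : der om (C_derive om)).
  { apply der_C_derive; intros w Hw; destruct (Him w Hw) as [Hw0 Hi].
    pose proof (proj1 (ex_derive_cdiff Psi (q w)) (HPsi' _ Hi)) as HP.
    eexists; refine (cdiff_comp q Psi w _ _ _ HP); unfold q.
    apply cdiff_plus; [apply cdiff_const|].
    apply cdiff_div; [exact Hw0 | apply cdiff_mult; [apply cdiff_id | now apply Hh'] | now apply Hh]. }
  assert (om0 : om (RtoC 0) = RtoC 0).
  { unfold om, q; replace (RtoC 1 + RtoC 0 * h' (RtoC 0) / h (RtoC 0))%C with (RtoC 1)
      by (unfold Cdiv; ring).
    rewrite <- Phi_0; apply HPsi; exact Cmod_0_lt_1. }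
  pose proof (der_der _ _ Hom) as Hom'.
  destruct (subordination_coefficients h h' h'' om _ _ Hh Hh' Hom Hom' h0 om0) as [E1 E2].
  { intros w Hw; apply Hom1, Hw. }
  { intros w Hw; rewrite (proj2 (Hom1 w Hw)); unfold q; field; apply Him, Hw. }
  pose proof (schwarz_second om _ _ Hom (Hom' _ Cmod_0_lt_1) om0
    (fun w Hw => Rlt_le _ _ (proj1 (Hom1 w Hw)))) as HS.
  rewrite E1, E2.
  set (w1 := C_derive om (RtoC 0)) in *.
  set (w2 := (C_derive (C_derive om) (RtoC 0) / RtoC 2)%C) in *.
  set (lam := 1 / 2 * (b / a) + a).
  (* The hypothesis on [a] and [b], divided by [2 a]. *)
  assert (Hlam : 1 <= Rabs lam).
  { replace lam with ((b + 2 * a ^ 2) / (2 * a)) by (unfold lam; field; lra).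
    unfold Rdiv; rewrite Rabs_mult, Rabs_inv, (Rabs_pos_eq (2 * a)) by lra.
    apply Rle_div_r; lra. }
  set (s := Cmod w1) in *; assert (Hs : 0 <= s) by apply Cmod_ge_0.
  pose proof (Cmod_ge_0 w2) as Hw2.
  (* By [HS], [|w2| + |lam| s^2 <= |lam| + (1 - |lam|) (1 - s^2)], and the last product is not
     positive. *)
  assert (B3 : Cmod (RtoC (a / 2) * (w2 + RtoC lam * (w1 * w1))) <= a / 2 * Rabs lam).
  { rewrite Cmod_mult, Cmod_R, (Rabs_pos_eq (a / 2)) by lra.
    apply Rmult_le_compat_l; [lra|].
    apply Rle_trans with (1 := Cmod_triangle _ _).
    rewrite !Cmod_mult, Cmod_R; fold s; nra. }
  unfold Cminus; apply Rle_trans with (1 := Cmod_triangle _ _).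
  rewrite Cmod_opp, !Cmod_pow.
  set (m3 := Cmod (RtoC (a / 2) * (w2 + RtoC lam * (w1 * w1)))) in *.
  assert (0 <= m3) by apply Cmod_ge_0.
  rewrite Cmod_mult, Cmod_R, (Rabs_pos_eq a) by lra; fold s.
  assert (m3 ^ 2 <= (a / 2 * Rabs lam) ^ 2) by (apply pow_incr; lra).
  rewrite Rpow_mult_distr, pow2_abs in H0.
  assert (s ^ 2 <= 1) by lra.
  assert ((a * s) ^ 2 <= a ^ 2 * 1).
  { rewrite Rpow_mult_distr; apply Rmult_le_compat_l; [apply pow2_ge_0 | assumption]. }
  replace ((a / 2) ^ 2) with (a ^ 2 / 4) in H0 by field; lra.
Qed.

End Phi.

(** * Primitives on the disk *)

Lemma Cint_derivative f D a b : a <= b ->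
  (forall t, a <= t <= b -> cdiff f (RtoC t) (D (RtoC t))) -> ccont_on (fun t => D (RtoC t)) a b ->
  Cint (fun t => D (RtoC t)) a b = (f (RtoC b) - f (RtoC a))%C.
Proof.
  intros Hab Hf HD.
  assert (Hc : forall c t, a <= t <= b ->
    is_derive (fun s => fst (c * f (RtoC s))%C) t (fst (c * (D (RtoC t) * RtoC 1))%C)).
  { intros c t Ht; apply is_derive_real_part; [now apply Hf|].
    intros s; rewrite RtoC_plus; ring. }
  assert (HI : forall c,
    RInt (fun t => fst (c * (D (RtoC t) * RtoC 1))%C) a b
      = fst (c * f (RtoC b))%C - fst (c * f (RtoC a))%C).
  { intros c; apply is_RInt_unique.
    apply (is_RInt_derive (V := R_CompleteNormedModule) (fun s => fst (c * f (RtoC s))%C));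
      rewrite Rmin_left, Rmax_right by exact Hab; [exact (Hc c)|].
    intros t Ht; apply (ccont_components (fun t => c * (D (RtoC t) * RtoC 1))%C t).
    apply ccont_mult; [apply ccont_const|]; apply ccont_mult; [now apply HD | apply ccont_const]. }
  pose proof (HI (RtoC 1)) as H1.
  pose proof (HI (- Ci)%C) as H2.
  assert (E1 : forall z : C, fst (RtoC 1 * z)%C = fst z) by (intros []; simpl; ring).
  assert (E2 : forall z : C, fst (- Ci * z)%C = snd z) by (intros []; simpl; ring).
  rewrite !E1 in H1; rewrite !E2 in H2.
  unfold Cint.
  rewrite (RInt_ext (fun t => fst (D (RtoC t))) (fun t => fst (RtoC 1 * (D (RtoC t) * RtoC 1))%C)), H1
    by (intros; rewrite E1; f_equal; ring).
  rewrite (RInt_ext (fun t => snd (D (RtoC t))) (fun t => fst (- Ci * (D (RtoC t) * RtoC 1))%C)), H2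
    by (intros; rewrite E2; f_equal; ring).
  destruct (f (RtoC b)), (f (RtoC a)); reflexivity.
Qed.

(** Compactness of the segment from [0] to [w] gives a tube of constant radius around it on which
    [K] is bounded, which makes the Cauchy remainders along the segment uniform in [t]. *)
Lemma segment_bound K K' w : der K K' -> Cmod w < 1 ->
  exists rho M, 0 < rho /\ forall t v, 0 <= t <= 1 -> Cmod v < rho ->
    Cmod (RtoC t * w + v) < 1 /\ Cmod (K (RtoC t * w + v)%C) <= M.
Proof.
  intros HK Hw.
  pose proof (Cmod_ge_0 w) as Hw0.
  assert (Hin : forall t, 0 <= t <= 1 -> Cmod (RtoC t * w) < 1)
    by (intros t Ht; pose proof (Cmod_segment w t Ht); lra).
  (* The factor 2 leaves room for two moves: from the centre [s w] to [t w], and from there by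
     [v]. *)
  assert (Hd : forall t, exists d : posreal, 0 <= t <= 1 -> forall v, Cmod (v - RtoC t * w) < 2 * d ->
    Cmod (K v - K (RtoC t * w)%C) < 1).
  { intros t; destruct (Rle_dec 0 t) as [H0 | H0]; [destruct (Rle_dec t 1) as [H1 | H1]|].
    - destruct (cdiff_cont _ _ _ (HK _ (Hin t (conj H0 H1))) 1 Rlt_0_1) as [d [Hd Hd']].
      assert (Hd2 : 0 < d / 2) by lra.
      exists (mkposreal _ Hd2); intros _ v Hv; apply Hd'; simpl in Hv; lra.
    - exists (mkposreal 1 Rlt_0_1); intros; lra.
    - exists (mkposreal 1 Rlt_0_1); intros; lra. }
  pose (del := fun t => proj1_sig (constructive_indefinite_description _ (Hd t))).
  assert (Hdel : forall t, 0 <= t <= 1 -> forall v, Cmod (v - RtoC t * w) < 2 * del t ->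
    Cmod (K v - K (RtoC t * w)%C) < 1)
    by (intros t; exact (proj2_sig (constructive_indefinite_description _ (Hd t)))).
  destruct (compactness_value_1d 0 1 del) as [d Hcomp].
  destruct (bounded_continuity (V := R_NormedModule) (fun t => Cmod (K (RtoC t * w)%C)) 0 1) as [M HM].
  { intros t Ht; apply filterlim_locally; intros eps.
    destruct (cdiff_cont _ _ _ (HK _ (Hin t Ht)) eps (cond_pos eps)) as [e [He He']].
    exists (mkposreal e He); intros s Hs.
    assert (Hst : Cmod (RtoC s * w - RtoC t * w) < e).
    { replace (RtoC s * w - RtoC t * w)%C with (RtoC (s - t) * w)%C by (rewrite RtoC_minus; ring).
      rewrite Cmod_mult, Cmod_R; change (Rabs (s - t) < e) in Hs.
      pose proof (Rabs_pos (s - t)); nra. }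
    specialize (He' _ Hst).
    change (Rabs (Cmod (K (RtoC s * w)%C) - Cmod (K (RtoC t * w)%C)) < eps).
    apply Rle_lt_trans with (2 := He').
    pose proof (Cmod_triangle (K (RtoC s * w)%C - K (RtoC t * w)%C) (K (RtoC t * w)%C)) as T1.
    pose proof (Cmod_triangle (K (RtoC t * w)%C - K (RtoC s * w)%C) (K (RtoC s * w)%C)) as T2.
    replace (K (RtoC s * w)%C - K (RtoC t * w)%C + K (RtoC t * w)%C)%C with (K (RtoC s * w)%C) in T1 by ring.
    replace (K (RtoC t * w)%C - K (RtoC s * w)%C + K (RtoC s * w)%C)%C with (K (RtoC t * w)%C) in T2 by ring.
    replace (K (RtoC t * w)%C - K (RtoC s * w)%C)%C with (- (K (RtoC s * w)%C - K (RtoC t * w)%C))%C in T2 by ring.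
    rewrite Cmod_opp in T2; apply Rabs_le; lra. }
  exists (Rmin d (1 - Cmod w)), (M + 1); split; [apply Rmin_pos; [apply cond_pos | lra]|].
  intros t v Ht Hv; pose proof (Rmin_l d (1 - Cmod w)); pose proof (Rmin_r d (1 - Cmod w)).
  split.
  { apply Rle_lt_trans with (1 := Cmod_triangle _ _); pose proof (Cmod_segment w t Ht); lra. }
  (* The compactness statement is doubly negated, so the bound is proved by contradiction. *)
  apply Rnot_lt_le; intros Hc; apply (Hcomp t Ht); intros [s [Hs [Hts Hds]]].
  assert (HB : Cmod (K (RtoC t * w + v)%C - K (RtoC s * w)%C) < 1).
  { apply Hdel; [exact Hs|].
    replace (RtoC t * w + v - RtoC s * w)%C with (RtoC (t - s) * w + v)%C by (rewrite RtoC_minus; ring).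
    apply Rle_lt_trans with (1 := Cmod_triangle _ _); rewrite Cmod_mult, Cmod_R.
    pose proof (Rabs_pos (t - s)); nra. }
  specialize (HM s Hs); change (Rabs (Cmod (K (RtoC s * w)%C)) < M) in HM.
  rewrite Rabs_pos_eq in HM by apply Cmod_ge_0.
  pose proof (Cmod_triangle (K (RtoC t * w + v)%C - K (RtoC s * w)%C) (K (RtoC s * w)%C)) as T.
  replace (K (RtoC t * w + v)%C - K (RtoC s * w)%C + K (RtoC s * w)%C)%C with (K (RtoC t * w + v))%C in T by ring.
  lra.
Qed.

(** The primitive is the integral of [K] along the segment from [0] to [w]. It is differentiated
    under the integral sign with uniform remainders, and the derivative is recognized by integrating
    that of [s K(s w)]. *)
Lemma holomorphic_primitive K K' : der K K' -> exists P, der P K /\ P (RtoC 0) = RtoC 0.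
Proof.
  intros HK.
  exists (fun w => w * Cint (fun t => K (RtoC t * w)%C) 0 1)%C; split; [|ring].
  assert (Hin : forall w t, Cmod w < 1 -> 0 <= t <= 1 -> Cmod (RtoC t * w) < 1)
    by (intros w t Hw Ht; pose proof (Cmod_segment w t Ht); lra).
  assert (HRt : forall t, ccont RtoC t).
  { intros t; apply ccont_components; split; [apply continuous_id | apply continuous_const]. }
  assert (Hcc : forall L L' w, der L L' -> Cmod w < 1 -> ccont_on (fun t => L (RtoC t * w))%C 0 1).
  { intros L L' w HL Hw; split; [lra|]; intros t Ht.
    apply (ccont_cdiff L (fun t => RtoC t * w)%C t (L' (RtoC t * w)%C)); [now apply HL, Hin|].
    apply ccont_mult; [apply HRt | apply ccont_const]. }
  pose proof (der_der _ _ HK) as HK'.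
  intros w Hw.
  destruct (segment_bound K K' w HK Hw) as [rho [M [Hrho HB]]].
  assert (HM : 0 <= M).
  { destruct (HB 0 (RtoC 0) ltac:(lra) ltac:(rewrite Cmod_0; lra)) as [_ H].
    apply Rle_trans with (2 := H); apply Cmod_ge_0. }
  assert (Hrem : forall t v, 0 <= t <= 1 -> Cmod v <= rho / 4 ->
    Cmod (K (RtoC t * w + v)%C - (K (RtoC t * w)%C + K' (RtoC t * w)%C * v)) <= 16 * M / rho ^ 2 * Cmod v ^ 2).
  { intros t v Ht Hv.
    pose proof (cauchy_remainder (fun v => K (RtoC t * w + v)%C)%C (fun v => K' (RtoC t * w + v)%C)%C rho M v
      Hrho) as H.
    cbv beta in H; replace (RtoC t * w + RtoC 0)%C with (RtoC t * w)%C in H by ring; apply H; [| |exact Hv].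
    - intros u Hu; apply cdiff_shift, HK, (HB t u Ht Hu).
    - intros u Hu; apply (HB t u Ht Hu). }
  assert (HK'b : forall t, 0 <= t <= 1 -> Cmod (K' (RtoC t * w)%C) <= 2 * M / rho).
  { intros t Ht; replace (2 * M / rho) with (M / (rho / 2)) by (field; lra).
    apply (cauchy_estimate K (RtoC t * w)%C _ rho).
    - intros u Hu; exists (K' u); apply HK.
      destruct (HB t (u - RtoC t * w)%C Ht Hu) as [H _].
      replace (RtoC t * w + (u - RtoC t * w))%C with u in H by ring; exact H.
    - now apply HK, Hin.
    - lra.
    - intros u Hu; destruct (HB t (u - RtoC t * w)%C Ht ltac:(lra)) as [_ H].
      replace (RtoC t * w + (u - RtoC t * w))%C with u in H by ring; exact H. }
  assert (HFTC : Cint (fun t => K (RtoC t * w)%C + RtoC t * w * K' (RtoC t * w)%C)%C 0 1 = K w).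
  { pose (D := fun s => (K (s * w) + s * w * K' (s * w))%C).
    transitivity ((fun s => s * K (s * w))%C (RtoC 1) - (fun s => s * K (s * w))%C (RtoC 0))%C.
    - apply (Cint_derivative (fun s => s * K (s * w))%C D); [lra | |].
      + intros t Ht.
        assert (H1 : cdiff (fun s => s * w)%C (RtoC t) w).
        { apply (cdiff_eq _ _ _ _ (cdiff_mult _ _ _ _ _ (cdiff_id _) (cdiff_const w _))); ring. }
        apply (cdiff_eq _ _ _ _ (cdiff_mult _ _ _ _ _ (cdiff_id _)
          (cdiff_comp _ K _ _ _ H1 (HK _ (Hin w t Hw Ht))))); unfold D; ring.
      + unfold D; apply ccont_on_plus; [now apply Hcc with K'|].
        apply ccont_on_mult; [|now apply (Hcc K' _ w HK')].
        split; [lra|]; intros t _; apply ccont_mult; [apply HRt | apply ccont_const].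
    - cbv beta; rewrite !Cmult_1_l; ring. }
  intros eps Heps.
  (* The integrand of the remainder is [(w + h) E + t h^2 K'(t w)]: the first summand of [B] bounds
     the Taylor remainder [E] of [K], the second one bounds [K']. *)
  set (B := 16 * M / rho ^ 2 + 2 * M / rho).
  assert (HB0 : 0 <= 16 * M / rho ^ 2)
    by (apply Rmult_le_pos; [lra | apply Rlt_le, Rinv_0_lt_compat, pow_lt, Hrho]).
  assert (HB1 : 0 <= 2 * M / rho) by (apply Rmult_le_pos; [lra | now apply Rlt_le, Rinv_0_lt_compat]).
  exists (Rmin (Rmin (rho / 4) (1 - Cmod w)) (eps / (B + 1))); split.
  { repeat apply Rmin_pos; try lra; apply Rdiv_lt_0_compat; unfold B; lra. }
  intros h Hh.
  pose proof (Rmin_l (Rmin (rho / 4) (1 - Cmod w)) (eps / (B + 1))).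
  pose proof (Rmin_r (Rmin (rho / 4) (1 - Cmod w)) (eps / (B + 1))).
  pose proof (Rmin_l (rho / 4) (1 - Cmod w)); pose proof (Rmin_r (rho / 4) (1 - Cmod w)).
  assert (Hwh : Cmod (w + h) < 1) by (apply Rle_lt_trans with (1 := Cmod_triangle _ _); lra).
  pose proof (Hcc K K' w HK Hw) as C1; pose proof (Hcc K K' (w + h)%C HK Hwh) as C2.
  assert (C3 : ccont_on (fun t => K (RtoC t * w)%C + RtoC t * w * K' (RtoC t * w)%C)%C 0 1).
  { apply ccont_on_plus; [exact C1|]; apply ccont_on_mult; [|now apply (Hcc K' _ w HK')].
    split; [lra|]; intros t _; apply ccont_mult; [apply HRt | apply ccont_const]. }
  assert (Hk : forall c, ccont_on (fun _ => c) 0 1) by (intros; apply ccont_on_const; lra).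
  set (I1 := Cint (fun t => K (RtoC t * w)%C)%C 0 1) in *.
  set (I2 := Cint (fun t => K (RtoC t * (w + h))%C)%C 0 1) in *.
  replace ((w + h) * I2 - (w * I1 + K w * h))%C with
    (Cint (fun t => ((w + h) * K (RtoC t * (w + h))%C + (- w) * K (RtoC t * w)%C)
      + (- h) * (K (RtoC t * w)%C + RtoC t * w * K' (RtoC t * w)%C))%C 0 1).
  2:{ rewrite Cint_plus, Cint_plus, !Cint_Cmult, HFTC; [fold I1 I2; ring | ..];
        repeat (exact C1 || exact C2 || exact C3 || apply Hk || apply ccont_on_plus || apply ccont_on_mult). }
  replace (eps * Cmod h) with (eps * Cmod h * (1 - 0)) by ring.
  apply Cint_le.
  { repeat (exact C1 || exact C2 || exact C3 || apply Hk || apply ccont_on_plus || apply ccont_on_mult). }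
  intros t Ht.
  pose proof (Cmod_segment h t Ht) as Hth.
  pose proof (Hrem t (RtoC t * h)%C Ht ltac:(lra)) as HR.
  replace (RtoC t * w + RtoC t * h)%C with (RtoC t * (w + h))%C in HR by ring.
  set (E := (K (RtoC t * (w + h))%C - (K (RtoC t * w)%C + K' (RtoC t * w)%C * (RtoC t * h)))%C) in *.
  replace ((w + h) * K (RtoC t * (w + h))%C + (- w) * K (RtoC t * w)%C
      + (- h) * (K (RtoC t * w)%C + RtoC t * w * K' (RtoC t * w)%C))%C
    with ((w + h) * E + h * (RtoC t * h) * K' (RtoC t * w)%C)%C by (unfold E; ring).
  apply Rle_trans with (1 := Cmod_triangle _ _).
  rewrite (Cmod_mult (w + h)), (Cmod_mult (h * (RtoC t * h))), (Cmod_mult h).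
  specialize (HK'b t Ht).
  pose proof (Cmod_ge_0 h); pose proof (Cmod_ge_0 (RtoC t * h)); pose proof (Cmod_ge_0 E).
  pose proof (Cmod_ge_0 (w + h)); pose proof (Cmod_ge_0 (K' (RtoC t * w)%C)).
  assert (S1 : Cmod (w + h) * Cmod E <= 16 * M / rho ^ 2 * Cmod h ^ 2).
  { apply Rle_trans with (1 * Cmod E); [apply Rmult_le_compat_r; lra|]; rewrite Rmult_1_l.
    apply Rle_trans with (1 := HR); apply Rmult_le_compat_l; [exact HB0|].
    apply pow_incr; lra. }
  assert (S2 : Cmod h * Cmod (RtoC t * h) * Cmod (K' (RtoC t * w)%C) <= 2 * M / rho * Cmod h ^ 2).
  { replace (2 * M / rho * Cmod h ^ 2) with (Cmod h * Cmod h * (2 * M / rho)) by ring.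
    apply Rmult_le_compat; try assumption; [now apply Rmult_le_pos|].
    apply Rmult_le_compat_l; assumption. }
  apply Rle_trans with (B * Cmod h * Cmod h); [unfold B; lra|].
  apply Rmult_le_compat_r; [assumption|].
  apply Rle_trans with ((B + 1) * (eps / (B + 1))); [|right; field; unfold B; lra].
  apply Rmult_le_compat; unfold B in *; lra.
Qed.

(** * Slices of holomorphic maps *)

(** The quotient [f w / w] is completed by [f'(0)]; the second-order Taylor expansion of [f] shows
    that it is differentiable at the origin, with derivative [f''(0) / 2]. *)
Lemma removable_quotient f f' : der f f' -> f (RtoC 0) = RtoC 0 ->
  exists k, (exists k', der k k') /\ forall w, Cmod w < 1 -> (w * k w = f w)%C.
Proof.
  intros Hf f0.
  pose (k := fun w => if Ceq_dec w (RtoC 0) then f' (RtoC 0) else (f w / w)%C).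
  assert (Hk : forall w, w <> RtoC 0 -> k w = (f w / w)%C)
    by (intros w Hw; unfold k; destruct (Ceq_dec w (RtoC 0)); [contradiction | reflexivity]).
  assert (Hk0 : k (RtoC 0) = f' (RtoC 0))
    by (unfold k; destruct (Ceq_dec (RtoC 0) (RtoC 0)); [reflexivity | contradiction]).
  exists k; split.
  - exists (C_derive k); apply der_C_derive; intros w Hw.
    destruct (Ceq_dec w (RtoC 0)) as [-> | Hw0].
    + pose proof (der_der _ _ Hf) as Hf'.
      set (e := C_derive f' (RtoC 0)).
      exists (e / RtoC 2)%C; intros eps Heps.
      destruct (taylor_second f f' e 1 Rlt_0_1 Hf (Hf' _ Cmod_0_lt_1) eps Heps) as [del [Hdel H]].
      exists del; split; [exact Hdel|]; intros h Hh.
      replace (RtoC 0 + h)%C with h by ring; rewrite Hk0.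
      destruct (Ceq_dec h (RtoC 0)) as [-> | Hh0].
      * rewrite Hk0; replace (f' (RtoC 0) - (f' (RtoC 0) + e / RtoC 2 * RtoC 0))%C with (RtoC 0) by ring.
        rewrite Cmod_0; lra.
      * rewrite Hk by exact Hh0; specialize (H h Hh); rewrite f0 in H.
        assert (H2 : RtoC 2 <> RtoC 0) by (intros K; apply RtoC_inj in K; lra).
        pose proof (proj1 (Cmod_gt_0 _) Hh0) as Hm.
        replace (f h / h - (f' (RtoC 0) + e / RtoC 2 * h))%C
          with ((f h - (RtoC 0 + f' (RtoC 0) * h + e / RtoC 2 * (h * h))) / h)%C
          by (field; auto).
        rewrite Cmod_div by exact Hh0; apply Rle_div_l; [exact Hm|].
        apply Rle_trans with (1 := H); right; ring.
    + pose proof (proj1 (Cmod_gt_0 _) Hw0) as Hm.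
      eexists; apply cdiff_ext_near with (fun w => f w / w)%C (Cmod w); [exact Hm | |].
      * intros v Hv; symmetry; apply Hk; intros ->.
        replace (RtoC 0 - w)%C with (- w)%C in Hv by ring; rewrite Cmod_opp in Hv; lra.
      * apply cdiff_div; [exact Hw0 | now apply Hf | apply cdiff_id].
  - intros w Hw; destruct (Ceq_dec w (RtoC 0)) as [-> | Hw0].
    + rewrite f0; ring.
    + rewrite Hk by exact Hw0; field; exact Hw0.
Qed.

(** The equation prescribes the logarithmic derivative [(q - 1) / w], whose singularity at the
    origin is removable; the exponential of a primitive solves it and has no zeros. *)
Lemma starlike_function q q' : der q q' -> q (RtoC 0) = RtoC 1 ->
  exists h h', der h h' /\ h (RtoC 0) = RtoC 1 /\ forall w, Cmod w < 1 ->
    h w <> RtoC 0 /\ (w * h' w = (q w - RtoC 1) * h w)%C.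
Proof.
  intros Hq q0.
  destruct (removable_quotient (fun w => q w - RtoC 1)%C q') as [k [[k' Hk] Ek]].
  { now apply der_minus_const. }
  { rewrite q0; ring. }
  destruct (holomorphic_primitive k k' Hk) as [P [HP P0]].
  exists (fun w => Cexp (P w)), (fun w => Cexp (P w) * k w)%C; split; [|split].
  - intros w Hw; apply (cdiff_comp P Cexp); [now apply HP | apply cdiff_Cexp].
  - rewrite P0; apply Cexp_0.
  - intros w Hw; split; [apply Cexp_neq_0|]; rewrite <- Ek by exact Hw; ring.
Qed.

Lemma MultLin_complete (U V : CNormedModule) k : seq_complete V -> seq_complete (MultLin U V k).
Proof. intros HV; induction k; [exact HV | now apply Lin_seq_complete]. Qed.

Lemma Frechet_n_holomorphic {U V : CNormedModule} (G : U -> V) k :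
  seq_complete V -> holomorphic_on_ball G -> holomorphic_on_ball (V := MultLin U V k) (Frechet_n k G).
Proof.
  intros HV HG; induction k as [|k IH]; [exact HG|].
  apply (Frechet_holomorphic (V := MultLin U V k)); [now apply MultLin_complete | exact IH].
Qed.

(** Evaluation on the diagonal as a bounded operator in the multilinear map, so that it can be
    composed with derivatives. *)
Fixpoint Lin_diag {U V : CNormedModule} (k : nat) (u : U) : Lin (MultLin U V k) V :=
  match k with
  | O => mkLin V V _ is_linear_id
  | S k => Lin_comp (Lin_diag k u) (Lin_eval (V := MultLin U V k) u)
  end.

Lemma Lin_diagE {U V : CNormedModule} k (u : U) (A : MultLin U V k) : Lin_diag k u A = diag k A u.
Proof. induction k as [|k IH]; [reflexivity | exact (IH (lin_fun A u))]. Qed.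

Lemma diag_scal {U V : CNormedModule} k (c : C) (A : MultLin U V k) (u : U) :
  diag k A (scal (c : C_AbsRing) u) = scal ((c ^ k)%C : C_AbsRing) (diag k A u).
Proof.
  induction k as [|k IH]; [simpl; module_eq V|].
  change (diag k (lin_fun A (scal (c : C_AbsRing) u)) (scal (c : C_AbsRing) u)
    = scal ((c ^ S k)%C : C_AbsRing) (diag k (lin_fun A u) u)).
  rewrite IH, Lin_scalE, <- !Lin_diagE, Lin_scalE, scal_C_assoc; f_equal.
  simpl; ring.
Qed.

(** The [k]-th derivative of [w |-> l (G (w u))], as [slice_der] shows. *)
Definition slice {U V : CNormedModule} (G : U -> V) (l : Lin V C_NormedModule) (u : U) k (w : C) : C :=
  l (diag k (Frechet_n k G (scal (w : C_AbsRing) u)) u).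

Lemma slice_der {U V : CNormedModule} (G : U -> V) (l : Lin V C_NormedModule) (u : U) k :
  seq_complete V -> holomorphic_on_ball G -> norm u = 1 ->
  der (slice G l u k) (slice G l u (S k)).
Proof.
  intros HV HG Hu w Hw.
  pose proof (Frechet_n_holomorphic G k HV HG (scal (w : C_AbsRing) u)) as H.
  assert (Hin : unit_ball (scal (w : C_AbsRing) u))
    by (unfold unit_ball; rewrite norm_scal_C, Hu; lra).
  specialize (H Hin); apply Frechet_spec in H.
  pose proof (slice_cdiff (Frechet_n k G) (Frechet (Frechet_n k G) (scal (w : C_AbsRing) u))
    (Lin_comp l (Lin_diag k u)) zero u w) as K.
  rewrite plus_zero_l in K; specialize (K H).
  assert (E : forall A, Lin_comp l (Lin_diag k u) A = l (diag k A u))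
    by (intros A; simpl; now rewrite Lin_diagE).
  rewrite E in K.
  apply cdiff_ext with (2 := K); intros v; rewrite E, plus_zero_l; reflexivity.
Qed.

Lemma zmul_fdiff {U : CNormedModule} (g : U -> C) (x : U) (A : Lin U C_NormedModule) :
  fdiff (V := C_NormedModule) g x A ->
  fdiff (zmul g) x (Lin_scal_fct (g x) x A (mkLin U U _ is_linear_id)).
Proof. intros H; exact (fdiff_scal g (fun y => y) x A _ H (fdiff_lin (mkLin U U _ is_linear_id) x)). Qed.

Lemma zmul_holomorphic {U : CNormedModule} (g : U -> C) :
  holomorphic_on_ball (V := C_NormedModule) g -> holomorphic_on_ball (zmul g).
Proof.
  intros Hg x Hx; apply fdiff_ex; eexists; apply zmul_fdiff, Frechet_spec, Hg, Hx.
Qed.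

Definition direction {U : CNormedModule} (z : U) : U := scal (RtoC (/ norm z) : C_AbsRing) z.

Lemma norm_direction {U : CNormedModule} (z : U) : z <> zero -> norm (direction z) = 1.
Proof.
  intros Hz; apply norm_pos_neq0 in Hz; unfold direction.
  rewrite norm_scal_C, Cmod_R, Rabs_pos_eq; [field; lra | now apply Rlt_le, Rinv_0_lt_compat].
Qed.

Lemma direction_scal {U : CNormedModule} (z : U) : z <> zero ->
  z = scal (RtoC (norm z) : C_AbsRing) (direction z).
Proof.
  intros Hz; apply norm_pos_neq0 in Hz; unfold direction.
  rewrite scal_C_assoc, <- RtoC_mult, Rinv_r by lra; symmetry; apply scal_C_one.
Qed.

Lemma support_direction {U : CNormedModule} (z : U) (l : Lin U C_NormedModule) :
  z <> zero -> support_functional z l -> l (direction z) = RtoC 1.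
Proof.
  intros Hz [H _]; apply norm_pos_neq0 in Hz; unfold direction; rewrite Lin_scalE, H.
  change (RtoC (/ norm z) * RtoC (norm z) = RtoC 1)%C.
  rewrite <- RtoC_mult, Rinv_l by lra; reflexivity.
Qed.

Lemma normalized_coef_slice {U : CNormedModule} k (G : U -> U) (l : Lin U C_NormedModule) (z : U) :
  z <> zero ->
  normalized_coef k G l z = (slice G l (direction z) k (RtoC 0) / RtoC (INR (Factorial.fact k)))%C.
Proof.
  intros Hz; unfold normalized_coef, slice.
  rewrite scal_C_zero.
  set (A := Frechet_n k G zero).
  assert (E : diag k A z = scal ((RtoC (norm z) ^ k)%C : C_AbsRing) (diag k A (direction z)))
    by (rewrite <- diag_scal, <- direction_scal by exact Hz; reflexivity).
  rewrite E, Lin_scalE; clear E.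
  set (c := l _); change (scal ((RtoC (norm z) ^ k)%C : C_AbsRing) c) with (RtoC (norm z) ^ k * c)%C.
  apply norm_pos_neq0 in Hz.
  rewrite RtoC_mult, RtoC_pow; field; split.
  - intros E; apply RtoC_inj in E; exact (INR_fact_neq_0 k E).
  - apply Cpow_nz; intros E; apply RtoC_inj in E; lra.
Qed.

(** Since [l] is [1] on the direction of [z], the slice of [G] is [w h(w)]. The factor [w] shifts
    the order by one: the second and third derivatives at [0] are [2 h'(0)] and [3 h''(0)], to be
    divided by [2!] and [3!]. *)
Lemma zmul_coefficients (X : CBanach) (g : X -> C) (z : X) (l : Lin X C_NormedModule) h' h'' :
  holomorphic_on_ball (V := C_NormedModule) g -> z <> zero -> support_functional z l ->
  der (fun w => g (scal (w : C_AbsRing) (direction z))) h' -> der h' h'' ->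
  normalized_coef 2 (zmul g) l z = h' (RtoC 0) /\
  normalized_coef 3 (zmul g) l z = (h'' (RtoC 0) / RtoC 2)%C.
Proof.
  intros Hg Hz Hl Hh Hh'.
  assert (H2 : RtoC 2 <> RtoC 0) by (intros K; apply RtoC_inj in K; lra).
  assert (H3 : RtoC 3 <> RtoC 0) by (intros K; apply RtoC_inj in K; lra).
  pose proof (Banach_seq_complete X) as HX; pose proof (zmul_holomorphic g Hg) as HG.
  pose proof (norm_direction z Hz) as Hu; pose proof (support_direction z l Hz Hl) as Hlu.
  rewrite !normalized_coef_slice by exact Hz.
  set (u := direction z) in *.
  set (h := fun w : C => g (scal (w : C_AbsRing) u)) in *.
  assert (Hsl : forall k, der (slice (zmul g) l u k) (slice (zmul g) l u (S k)))
    by (intros k; now apply slice_der).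
  assert (E0 : forall w, Cmod w < 1 -> (w * h w)%C = slice (zmul g) l u 0 w).
  { intros w _; unfold slice, zmul; simpl; rewrite !Lin_scalE, Hlu.
    change (w * h w = h w * (w * RtoC 1))%C; ring. }
  assert (H1 : der (fun _ => RtoC 1) (fun _ => RtoC 0)) by (intros w _; apply cdiff_const).
  pose proof (der_mult _ _ _ _ der_id Hh) as D1.
  pose proof (der_plus _ _ _ _ (der_mult _ _ _ _ H1 Hh) (der_mult _ _ _ _ der_id Hh')) as D2.
  assert (H0 : der (fun _ => RtoC 0) (fun _ => RtoC 0)) by (intros w _; apply cdiff_const).
  pose proof (der_der _ _ Hh') as Hh''.
  pose proof (der_plus _ _ _ _
    (der_plus _ _ _ _ (der_mult _ _ _ _ H0 Hh) (der_mult _ _ _ _ H1 Hh'))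
    (der_plus _ _ _ _ (der_mult _ _ _ _ H1 Hh') (der_mult _ _ _ _ der_id Hh''))) as D3.
  pose proof (der_unique _ _ _ _ E0 D1 (Hsl O)) as E1.
  pose proof (der_unique _ _ _ _ E1 D2 (Hsl 1%nat)) as E2.
  pose proof (der_unique _ _ _ _ E2 D3 (Hsl 2%nat)) as E3.
  rewrite <- (E2 _ Cmod_0_lt_1), <- (E3 _ Cmod_0_lt_1); cbv beta.
  replace (INR (Factorial.fact 2)) with 2 by (simpl; ring).
  replace (INR (Factorial.fact 3)) with (2 * 3) by (simpl; ring).
  rewrite RtoC_mult.
  split; [field; exact H2|].
  replace (RtoC 3) with (RtoC 1 + RtoC 1 + RtoC 1)%C in * by (rewrite <- !RtoC_plus; f_equal; ring).
  replace (RtoC 2) with (RtoC 1 + RtoC 1)%C in * by (rewrite <- RtoC_plus; f_equal; ring).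
  field; split; assumption.
Qed.

(** * The estimate and its sharpness *)

Lemma slice_scalar_der {U : CNormedModule} (g : U -> C) (u : U) :
  holomorphic_on_ball (V := C_NormedModule) g -> norm u = 1 ->
  der (fun w => g (scal (w : C_AbsRing) u))
    (fun w => Frechet (V := C_NormedModule) g (scal (w : C_AbsRing) u) u).
Proof.
  intros Hg Hu w Hw.
  assert (Hin : unit_ball (scal (w : C_AbsRing) u))
    by (unfold unit_ball; rewrite norm_scal_C, Hu; lra).
  pose proof (slice_cdiff (V := C_NormedModule) g (Frechet (V := C_NormedModule) g (scal (w : C_AbsRing) u))
    (mkLin _ _ _ is_linear_id) zero u w) as K.
  rewrite plus_zero_l in K; specialize (K (Frechet_spec (V := C_NormedModule) _ _ (Hg _ Hin))).
  apply cdiff_ext with (2 := K); intros v; simpl; rewrite plus_zero_l; reflexivity.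
Qed.

Lemma Lin_inv_spec {U : CNormedModule} (A : Lin U U) : invertible A -> is_inverse A (Lin_inv A).
Proof. intros H; exact (epsilon_spec (inhabits (Lin_zero U U)) (is_inverse A) H). Qed.

(* [DG(x) x = (g(x) + Dg(x) x) x], hence [DG(x)^-1 G(x) = g(x) / (g(x) + Dg(x) x) x]. *)
Lemma zmul_quotient {U : CNormedModule} (Phi : C -> C) (g : U -> C) (x : U)
    (l : Lin U C_NormedModule) : admissible Phi g ->
  unit_ball x -> x <> zero -> support_functional x l ->
  g x <> RtoC 0 /\ disk_image Phi (RtoC 1 + Frechet (V := C_NormedModule) g x x / g x)%C.
Proof.
  intros [Hg [_ [Hinv [_ [_ [_ HM]]]]]] Hx Hx0 Hl.
  destruct (HM x l Hx Hx0 Hl) as [H0 Hi].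
  pose proof (Lin_inv_spec _ (Hinv x Hx)) as [_ HB].
  set (B := Lin_inv (Frechet (zmul g) x)) in *.
  set (A := Frechet (V := C_NormedModule) g x) in *.
  assert (HD : Frechet (zmul g) x x = scal ((A x + g x)%C : C_AbsRing) x).
  { rewrite (Frechet_eq _ _ _ (zmul_fdiff g x A (Frechet_spec (V := C_NormedModule) g x (Hg x Hx)))).
    change (plus (scal (A x : C_AbsRing) x) (scal (g x : C_AbsRing) x)
      = scal ((A x + g x)%C : C_AbsRing) x); module_eq U. }
  pose proof (HB x) as HBx; rewrite HD, Lin_scalE in HBx.
  set (kap := (A x + g x)%C) in *.
  destruct Hl as [Hlx _].
  (* Applying [l] to [kap B x = x] gives [kap l(B x) = norm x], so the quotient in [class_M] is
     [kap / g x]. *)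
  pose proof (f_equal l HBx) as E; rewrite Lin_scalE, Hlx in E.
  change (kap * l (B x) = RtoC (norm x))%C in E.
  unfold zmul in H0, Hi; rewrite !Lin_scalE in H0, Hi.
  change (g x * l (B x) <> RtoC 0)%C in H0.
  change (disk_image Phi (RtoC (norm x) / (g x * l (B x)))%C) in Hi.
  assert (Hgx : g x <> RtoC 0) by (intros K; apply H0; rewrite K; ring).
  assert (HlB : l (B x) <> RtoC 0) by (intros K; apply H0; rewrite K; ring).
  split; [exact Hgx|].
  replace (RtoC 1 + A x / g x)%C with (RtoC (norm x) / (g x * l (B x)))%C; [exact Hi|].
  rewrite <- E; unfold kap; field; auto.
Qed.

(** At [w u] with [w <> 0] a support functional is [c l], where [c = conj w / |w|], and
    [zmul_quotient] applies with it. At the origin the value is [1 = Phi 0]. *)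
Lemma admissible_slice {U : CNormedModule} (Phi : C -> C) (g : U -> C) (u : U)
    (l : Lin U C_NormedModule) : Phi (RtoC 0) = RtoC 1 -> admissible Phi g ->
  norm u = 1 -> support_functional u l -> forall w, Cmod w < 1 ->
  g (scal (w : C_AbsRing) u) <> RtoC 0 /\
  disk_image Phi (RtoC 1 + w * Frechet (V := C_NormedModule) g (scal (w : C_AbsRing) u) u
    / g (scal (w : C_AbsRing) u))%C.
Proof.
  intros Phi_0 Hg Hu [Hlu Hln] w Hw.
  destruct (Ceq_dec w (RtoC 0)) as [-> | Hw0].
  - rewrite scal_C_zero, (proj1 (proj2 Hg)); split; [intros E; apply RtoC_inj in E; lra|].
    exists (RtoC 0); split; [exact Cmod_0_lt_1|]; rewrite Phi_0; field.
  - pose proof (proj1 (Cmod_gt_0 _) Hw0) as Hm.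
    assert (Hm0 : RtoC (Cmod w) <> RtoC 0) by (intros E; apply RtoC_inj in E; lra).
    set (x := scal (w : C_AbsRing) u).
    assert (Hx : norm x = Cmod w) by (unfold x; rewrite norm_scal_C, Hu; ring).
    set (c := (Cconj w / RtoC (Cmod w))%C).
    assert (Hc : Cmod c = 1)
      by (unfold c; rewrite Cmod_div, Cmod_conj, Cmod_R, Rabs_pos_eq by (assumption || lra); field; lra).
    destruct (zmul_quotient Phi g x (Lin_scal U C_NormedModule c l) Hg) as [H1 H2].
    + unfold unit_ball; lra.
    + apply norm_pos_inv; lra.
    + split.
      * change (c * l x = RtoC (norm x))%C; rewrite Hx; unfold x; rewrite Lin_scalE, Hlu, Hu.
        change (c * (w * RtoC 1) = RtoC (Cmod w))%C; unfold c.
        transitivity ((w * Cconj w) / RtoC (Cmod w))%C; [field; exact Hm0|].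
        rewrite <- Cmod2_conj, <- RtoC_div by lra; f_equal; field; lra.
      * transitivity (Cmod c * norm l); [exact (norm_scal_C (V := Lin_NormedModule U C_NormedModule) c l)|].
        rewrite Hc, Hln; ring.
    + split; [exact H1|].
      unfold x in H2 at 2; rewrite Lin_scalE in H2; exact H2.
Qed.

Lemma support_of_direction {U : CNormedModule} (z : U) (l : Lin U C_NormedModule) :
  z <> zero -> support_functional z l -> support_functional (direction z) l.
Proof.
  intros Hz Hl; split; [|apply Hl].
  rewrite norm_direction, (support_direction z l Hz Hl) by exact Hz; reflexivity.
Qed.

Lemma upper_bound (X : CBanach) (Phi : C -> C) (a b : R) :
  biholomorphic_onto_image Phi -> Phi (RtoC 0) = RtoC 1 -> C_derive Phi (RtoC 0) = RtoC a -> 0 < a ->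
  C_derive (C_derive Phi) (RtoC 0) = RtoC b -> Rabs (b + 2 * a ^ 2) >= 2 * a ->
  forall g : X -> C, admissible Phi g ->
  forall (z : X) (l : Lin X C_NormedModule), z <> zero -> support_functional z l ->
  Cmod (normalized_coef 2 (zmul g) l z ^ 2 - normalized_coef 3 (zmul g) l z ^ 2)%C
    <= a ^ 2 / 4 * (1 / 2 * (b / a) + a) ^ 2 + a ^ 2.
Proof.
  intros HPhi Phi_0 Phi_d1 a_pos Phi_d2 Hab g Hg z l Hz Hl.
  pose proof (norm_direction z Hz) as Hu.
  pose proof (slice_scalar_der g (direction z) (proj1 Hg) Hu) as Hh.
  pose proof (der_der _ _ Hh) as Hh'.
  destruct (zmul_coefficients X g z l _ _ (proj1 Hg) Hz Hl Hh Hh') as [-> ->].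
  apply (coefficient_bound Phi a b HPhi Phi_0 Phi_d1 a_pos Phi_d2 _ _ _ Hab Hh Hh').
  - rewrite scal_C_zero; apply Hg.
  - intros w Hw; exact (admissible_slice Phi g (direction z) l Phi_0 Hg Hu
      (support_of_direction z l Hz Hl) w Hw).
Qed.

Section Extremal_map.

Context {U : CNormedModule}.
Variables (l : Lin U C_NormedModule) (Phi : C -> C) (q h h' : C -> C).
Hypothesis Hl : forall x, Cmod (l x) <= norm x.
Hypothesis Hh : der h h'.
Hypothesis h0 : h (RtoC 0) = RtoC 1.
Hypothesis hnz : forall w, Cmod w < 1 -> h w <> RtoC 0.
Hypothesis Hq : exists q', der q q'.
Hypothesis q0 : q (RtoC 0) = RtoC 1.
Hypothesis qnz : forall w, Cmod w < 1 -> q w <> RtoC 0.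
Hypothesis q_image : forall w, Cmod w < 1 -> disk_image Phi (q w).
Hypothesis Hode : forall w, Cmod w < 1 -> (w * h' w = (q w - RtoC 1) * h w)%C.

(** Dependence through [l] alone makes [DG(x)] a multiple of the identity plus a rank-one operator,
    so that its inverse is explicit and [DG(x)^-1 G(x) = x / q(l x)]. *)
Let g (x : U) : C := h (l x).

Lemma functional_disk x : unit_ball x -> Cmod (l x) < 1.
Proof. intros Hx; apply Rle_lt_trans with (1 := Hl x); exact Hx. Qed.

Lemma comp_functional_fdiff f f' x : der f f' -> unit_ball x ->
  fdiff (V := C_NormedModule) (fun y => f (l y)) x (Lin_comp (Cmul (f' (l x))) l).
Proof.
  intros Hf Hx; apply (fdiff_comp (V := C_NormedModule) l f); [apply fdiff_lin|].
  apply cdiff_fdiff, Hf, functional_disk, Hx.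
Qed.

Lemma zmul_derivative x : unit_ball x -> forall v, Frechet (zmul g) x v =
  plus (scal ((h' (l x) * l v)%C : C_AbsRing) x) (scal (h (l x) : C_AbsRing) v).
Proof.
  intros Hx v.
  rewrite (Frechet_eq _ _ _ (zmul_fdiff g x _ (comp_functional_fdiff h h' x Hh Hx))); reflexivity.
Qed.

(* Solves [v |-> h'(l x) l(v) x + h(l x) v = y], using [h + w h' = q h]. *)
Lemma inverse_linear x : is_linear (fun y : U =>
  plus (scal ((- (h' (l x) * / (q (l x) * h (l x) * h (l x))) * l y)%C : C_AbsRing) x)
    (scal ((/ h (l x))%C : C_AbsRing) y)).
Proof.
  exact (lin_is_linear (Lin_scal_fct (U := U) (V := U) (/ h (l x))%C x
    (Lin_comp (Cmul (- (h' (l x) * / (q (l x) * h (l x) * h (l x))))%C) l) (mkLin U U _ is_linear_id))).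
Qed.

Lemma zmul_inverse x : unit_ball x ->
  is_inverse (Frechet (zmul g) x) (mkLin U U _ (inverse_linear x)).
Proof.
  intros Hx; pose proof (functional_disk x Hx) as Hw.
  set (w := l x) in *.
  pose proof (hnz w Hw) as H1; pose proof (qnz w Hw) as H2.
  assert (E : (h' w * w = (q w - RtoC 1) * h w)%C) by (rewrite <- Hode by exact Hw; ring).
  assert (El : forall (al be : C) v,
    l (plus (scal (al : C_AbsRing) x) (scal (be : C_AbsRing) v)) = (al * w + be * l v)%C)
    by (intros al be v; etransitivity; [exact (Lin_plusE l _ _) | rewrite !Lin_scalE; reflexivity]).
  split; intros y; rewrite !zmul_derivative by exact Hx; simpl; fold w; rewrite El;
    set (p := l y); module_coefs U; try (field; auto);
    (* The coefficient of [x] must vanish, and [E], the differential equation for [h], is what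
       cancels it. *)
    (transitivity (p * h' w * (RtoC 1 / h w - RtoC 1 / (q w * h w)
        - (h' w * w) / (q w * h w * h w)))%C; [field; auto | rewrite E; field; auto]).
Qed.

Lemma is_inverse_unique (A B B' : Lin U U) : is_inverse A B -> is_inverse A B' -> B = B'.
Proof.
  intros [_ H1] [H2 _]; apply Lin_ext; intros x; rewrite <- (H2 x) at 1; apply H1.
Qed.

Lemma zmul_quotient_value x : unit_ball x ->
  Lin_inv (Frechet (zmul g) x) (zmul g x) = scal ((/ q (l x))%C : C_AbsRing) x.
Proof.
  intros Hx; pose proof (zmul_inverse x Hx) as HI.
  rewrite (is_inverse_unique _ _ _ (Lin_inv_spec _ (ex_intro _ _ HI)) HI).
  pose proof (functional_disk x Hx) as Hw; unfold zmul, g; simpl.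
  rewrite Lin_scalE; set (w := l x) in *.
  change (scal (h w : C_AbsRing) w) with (h w * w)%C.
  pose proof (hnz w Hw) as H1; pose proof (qnz w Hw) as H2.
  assert (E : (h' w * w = (q w - RtoC 1) * h w)%C) by (rewrite <- Hode by exact Hw; ring).
  module_coefs U.
  transitivity (RtoC 1 - (h' w * w) / (q w * h w))%C; [field; auto | rewrite E; field; auto].
Qed.

Lemma extremal_admissible : admissible Phi g.
Proof.
  destruct Hq as [q' Hq'].
  assert (Hr : exists r', der (fun w => / q w)%C r').
  { eexists; intros w Hw; apply (cdiff_comp q Cinv); [now apply Hq' | apply cdiff_inv, qnz, Hw]. }
  destruct Hr as [r' Hr].
  assert (Hp : forall x, unit_ball x -> exists A : Lin U U, (x = zero -> forall v, A v = v) /\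
    fdiff (fun z => Lin_inv (Frechet (zmul g) z) (zmul g z)) x A).
  { intros x Hx.
    pose proof (zmul_fdiff (fun y => / q (l y))%C x _ (comp_functional_fdiff _ _ x Hr Hx)) as H.
    eexists; split; [|apply (fdiff_ext_near _ _ _ _ (1 - norm x)) with (3 := H)].
    - intros -> v; simpl.
      rewrite Lin_zeroE; change (lin_fun l zero) with (l zero).
      change (q zero) with (q (RtoC 0)); rewrite q0; module_coefs U; field;
        intros K; apply RtoC_inj in K; lra.
    - unfold unit_ball in Hx; lra.
    (* The formula for the quotient holds on the whole open ball, so it may be differentiated at
       [x]. *)
    - intros k Hk; symmetry; apply zmul_quotient_value.
      apply Rle_lt_trans with (1 := norm_triangle _ _); lra. }
  assert (Hzero : unit_ball (zero : U)) by (unfold unit_ball; rewrite norm_zero; lra).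
  split; [|split; [|split; [|split; [|split; [|split]]]]].
  - intros x Hx; apply fdiff_ex; eexists; exact (comp_functional_fdiff h h' x Hh Hx).
  - unfold g; rewrite Lin_zeroE; exact h0.
  - intros x Hx; eexists; apply zmul_inverse, Hx.
  - intros x Hx; apply fdiff_ex; destruct (Hp x Hx) as [A [_ HA]]; now exists A.
  - rewrite zmul_quotient_value by exact Hzero; module_eq U.
  - intros v; destruct (Hp zero Hzero) as [A [HA1 HA2]].
    rewrite (Frechet_eq _ _ _ HA2); now apply HA1.
  - intros x k Hx Hx0 [Hk _]; rewrite zmul_quotient_value by exact Hx.
    rewrite Lin_scalE, Hk; pose proof (functional_disk x Hx) as Hw.
    pose proof (qnz _ Hw) as H2; apply norm_pos_neq0 in Hx0.
    assert (Hn : RtoC (norm x) <> RtoC 0) by (intros E; apply RtoC_inj in E; lra).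
    change (scal ((/ q (l x))%C : C_AbsRing) (RtoC (norm x))) with (/ q (l x) * RtoC (norm x))%C.
    split.
    + apply Cmult_neq_0; [|exact Hn].
      intros E; apply (f_equal (Cmult (q (l x)))) in E; rewrite Cinv_r, Cmult_0_r in E by exact H2.
      apply RtoC_inj in E; lra.
    + replace (RtoC (norm x) / (/ q (l x) * RtoC (norm x)))%C with (q (l x)) by (field; auto).
      now apply q_image.
Qed.

End Extremal_map.

Lemma sharpness (X : CBanach) (Phi : C -> C) (a b : R) : (exists x : X, x <> zero) ->
  biholomorphic_onto_image Phi -> Phi (RtoC 0) = RtoC 1 ->
  (forall u, unit_disk u -> 0 < Re (Phi u)) -> C_derive Phi (RtoC 0) = RtoC a -> 0 < a ->
  C_derive (C_derive Phi) (RtoC 0) = RtoC b ->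
  exists g : X -> C, admissible Phi g /\
    exists (z : X) (l : Lin X C_NormedModule),
      unit_ball z /\ z <> zero /\ support_functional z l /\
      Cmod (normalized_coef 2 (zmul g) l z ^ 2 - normalized_coef 3 (zmul g) l z ^ 2)%C
        = a ^ 2 / 4 * (1 / 2 * (b / a) + a) ^ 2 + a ^ 2.
Proof.
  intros [x Hx] HPhi Phi_0 Phi_Re Phi_d1 a_pos Phi_d2.
  set (u := direction x); pose proof (norm_direction x Hx) as Hu; fold u in Hu.
  assert (HCi : Cmod Ci = 1) by (unfold Cmod, Ci; simpl;
    replace (0 * (0 * 1) + 1 * (1 * 1)) with 1 by ring; apply sqrt_1).
  assert (Hdisk : forall w, Cmod w < 1 -> Cmod (Ci * w) < 1)
    by (intros w Hw; rewrite Cmod_mult, HCi; lra).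
  pose (om := fun w => (Ci * w)%C).
  assert (Hom : der om (fun _ => Ci)).
  { intros w _; apply (cdiff_eq _ _ _ _ (cdiff_scal Ci _ _ _ (cdiff_id w))); ring. }
  assert (Hom' : der (fun _ => Ci) (fun _ => RtoC 0)) by (intros w _; apply cdiff_const).
  pose (q := fun w => Phi (om w)).
  assert (Hq : der q (fun w => C_derive Phi (om w) * Ci)%C).
  { intros w Hw; apply (cdiff_comp om Phi); [now apply Hom | now apply (Phi_der Phi HPhi), Hdisk]. }
  assert (om0 : om (RtoC 0) = RtoC 0) by (unfold om; ring).
  assert (q0 : q (RtoC 0) = RtoC 1) by (unfold q; rewrite om0; exact Phi_0).
  destruct (starlike_function q _ Hq q0) as [h [h' [Hh [h0 Hode]]]].
  pose proof (der_der _ _ Hh) as Hh'.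
  (* Positivity of the real part enters here: the inverse of [DG] divides by [q]. *)
  assert (qnz : forall w, Cmod w < 1 -> q w <> RtoC 0).
  { intros w Hw E; pose proof (Phi_Re _ (Hdisk w Hw)) as K.
    change (Phi (Ci * w)%C) with (q w) in K; rewrite E in K; simpl in K; lra. }
  assert (Hu0 : u <> zero) by (apply norm_pos_inv; lra).
  destruct (support_functional_exists u Hu0) as [l Hl].
  (* The normalized coefficients depend only on the direction; the factor [1 / 2] merely places [z]
     inside the ball. *)
  set (z := scal (RtoC (/ 2) : C_AbsRing) u).
  assert (Hzn : norm z = / 2)
    by (unfold z; rewrite norm_scal_C, Hu, Cmod_R, Rabs_pos_eq by lra; ring).
  assert (Hz0 : z <> zero) by (apply norm_pos_inv; lra).
  assert (Hlz : support_functional z l).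
  { split; [|apply Hl]; unfold z at 1; rewrite Lin_scalE, (proj1 Hl), Hu, Hzn.
    change (RtoC (/ 2) * RtoC 1 = RtoC (/ 2))%C; ring. }
  assert (Hlx : forall y, Cmod (l y) <= norm y).
  { intros y; pose proof (Lin_norm_apply l y) as K; rewrite (proj2 Hl), Rmult_1_l in K; exact K. }
  assert (Hadm : admissible Phi (fun y => h (l y))).
  { apply (extremal_admissible l Phi q h h'); try assumption.
    - intros w Hw; apply Hode, Hw.
    - now exists (fun w => C_derive Phi (om w) * Ci)%C.
    - intros w Hw; exists (Ci * w)%C; split; [now apply Hdisk | reflexivity].
    - intros w Hw; apply Hode, Hw. }
  exists (fun y => h (l y)); split; [exact Hadm|].
  exists z, l; split; [unfold unit_ball; lra|]; split; [exact Hz0|]; split; [exact Hlz|].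
  assert (Hsl : forall w, h (l (scal (w : C_AbsRing) (direction z))) = h w).
  { intros w; rewrite Lin_scalE, (support_direction z l Hz0 Hlz).
    change (h (w * RtoC 1)%C = h w); f_equal; ring. }
  assert (Hhs : der (fun w => h (l (scal (w : C_AbsRing) (direction z)))) h').
  { intros w Hw; apply cdiff_ext with h; [intros v; symmetry; apply Hsl | now apply Hh]. }
  destruct (zmul_coefficients X _ z l _ _ (proj1 Hadm) Hz0 Hlz Hhs Hh') as [-> ->].
  destruct (subordination_coefficients Phi a b HPhi Phi_0 Phi_d1 a_pos Phi_d2
    h h' _ om _ _ Hh Hh' Hom Hom' h0 om0) as [-> ->].
  { exact Hdisk. }
  { intros w Hw; apply Hode, Hw. }
  assert (HC2 : (Ci * Ci)%C = (- RtoC 1)%C)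
    by (unfold Ci, Cmult, Copp, RtoC; simpl; f_equal; ring).
  set (lam := 1 / 2 * (b / a) + a).
  rewrite HC2.
  (* Here [w1 = i] and [w2 = 0]: the coefficients are [a i] and [- a lam / 2], so their squares
     [- a^2] and [a^2 lam^2 / 4] have opposite signs and the moduli add up. *)
  replace ((RtoC a * Ci) ^ 2 - (RtoC (a / 2) * (RtoC 0 / RtoC 2 + RtoC lam * - RtoC 1)) ^ 2)%C
    with (RtoC (- (a ^ 2 / 4 * lam ^ 2 + a ^ 2))).
  - rewrite Cmod_R, Rabs_Ropp; apply Rabs_pos_eq.
    pose proof (pow2_ge_0 a); pose proof (pow2_ge_0 lam); nra.
  - transitivity (RtoC (a * a) * (Ci * Ci) - RtoC ((a / 2) * (a / 2)) * RtoC (lam * lam))%C.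
    + rewrite HC2; replace (- (a ^ 2 / 4 * lam ^ 2 + a ^ 2))
        with (- (a * a) - (a / 2 * (a / 2)) * (lam * lam)) by field.
      rewrite RtoC_minus, RtoC_opp, (RtoC_mult (a / 2 * (a / 2))); ring.
    + rewrite !RtoC_mult; unfold Cdiv; simpl; ring.
Qed.

Theorem theorem2p4 (X : CBanach) (X_nonzero : exists x : X, x <> zero)
    (Phi : C -> C) (a b : R)
    (Phi_biholomorphic : biholomorphic_onto_image Phi)
    (Phi_0 : Phi (RtoC 0) = RtoC 1)
    (Phi_Re : forall u : C, unit_disk u -> 0 < Re (Phi u))
    (Phi_d1 : C_derive Phi (RtoC 0) = RtoC a)
    (a_pos : 0 < a)
    (Phi_d2 : C_derive (C_derive Phi) (RtoC 0) = RtoC b)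
    (Hab : Rabs (b + 2 * a ^ 2) >= 2 * a) :
  (forall g : X -> C, admissible Phi g ->
     forall (z : X) (l : Lin X C_NormedModule),
       unit_ball z -> z <> zero -> support_functional z l ->
       Cmod (normalized_coef 2 (zmul g) l z ^ 2
             - normalized_coef 3 (zmul g) l z ^ 2)%C
       <= a ^ 2 / 4 * (1 / 2 * (b / a) + a) ^ 2 + a ^ 2)
  /\
  (exists g : X -> C, admissible Phi g /\
     exists (z : X) (l : Lin X C_NormedModule),
       unit_ball z /\ z <> zero /\ support_functional z l /\
       Cmod (normalized_coef 2 (zmul g) l z ^ 2
             - normalized_coef 3 (zmul g) l z ^ 2)%C
       = a ^ 2 / 4 * (1 / 2 * (b / a) + a) ^ 2 + a ^ 2).
Proof.
  split.
  - intros g Hg z l _ Hz Hl.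
    exact (upper_bound X Phi a b Phi_biholomorphic Phi_0 Phi_d1 a_pos Phi_d2 Hab g Hg z l Hz Hl).
  - exact (sharpness X Phi a b X_nonzero Phi_biholomorphic Phi_0 Phi_Re Phi_d1 a_pos Phi_d2).
Qed.
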